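(* Let $k$ be a commutative ring, $A$ a unital cdg algebra over $k$, $C$ a counital dg coalgebra over $k$, and $\tau$ a solution of the Maurer-Cartan equation in $\mathrm{Hom}^\bullet_k(C,A)$. Then the bar construction $R:=\,?\otimes_\tau C:\mathcal CA\to\mathsf{Com}\,C$ and the cobar construction $L:=\,?\otimes_\tau A:\mathsf{Com}\,C\to\mathcal CA$ form a pair of adjoint exact functors between Frobenius categories, $L$ being left adjoint to $R$. In particular, there are isomorphisms $$(\mathcal HA)(LN,M)\cong H^0F_\tau(\mathrm{Hom}^\bullet_k(N,M))\cong(\mathcal HC)(N,RM)$$ natural in $N\in\mathsf{Com}\,C$ and $M\in\mathcal CA$.
   Context: $k$ is a commutative associative unital ring; graded means $\mathbf Z$-graded; $\otimes=\otimes_k$; Koszul sign rule $(f\otimes g)(u\otimes v)=(-1)^{|g||u|}f(u)\otimes g(v)$. A unital cdg (curved dg) algebra is a unital graded associative $k$-algebra $A$ (multiplication $m_2$) with $c\in A^2$ and a degree $1$ map $d=m_1:A\to A$ with $d(c)=0$, $d(d(a))=ca-ac$, $d(ab)=d(a)b+(-1)^{|a|}a\,d(b)$. A unital (right) cdg $A$-module is a unital graded right $A$-module $M$ (action $m_2^M$) with a degree $1$ map $d_M$ with $d_M(ma)=d_M(m)a+(-1)^{|m|}m\,d(a)$ and $d_M(d_M(m))=-mc$. $\mathcal CA$ is the category of unital cdg $A$-modules with degree $0$ $A$-linear maps commuting with the $d$'s. It is a Frobenius category: conflations are the short exact sequences which split as sequences of graded $A$-modules; $M$ is projective-injective iff $\mathbf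 1_M=d_Mh+hd_M$ for some degree $-1$ morphism $h$ of graded $A$-modules. Its stable category $\mathcal HA$ is the quotient by null-homotopic morphisms (those of the form $d h+h d$). A counital dg coalgebra is $(C,d_C,\Delta,\eta)$ with counit $\eta$ and square-zero degree $1$ coderivation $d_C$. $\mathsf{Com}\,C$ is the category of counital dg right $C$-comodules $(N,d_N,\Delta_N)$; it is a Frobenius category with conflations the short exact sequences split in graded $C$-comodules, and stable category $\mathcal HC$, the quotient by null-homotopic morphisms (via degree $-1$ graded comodule maps). Exact functor: preserves conflations. A solution of the Maurer-Cartan equation in $\mathrm{Hom}^\bullet_k(C,A)$ is a degree $1$ map $\tau:C\to A$ with $c\,\eta(-)+(m_1\tau+\tau d_C)+m_2(\tau\otimes\tau)\Delta=0$. $M\otimes_\tau C$ is the graded comodule $(M\otimes C,\mathbf 1\otimes\Delta)$ with codifferential $d_M\otimes\mathbf 1+\mathbf 1\otimes d_C-(m_2^M\otimes\mathbf 1)(\mathbf 1\otimes\tau\otimes\mathbf 1)(\mathbf 1\otimes\Delta)$. $N\otimes_\tau A$ is the graded module $(N\otimes A,\mathbf 1\otimes m_2)$ with predifferential $d_N\otimes\mathbf 1+\mathbf 1\otimes m_1+(\mathbf 1\otimes m_2)(\mathbf 1\otimes\tau\otimes\mathbf 1)(\Delta_N\otimes\mathbf 1)$. $F_\tau(\mathrm{Hom}^\bullet_k(N,M))$ is the complex with underlying graded module $\mathrm{Hom}^\bullet_k(N,M)$ (homogeneous $k$-linear maps) and differential $d_\tau(f)=d_Mf-(-1)^{|f|}fd_N+(-1)^{|f|+1}m_2^M(f\otimes\tau)\Delta_N$.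 *)

(* Defs.v *)
From HB Require Import structures.
From mathcomp Require Import all_boot all_order all_algebra.
From mathcomp Require Import boolp functions.

Set Implicit Arguments.
Unset Strict Implicit.
Unset Printing Implicit Defensive.

Import GRing.Theory.
Local Open Scope quotient_scope.
Local Open Scope ring_scope.

(** * Submodules and quotient modules *)

Section LinFacts.
Variables (k : pzRingType) (V W : lmodType k) (f : V -> W).
Hypothesis fl : linear f.

Lemma lin0 : f 0 = 0.
Proof. by have := fl (-1) 0 0; rewrite scaler0 addr0 scaleN1r addNr. Qed.

Lemma linD u v : f (u + v) = f u + f v.
Proof. by have := fl 1 u v; rewrite !scale1r. Qed.

Lemma linZ a u : f (a *: u) = a *: f u.
Proof. by have := fl a u 0; rewrite lin0 !addr0. Qed.

Lemma linN u : f (- u) = - f u.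
Proof. by rewrite -scaleN1r linZ scaleN1r. Qed.

Lemma linB u v : f (u - v) = f u - f v.
Proof. by rewrite linD linN. Qed.

Lemma lin_sum I (r : seq I) (F : I -> V) :
  f (\sum_(i <- r) F i) = \sum_(i <- r) f (F i).
Proof. exact: (big_morph f linD lin0). Qed.
End LinFacts.

Record submod (k : pzRingType) (V : lmodType k) := Submod {
  sm_mem :> V -> Prop;
  sm0 : sm_mem 0;
  sm_lin : forall a u v, sm_mem u -> sm_mem v -> sm_mem (a *: u + v) }.

Section Submodules.
Variables (k : pzRingType) (V : lmodType k) (S : submod V).

Definition sm_pred : {pred V} := fun v => `[< S v >].

Lemma sm_predP v : reflect (S v) (v \in sm_pred).
Proof. exact: asboolP. Qed.

Lemma sm_pred_closed : submod_closed sm_pred.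
Proof.
split; first exact/sm_predP/sm0.
by move=> a u v /sm_predP Su /sm_predP Sv; apply/sm_predP/sm_lin.
Qed.

HB.instance Definition _ := GRing.isSubmodClosed.Build k V sm_pred
  sm_pred_closed.

Definition smT := {v : V | sm_pred v}.
HB.instance Definition _ := SubChoice.on smT.
HB.instance Definition _ := [SubChoice_isSubLmodule of smT by <:].

Definition smI (v : V) (Sv : S v) : smT := exist _ v (introT (sm_predP v) Sv).

Lemma smP (x : smT) : S (val x).
Proof. exact/sm_predP/(valP x). Qed.

Lemma val_lin : linear (val : smT -> V).
Proof. by move=> a x y; rewrite linearP. Qed.

Definition quotM := Quotient.quot sm_pred.
HB.instance Definition _ := GRing.Zmodule.on quotM.

Definition qproj (v : V) : quotM := \pi_quotM v.
Definition qrepr (x : quotM) : V := repr x.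

Lemma qreprK x : qproj (qrepr x) = x.
Proof. exact: reprK. Qed.

Lemma qprojE u v : qproj u = qproj v <-> S (u - v).
Proof.
have e := Quotient.idealrBE sm_pred u v.
by split=> [/eqP h|/sm_predP h]; [apply/sm_predP; rewrite e | apply/eqP; rewrite -e].
Qed.

Lemma qprojD u v : qproj (u + v) = qproj u + qproj v.
Proof. exact: Quotient.pi_add. Qed.

Definition qscale (a : k) (x : quotM) : quotM := qproj (a *: qrepr x).

Lemma qprojZ a v : qproj (a *: v) = qscale a (qproj v).
Proof.
apply/qprojE; rewrite -scalerBr -[_ *: _]addr0; apply: sm_lin (sm0 S).
by apply/qprojE; rewrite qreprK.
Qed.

Lemma qscaleA a b x : qscale a (qscale b x) = qscale (a * b) x.
Proof. by rewrite -[x]qreprK -!qprojZ scalerA. Qed.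
Lemma qscale1 : left_id 1 qscale.
Proof. by move=> x; rewrite -[x]qreprK -!qprojZ scale1r. Qed.
Lemma qscaleDr : right_distributive qscale +%R.
Proof.
by move=> a x y; rewrite -[x]qreprK -[y]qreprK -qprojD -!qprojZ -qprojD scalerDr.
Qed.
Lemma qscaleDl x : {morph qscale^~ x : a b / a + b}.
Proof. by move=> a b; rewrite -[x]qreprK -!qprojZ -qprojD scalerDl. Qed.

HB.instance Definition _ :=
  GRing.Zmodule_isLmodule.Build k quotM qscaleA qscale1 qscaleDr qscaleDl.

Lemma qproj_lin : linear qproj.
Proof. by move=> a u v; rewrite qprojD qprojZ. Qed.

End Submodules.

Section Qmap.
Variables (k : pzRingType) (V W : lmodType k) (S : submod V) (T : submod W).
Variable f : V -> W.

(** Only meaningful when [f] is linear and maps [S] into [T]. *)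
Definition qmap (x : quotM S) : quotM T := qproj T (f (qrepr x)).

Hypothesis fl : linear f.
Hypothesis fS : forall v, S v -> T (f v).

Lemma qmapE v : qmap (qproj S v) = qproj T (f v).
Proof. by apply/qprojE; rewrite -linB //; apply/fS/qprojE; rewrite qreprK. Qed.

Lemma qmap_lin : linear qmap.
Proof.
move=> a x y; rewrite -[x]qreprK -[y]qreprK -qproj_lin !qmapE fl.
exact: qproj_lin.
Qed.
End Qmap.

(** * Tensor products over [k]

[tens V W] consists of finite formal sums of pairs [(v, w)] modulo the
congruence generated by bilinearity. *)

Section Tensor.
Variables (k : comPzRingType) (V W : lmodType k).

Inductive teq : seq (V * W) -> seq (V * W) -> Prop :=
| teq_refl s : teq s s
| teq_sym s t : teq s t -> teq t s
| teq_trans s t u : teq s t -> teq t u -> teq s u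
| teq_cat s s' t t' : teq s s' -> teq t t' -> teq (s ++ t) (s' ++ t')
| teq_catC s t : teq (s ++ t) (t ++ s)
| teq_addl v v' w : teq [:: (v + v', w)] [:: (v, w); (v', w)]
| teq_addr v w w' : teq [:: (v, w + w')] [:: (v, w); (v, w')]
| teq_scale a v w : teq [:: (a *: v, w)] [:: (v, a *: w)]
| teq_zero w : teq [:: (0, w)] [::].

Definition teqb (s t : seq (V * W)) := `[< teq s t >].

Lemma teqb_equiv : equiv_class_of teqb.
Proof.
split=> [s|s t|t s u]; first exact/asboolP/teq_refl.
- by apply/asboolP/asboolP => /teq_sym.
- by move=> /asboolP h1 /asboolP h2; apply/asboolP/(teq_trans h1 h2).
Qed.

Canonical teqb_equivrel := EquivRelPack teqb_equiv.
Canonical teqb_encModRel := defaultEncModRel teqb.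

Definition tens := {eq_quot teqb}.
HB.instance Definition _ := Choice.on tens.
HB.instance Definition _ := EqQuotient.on tens.

Definition tmk (s : seq (V * W)) : tens := \pi_tens s.
Definition trepr (t : tens) : seq (V * W) := repr t.

Lemma treprK t : tmk (trepr t) = t. Proof. exact: reprK. Qed.

Lemma tmkE s t : tmk s = tmk t <-> teq s t.
Proof.
split=> [/eqP|h]; first by rewrite /tmk piE => /asboolP.
by apply/eqP; rewrite /tmk piE; apply/asboolP.
Qed.

Definition tadd (x y : tens) := tmk (trepr x ++ trepr y).
Definition tzero : tens := tmk [::].
Definition tscale (a : k) (x : tens) : tens :=
  tmk [seq (a *: p.1, p.2) | p <- trepr x].

Lemma tmk_cat s t : tmk (s ++ t) = tadd (tmk s) (tmk t).
Proof. by apply/tmkE/teq_cat; apply/tmkE; rewrite treprK. Qed.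

Lemma teq_map a s t : teq s t ->
  teq [seq (a *: p.1, p.2) | p <- s] [seq (a *: p.1, p.2) | p <- t].
Proof.
elim=> {s t} [s|s t _ h|s t u _ h1 _ h2|s s' t t' _ h1 _ h2|s t|v v' w|v w w'
  |b v w|w] /=.
- exact: teq_refl.
- exact: teq_sym.
- exact: teq_trans h1 h2.
- by rewrite !map_cat; apply: teq_cat.
- by rewrite !map_cat; apply: teq_catC.
- by rewrite scalerDr; apply: teq_addl.
- exact: teq_addr.
- by rewrite scalerA mulrC -scalerA; apply: teq_scale.
- by rewrite scaler0; apply: teq_zero.
Qed.

Lemma tmk_scale a s : tmk [seq (a *: p.1, p.2) | p <- s] = tscale a (tmk s).
Proof. by apply/tmkE/teq_map/tmkE; rewrite treprK. Qed.

Lemma taddA : associative tadd.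
Proof.
move=> x y z; rewrite -[x]treprK -[y]treprK -[z]treprK -!tmk_cat.
by rewrite catA.
Qed.
Lemma taddC : commutative tadd.
Proof.
move=> x y; rewrite -[x]treprK -[y]treprK -!tmk_cat; apply/tmkE/teq_catC.
Qed.
Lemma tadd0 : left_id tzero tadd.
Proof. by move=> x; rewrite -[x]treprK -tmk_cat. Qed.

HB.instance Definition _ := GRing.isNmodule.Build tens taddA taddC tadd0.

Definition tpure (v : V) (w : W) : tens := tmk [:: (v, w)].

Lemma tmk_sum s : tmk s = \sum_(p <- s) tpure p.1 p.2.
Proof.
elim: s => [|[v w] s IH]; first by rewrite big_nil.
by rewrite big_cons /= -IH -[(v, w) :: s]cat1s tmk_cat.
Qed.

Lemma tpureDl v v' w : tpure (v + v') w = tpure v w + tpure v' w.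
Proof. by rewrite -[RHS]tmk_cat; apply/tmkE/teq_addl. Qed.
Lemma tpureDr v w w' : tpure v (w + w') = tpure v w + tpure v w'.
Proof. by rewrite -[RHS]tmk_cat; apply/tmkE/teq_addr. Qed.
Lemma tpureZlr a v w : tpure (a *: v) w = tpure v (a *: w).
Proof. exact/tmkE/teq_scale. Qed.
Lemma tpure0l w : tpure 0 w = 0.
Proof. exact/tmkE/teq_zero. Qed.

Lemma tscale_pure a v w : tscale a (tpure v w) = tpure (a *: v) w.
Proof. by rewrite /tpure -tmk_scale. Qed.

Lemma tscaleDr : right_distributive tscale +%R.
Proof.
move=> a x y; rewrite -[x]treprK -[y]treprK -[tmk _ + tmk _]tmk_cat.
by rewrite -!tmk_scale map_cat -[RHS]tmk_cat.
Qed.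

Lemma tens_ind (P : tens -> Prop) :
  P 0 -> (forall v w, P (tpure v w)) -> (forall x y, P x -> P y -> P (x + y)) ->
  forall t, P t.
Proof.
move=> P0 Pp PD t; rewrite -[t]treprK tmk_sum.
by elim: (trepr t) => [|p s IH]; rewrite ?big_nil ?big_cons //; apply: PD.
Qed.

Lemma tscale0' a : tscale a 0 = 0.
Proof. by rewrite -[0]/(tmk [::]) -tmk_scale. Qed.

Lemma tscaleA a b t : tscale a (tscale b t) = tscale (a * b) t.
Proof.
elim/tens_ind: t => [|v w|x y hx hy]; rewrite ?tscale0' ?tscale_pure ?scalerA //.
by rewrite !tscaleDr hx hy.
Qed.
Lemma tscale1 : left_id 1 tscale.
Proof.
by elim/tens_ind => [|v w|x y hx hy];
  rewrite ?tscale0' ?tscale_pure ?scale1r ?tscaleDr ?hx ?hy.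
Qed.
Lemma tscaleDl t : {morph tscale^~ t : a b / a + b}.
Proof.
move=> a b; elim/tens_ind: t => [|v w|x y hx hy]; rewrite ?tscale0' ?addr0 //.
  by rewrite !tscale_pure scalerDl tpureDl.
by rewrite !tscaleDr hx hy addrACA.
Qed.

Lemma tscale0 t : tscale 0 t = 0.
Proof.
elim/tens_ind: t => [|v w|x y hx hy]; rewrite ?tscale0' //.
  by rewrite tscale_pure scale0r tpure0l.
by rewrite tscaleDr hx hy addr0.
Qed.

Lemma taddN : left_inverse 0 (tscale (-1)) +%R.
Proof.
move=> t; rewrite -[X in _ + X]tscale1 -tscaleDl addNr; exact: tscale0.
Qed.

HB.instance Definition _ := GRing.Nmodule_isZmodule.Build tens taddN.
HB.instance Definition _ :=
  GRing.Zmodule_isLmodule.Build k tens tscaleA tscale1 tscaleDr tscaleDl.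

Lemma tpureZl a v w : tpure (a *: v) w = a *: tpure v w.
Proof. by rewrite -tscale_pure. Qed.
Lemma tpureZr a v w : tpure v (a *: w) = a *: tpure v w.
Proof. by rewrite -tpureZlr tpureZl. Qed.
Lemma tpure0r v : tpure v 0 = 0.
Proof. by rewrite -(scale0r 0) tpureZr scale0r. Qed.

Lemma tens_ext (X : lmodType k) (f g : tens -> X) : linear f -> linear g ->
  (forall v w, f (tpure v w) = g (tpure v w)) -> forall t, f t = g t.
Proof.
move=> fl gl h; elim/tens_ind => [|v w|x y hx hy]; first by rewrite !lin0.
  exact: h.
by rewrite !linD // hx hy.
Qed.

Definition bilinear2 (X : lmodType k) (b : V -> W -> X) :=
  (forall w, linear (b^~ w)) /\ (forall v, linear (b v)).

(** Only meaningful when [b] is bilinear. *)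
Definition tlift (X : lmodType k) (b : V -> W -> X) (t : tens) : X :=
  \sum_(p <- trepr t) b p.1 p.2.

Section Lift.
Variables (X : lmodType k) (b : V -> W -> X).
Hypothesis bb : bilinear2 b.

Lemma tlift_mk s : tlift b (tmk s) = \sum_(p <- s) b p.1 p.2.
Proof.
have bl w := bb.1 w; have br v := bb.2 v.
have: teq (trepr (tmk s)) s by apply/tmkE; rewrite treprK.
rewrite /tlift; move: (trepr _) => s'.
elim=> {s s'} [s|s t _ h|s t u _ h1 _ h2|s s' t t' _ h1 _ h2|s t|v v' w|v w w'
  |a v w|w] //=; rewrite ?big_cat /= ?big_cons ?big_nil ?addr0 /=.
- exact: etrans h1 h2.
- by rewrite h1 h2.
- by rewrite addrC.
- by rewrite (linD (bl w)).
- by rewrite (linD (br v)).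
- by rewrite (linZ (bl w)) (linZ (br v)).
- by rewrite (lin0 (bl w)).
Qed.

Lemma tliftE v w : tlift b (tpure v w) = b v w.
Proof. by rewrite tlift_mk big_cons big_nil addr0. Qed.

Lemma tliftD : {morph tlift b : x y / x + y}.
Proof.
move=> x y; rewrite -[x]treprK -[y]treprK -[tmk _ + tmk _]tmk_cat.
by rewrite !tlift_mk big_cat.
Qed.

Lemma tlift_lin : linear (tlift b).
Proof.
move=> a x y; rewrite tliftD; congr (_ + _).
elim/tens_ind: x => [|v w|u v hu hv].
- by rewrite scaler0 -[0]/(tmk [::]) tlift_mk big_nil scaler0.
- by rewrite -tpureZl !tliftE (linZ (bb.1 w)).
- by rewrite scalerDr !tliftD hu hv scalerDr.
Qed.
End Lift.

Lemma tpure_bil : bilinear2 tpure.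
Proof.
by split=> [w|v] a x y /=; rewrite ?tpureDl ?tpureDr ?tpureZl ?tpureZr.
Qed.

End Tensor.

Arguments tpure {k V W}.

Section TensorMaps.
Variables (k : comPzRingType).

(** The unsigned map [v ⊗ w ↦ f v ⊗ g w]. *)
Definition tmap (V W V' W' : lmodType k) (f : V -> V') (g : W -> W') :
  tens V W -> tens V' W' := tlift (fun v w => tpure (f v) (g w)).

Definition tassoc (U V W : lmodType k) :
    tens (tens U V) W -> tens U (tens V W) :=
  tlift (fun t w => tlift (fun u v => tpure u (tpure v w)) t).

Definition tassocV (U V W : lmodType k) :
    tens U (tens V W) -> tens (tens U V) W :=
  tlift (fun u t => tlift (fun v w => tpure (tpure u v) w) t).

Lemma bil_comp (V W V' W' X : lmodType k) (b : V' -> W' -> X)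
    (f : V -> V') (g : W -> W') : bilinear2 b -> linear f -> linear g ->
  bilinear2 (fun v w => b (f v) (g w)).
Proof.
move=> [bl br] fl gl; split=> [w|v] a x y /=; first by rewrite fl bl.
by rewrite gl br.
Qed.

Lemma tmapE (V W V' W' : lmodType k) (f : V -> V') (g : W -> W') v w :
  linear f -> linear g -> tmap f g (tpure v w) = tpure (f v) (g w).
Proof.
by move=> fl gl; rewrite /tmap (tliftE (bil_comp (@tpure_bil _ _ _) fl gl)).
Qed.

Lemma tmap_lin (V W V' W' : lmodType k) (f : V -> V') (g : W -> W') :
  linear f -> linear g -> linear (tmap f g).
Proof. by move=> fl gl; apply/tlift_lin/(bil_comp (@tpure_bil _ _ _) fl gl). Qed.

Lemma tassoc_bil1 (U V W : lmodType k) (w : W) :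
  bilinear2 (fun (u : U) (v : V) => tpure u (tpure v w)).
Proof.
by split=> [v|u] a x y /=; rewrite !(tpureDl, tpureZl, tpureDr, tpureZr).
Qed.

Lemma tassoc_bil (U V W : lmodType k) : bilinear2 (fun (t : tens U V) (w : W) =>
  tlift (fun u v => tpure u (tpure v w)) t).
Proof.
split=> [w|t] a x y; first by apply: tlift_lin; apply: tassoc_bil1.
elim/tens_ind: t => [|u v|s t hs ht].
- by rewrite /= !(lin0 (tlift_lin (tassoc_bil1 _ _ _))) scaler0 addr0.
- by rewrite /= !(tliftE (tassoc_bil1 _ _ _)) !(tpureDr, tpureZr).
- by rewrite /= !(linD (tlift_lin (tassoc_bil1 _ _ _))) hs ht scalerDr addrACA.
Qed.

Lemma tassocV_bil1 (U V W : lmodType k) (u : U) :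
  bilinear2 (fun (v : V) (w : W) => tpure (tpure u v) w).
Proof.
by split=> [w|v] a x y /=; rewrite !(tpureDl, tpureZl, tpureDr, tpureZr).
Qed.

Lemma tassocV_bil (U V W : lmodType k) : bilinear2 (fun (u : U) (t : tens V W) =>
  tlift (fun v w => tpure (tpure u v) w) t).
Proof.
split=> [t|u] a x y; last by apply: tlift_lin; apply: tassocV_bil1.
elim/tens_ind: t => [|v w|s t hs ht].
- by rewrite /= !(lin0 (tlift_lin (tassocV_bil1 _ _ _))) scaler0 addr0.
- by rewrite /= !(tliftE (tassocV_bil1 _ _ _)) !(tpureDl, tpureZl).
- by rewrite /= !(linD (tlift_lin (tassocV_bil1 _ _ _))) hs ht scalerDr addrACA.
Qed.

Lemma tassoc_lin (U V W : lmodType k) : linear (@tassoc U V W).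
Proof. exact/tlift_lin/tassoc_bil. Qed.
Lemma tassocV_lin (U V W : lmodType k) : linear (@tassocV U V W).
Proof. exact/tlift_lin/tassocV_bil. Qed.

Lemma tassocE (U V W : lmodType k) (u : U) (v : V) (w : W) :
  tassoc (tpure (tpure u v) w) = tpure u (tpure v w).
Proof.
by rewrite /tassoc (tliftE (tassoc_bil _ _ _)) (tliftE (tassoc_bil1 _ _ _)).
Qed.
Lemma tassocVE (U V W : lmodType k) (u : U) (v : V) (w : W) :
  tassocV (tpure u (tpure v w)) = tpure (tpure u v) w.
Proof.
by rewrite /tassocV (tliftE (tassocV_bil _ _ _)) (tliftE (tassocV_bil1 _ _ _)).
Qed.

Lemma tassocK (U V W : lmodType k) : cancel (@tassoc U V W) (@tassocV U V W).
Proof.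
elim/tens_ind => [|t w|s t hs ht].
- by rewrite (lin0 (@tassoc_lin _ _ _)) (lin0 (@tassocV_lin _ _ _)).
- elim/tens_ind: t => [|u v|s t hs ht].
  + by rewrite tpure0l (lin0 (@tassoc_lin _ _ _)) (lin0 (@tassocV_lin _ _ _)).
  + by rewrite tassocE tassocVE.
  + by rewrite tpureDl (linD (@tassoc_lin _ _ _)) (linD (@tassocV_lin _ _ _)) hs ht.
- by rewrite (linD (@tassoc_lin _ _ _)) (linD (@tassocV_lin _ _ _)) hs ht.
Qed.

Lemma tassocVK (U V W : lmodType k) : cancel (@tassocV U V W) (@tassoc U V W).
Proof.
elim/tens_ind => [|u t|s t hs ht].
- by rewrite (lin0 (@tassocV_lin _ _ _)) (lin0 (@tassoc_lin _ _ _)).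
- elim/tens_ind: t => [|v w|s t hs ht].
  + by rewrite tpure0r (lin0 (@tassocV_lin _ _ _)) (lin0 (@tassoc_lin _ _ _)).
  + by rewrite tassocVE tassocE.
  + by rewrite tpureDr (linD (@tassocV_lin _ _ _)) (linD (@tassoc_lin _ _ _)) hs ht.
- by rewrite (linD (@tassocV_lin _ _ _)) (linD (@tassoc_lin _ _ _)) hs ht.
Qed.
End TensorMaps.

Arguments tassoc {k U V W}.
Arguments tassocV {k U V W}.

(** * Graded modules *)

(** A [Z]-graded [k]-module, given as the total module [⨁ V^n] together with
its projections onto the homogeneous components. *)
Record grMod (k : comPzRingType) := GrMod {
  gcar :> lmodType k;
  gpr : int -> gcar -> gcar;
  gpr_lin : forall n, linear (gpr n);
  gpr_pr : forall m n v, gpr m (gpr n v) = if m == n then gpr n v else 0;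
  gpr_fin : forall v, exists s : seq int, uniq s /\ v = \sum_(n <- s) gpr n v }.

Arguments gpr {k g}.

Section Graded.
Variable k : comPzRingType.

Definition homog (V : grMod k) (n : int) (v : V) : Prop := gpr n v = v.

(** [k]-linear maps homogeneous of degree [n]. *)
Definition isHom (V W : grMod k) (n : int) (f : V -> W) : Prop :=
  linear f /\ forall i v, homog i v -> homog (i + n) (f v).

Definition sgn (n : int) : k := (-1) ^+ `|n|%N.

Definition supp (V : grMod k) (v : V) : seq int :=
  [seq n <- sval (cid (gpr_fin v)) | gpr n v != 0].

(** [v ↦ (-1)^(n|v|) v]. *)
Definition ksign (V : grMod k) (n : int) (v : V) : V :=
  \sum_(i <- supp v) sgn (n * i) *: gpr i v.

(** [f ⊗ g] with the Koszul sign, for [g] of degree [n]; when [n] is 0 this is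
just [tmap f g]. *)
Definition ktens (V W V' W' : grMod k) (n : int) (f : V -> V') (g : W -> W') :
  tens V W -> tens V' W' := tmap (fun v => f (ksign n v)) g.

Lemma sgnD m n : sgn (m + n) = sgn m * sgn n.
Proof.
rewrite /sgn -signr_odd -[in RHS]signr_odd -[X in _ = _ * X]signr_odd -signr_addb.
congr (_ ^+ nat_of_bool _); case: m n => m [] n.
- by rewrite !absz_nat oddD.
- rewrite NegzE; case: (leqP n.+1 m) => h.
    by rewrite subzn // abszN !absz_nat oddB.
  by rewrite distnEr ?oddB ?(ltnW h) // abszN absz_nat addbC.
- rewrite NegzE addrC; case: (leqP m.+1 n) => h.
    by rewrite subzn // abszN !absz_nat oddB // addbC.
  by rewrite distnEr ?oddB ?(ltnW h) // abszN absz_nat.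
- by rewrite !NegzE -opprD !abszN -PoszD !absz_nat oddD.
Qed.

Lemma sgn0 : sgn 0 = 1. Proof. by []. Qed.
Lemma sgn1 : sgn 1 = -1. Proof. by rewrite /sgn expr1. Qed.
Lemma sgnN n : sgn (- n) = sgn n. Proof. by rewrite /sgn abszN. Qed.
Lemma sgnK n : sgn n * sgn n = 1.
Proof. by rewrite -[X in X * _]sgnN -sgnD addNr. Qed.

Section Basics.
Variable V : grMod k.
Implicit Types (v : V).

Lemma supp_uniq v : uniq (supp v).
Proof. by rewrite filter_uniq //; case: cid => s []. Qed.

Lemma mem_supp v n : (n \in supp v) = (gpr n v != 0).
Proof.
rewrite mem_filter; case: eqVneq => //= nz.
case: cid => s /= [us es]; apply: contraNT nz => ns.
apply/eqP; rewrite es (lin_sum (gpr_lin _)) big_seq big1 // => i si.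
by rewrite gpr_pr; case: eqP => // e; rewrite -e in si; rewrite si in ns.
Qed.

Lemma supp_sum (X : lmodType k) (F : int -> V -> X) (s : seq int) v :
  (forall i, F i 0 = 0) -> uniq s -> {subset supp v <= s} ->
  \sum_(i <- s) F i (gpr i v) = \sum_(i <- supp v) F i (gpr i v).
Proof.
move=> F0 us sub; rewrite (bigID (fun i => gpr i v != 0)) /=.
rewrite [X in _ + X]big1 ?addr0 => [|i /negPn/eqP ->]; last exact: F0.
rewrite -big_filter; apply/perm_big/uniq_perm;
  [exact: filter_uniq | exact: supp_uniq | ].
move=> i; rewrite mem_filter mem_supp; case: eqVneq => //= nz.
by apply/sub; rewrite mem_supp.
Qed.

Lemma gsum v : v = \sum_(i <- supp v) gpr i v.
Proof.
have [s [us es]] := gpr_fin v.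
rewrite {1}es; apply: (supp_sum (F := fun _ x => x)) => // i.
rewrite mem_supp; apply: contraNT => ns; apply/eqP.
rewrite es (lin_sum (gpr_lin _)) big_seq big1 // => j sj.
by rewrite gpr_pr; case: eqP => // e; rewrite -e in sj; rewrite sj in ns.
Qed.

Lemma homog_gpr n v : homog n (gpr n v).
Proof. by rewrite /homog gpr_pr eqxx. Qed.

Lemma homog_lin n a u v : homog n u -> homog n v -> homog n (a *: u + v).
Proof. by rewrite /homog => hu hv; rewrite gpr_lin hu hv. Qed.
Lemma homog0 n : homog n (0 : V). Proof. exact: (lin0 (gpr_lin _)). Qed.
Lemma homogD n u v : homog n u -> homog n v -> homog n (u + v).
Proof. by move=> hu hv; rewrite -[u]scale1r; apply: homog_lin. Qed.
Lemma homogZ n a v : homog n v -> homog n (a *: v).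
Proof. by move=> hv; rewrite -[_ *: _]addr0; apply/homog_lin/homog0. Qed.

Lemma gpr_homog m n v : homog n v -> gpr m v = if m == n then v else 0.
Proof. by move=> h; rewrite -[in LHS]h gpr_pr h. Qed.

Lemma hext (X : lmodType k) (f g : V -> X) : linear f -> linear g ->
  (forall i v, homog i v -> f v = g v) -> forall v, f v = g v.
Proof.
move=> fl gl h v; rewrite [v]gsum !lin_sum //; apply: eq_bigr => i _.
exact/h/homog_gpr.
Qed.

Lemma gext u v : (forall i, gpr i u = gpr i v) -> u = v.
Proof.
move=> h; apply/eqP; rewrite -subr_eq0; apply/eqP; rewrite [LHS]gsum big1 //.
by move=> i _; rewrite (linB (gpr_lin _)) h subrr.
Qed.

Lemma gpr_ksign n j v : gpr j (ksign n v) = sgn (n * j) *: gpr j v.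
Proof.
rewrite /ksign (lin_sum (gpr_lin _)).
under eq_bigr => i _ do rewrite (linZ (gpr_lin _)) gpr_pr.
case: (boolP (j \in supp v)) => hj.
  rewrite (bigD1_seq j) ?supp_uniq //= eqxx big1 ?addr0 // => i.
  by rewrite eq_sym => /negPf ->; rewrite scaler0.
have -> : gpr j v = 0 by move: hj; rewrite mem_supp => /negPn/eqP.
rewrite scaler0 big_seq big1 // => i si; case: eqP => [e|_]; last by rewrite scaler0.
by rewrite -e in si; rewrite si in hj.
Qed.

Lemma ksign_lin n : linear (@ksign V n).
Proof.
move=> a u v; apply: gext => j.
by rewrite gpr_lin !gpr_ksign gpr_lin scalerDr !scalerA mulrC.
Qed.

Lemma ksignE n i v : homog i v -> ksign n v = sgn (n * i) *: v.
Proof.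
move=> h; apply: gext => j; rewrite gpr_ksign (linZ (gpr_lin _)).
by rewrite (gpr_homog _ h); case: eqP => [->//|_]; rewrite !scaler0.
Qed.

Lemma ksign0 v : ksign 0 v = v.
Proof. by apply: gext => j; rewrite gpr_ksign mul0r sgn0 scale1r. Qed.

Lemma ksignK n : involutive (@ksign V n).
Proof. by move=> v; apply: gext => j; rewrite !gpr_ksign scalerA sgnK scale1r. Qed.

Lemma ksign_homog n i v : homog i v -> homog i (ksign n v).
Proof. by move=> h; rewrite (ksignE _ h); apply: homogZ. Qed.

Lemma ksign_hom n : isHom 0 (@ksign V n).
Proof. by split=> [|i v h]; [exact: ksign_lin | rewrite addr0; apply: ksign_homog]. Qed.
End Basics.

Lemma isHomP (V W : grMod k) n (f : V -> W) : linear f ->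
  isHom n f <-> forall i v, gpr (i + n) (f v) = f (gpr i v).
Proof.
move=> fl; split=> [[_ h] i|h].
  apply: hext => [a u v|a u v|j v hv]; rewrite ?fl ?gpr_lin ?fl //.
  rewrite (gpr_homog _ hv) (gpr_homog _ (h _ _ hv)) (inj_eq (addIr n)).
  by case: eqP => // _; rewrite lin0.
by split=> // i v hv; rewrite /homog h hv.
Qed.

Lemma ksign_isHom (V W : grMod k) m n (f : V -> W) v : isHom m f ->
  ksign n (f v) = sgn (n * m) *: f (ksign n v).
Proof.
move=> [fl h]; move: v; apply: hext => [a u v|a u v|i v hv].
- by rewrite fl ksign_lin.
- by rewrite ksign_lin fl scalerDr !scalerA mulrC.
- rewrite (ksignE _ hv) (ksignE _ (h _ _ hv)) (linZ fl) scalerA -sgnD.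
  by rewrite mulrDr addrC.
Qed.

Lemma isHom_id (V : grMod k) : isHom 0 (id : V -> V).
Proof. by split=> [//|i v]; rewrite addr0. Qed.

Lemma isHom_comp (U V W : grMod k) m n (f : V -> W) (g : U -> V) :
  isHom m f -> isHom n g -> isHom (n + m) (fun x => f (g x)).
Proof.
move=> [fl fh] [gl gh]; split=> [a u v|i v hv]; first by rewrite gl fl.
by rewrite addrA; apply/fh/gh.
Qed.

Lemma isHom_lin (V W : grMod k) n a (f g : V -> W) :
  isHom n f -> isHom n g -> isHom n (fun x => a *: f x + g x).
Proof.
move=> [fl fh] [gl gh]; split=> [b u v|i v hv]; last first.
  by apply: homog_lin; [apply: fh | apply: gh].
by rewrite fl gl !scalerDr !scalerA [a * b]mulrC addrACA.
Qed.

Lemma isHom0 (V W : grMod k) n : isHom n (fun _ : V => 0 : W).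
Proof. by split=> [a u v|i v _]; [rewrite scaler0 addr0 | apply: homog0]. Qed.

Lemma isHomD (V W : grMod k) n (f g : V -> W) :
  isHom n f -> isHom n g -> isHom n (fun x => f x + g x).
Proof.
move=> hf hg; have := isHom_lin 1 hf hg; congr isHom.
by apply/funext => x; rewrite scale1r.
Qed.

Lemma isHomZ (V W : grMod k) n a (f : V -> W) :
  isHom n f -> isHom n (fun x => a *: f x).
Proof.
move=> hf; have := isHom_lin a hf (isHom0 V W n); congr isHom.
by apply/funext => x; rewrite addr0.
Qed.

Lemma isHomN (V W : grMod k) n (f : V -> W) :
  isHom n f -> isHom n (fun x => - f x).
Proof.
move=> hf; have := isHomZ (-1) hf; congr isHom.
by apply/funext => x; rewrite scaleN1r.
Qed.

(** ** The grading of a tensor product *)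

Section GTens.
Variables (V W : grMod k).

Definition gtens_pr (n : int) : tens V W -> tens V W :=
  tlift (fun v w => \sum_(i <- supp v) tpure (gpr i v) (gpr (n - i) w)).

Lemma gtens_pr_bil n : bilinear2 (fun (v : V) (w : W) =>
  \sum_(i <- supp v) tpure (gpr i v) (gpr (n - i) w)).
Proof.
split=> [w|v] a x y /=; last first.
  rewrite scaler_sumr -big_split /=; apply: eq_bigr => i _.
  by rewrite gpr_lin tpureDr tpureZr.
pose s := undup (supp x ++ supp y ++ supp (a *: x + y)).
have S z : {subset supp z <= s} -> \sum_(i <- supp z) tpure (gpr i z) (gpr (n - i) w)
    = \sum_(i <- s) tpure (gpr i z) (gpr (n - i) w).
  move=> sub; symmetry.
  apply: (supp_sum (F := fun i u => tpure u (gpr (n - i) w))) => //.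
  - by move=> i; apply: tpure0l.
  - exact: undup_uniq.
rewrite !S; try by move=> i; rewrite mem_undup !mem_cat => ->; rewrite ?orbT.
rewrite scaler_sumr -big_split /=; apply: eq_bigr => i _.
by rewrite gpr_lin tpureDl tpureZl.
Qed.

Lemma gtens_pr_lin n : linear (gtens_pr n).
Proof. exact/tlift_lin/gtens_pr_bil. Qed.

Lemma gtens_prE n i j v w : homog i v -> homog j w ->
  gtens_pr n (tpure v w) = if n == i + j then tpure v w else 0.
Proof.
move=> hv hw; rewrite /gtens_pr (tliftE (gtens_pr_bil n)).
rewrite -(supp_sum (F := fun l u => tpure u (gpr (n - l) w)) (s := [:: i])) //.
- rewrite big_seq1 hv (gpr_homog _ hw) subr_eq [j + i]addrC.
  by case: eqP => //; rewrite tpure0r.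
- by move=> l; apply: tpure0l.
- move=> l; rewrite mem_supp (gpr_homog _ hv) inE.
  by case: (l =P i) => // _ /eqP.
Qed.

Lemma tens_hext (X : lmodType k) (f g : tens V W -> X) : linear f -> linear g ->
  (forall i j v w, homog i v -> homog j w -> f (tpure v w) = g (tpure v w)) ->
  forall t, f t = g t.
Proof.
move=> fl gl h; apply: tens_ext => // v w.
move: v; apply: hext => [a x y|a x y|i v hv]; rewrite ?(tpureDl, tpureZl) ?fl ?gl //.
move: w; apply: hext => [a x y|a x y|j w hw]; rewrite ?(tpureDr, tpureZr) ?fl ?gl //.
exact: h hv hw.
Qed.

Lemma gtens_pr_pr m n t :
  gtens_pr m (gtens_pr n t) = if m == n then gtens_pr n t else 0.
Proof.
move: t; apply: tens_hext => [a x y|a x y|i j v w hv hw].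
- by rewrite !gtens_pr_lin.
- by case: eqP => _; rewrite ?gtens_pr_lin // scaler0 addr0.
- rewrite (gtens_prE _ hv hw); case: (n =P i + j) => [->|_].
    by rewrite (gtens_prE _ hv hw); case: eqP.
  by rewrite (lin0 (gtens_pr_lin _)); case: eqP.
Qed.

Lemma gtens_pr_finD t u :
  (exists s, uniq s /\ t = \sum_(n <- s) gtens_pr n t) ->
  (exists s, uniq s /\ u = \sum_(n <- s) gtens_pr n u) ->
  exists s, uniq s /\ t + u = \sum_(n <- s) gtens_pr n (t + u).
Proof.
move=> [s [us es]] [r [ur er]]; exists (undup (s ++ r)); split; first exact: undup_uniq.
have key x q : uniq q -> x = \sum_(n <- q) gtens_pr n x -> {subset q <= s ++ r} ->
    \sum_(n <- undup (s ++ r)) gtens_pr n x = x.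
  move=> uq ex sub; rewrite [RHS]ex (bigID (mem q)) /=.
  rewrite [X in _ + X]big1 ?addr0; last first.
    move=> n nq; rewrite ex (lin_sum (gtens_pr_lin n)) big_seq big1 // => l lq.
    by rewrite gtens_pr_pr; case: eqP => // e; rewrite e lq in nq.
  rewrite -big_filter; apply/perm_big/uniq_perm => //.
    by rewrite filter_uniq ?undup_uniq.
  move=> n; rewrite mem_filter mem_undup; case: (boolP (n \in q)) => //= nq.
  exact: sub.
under eq_bigr => n _ do rewrite (linD (gtens_pr_lin n)).
rewrite big_split /= (key t s) // ?(key u r) //.
- by move=> n; rewrite mem_cat orbC => ->.
- by move=> n; rewrite mem_cat => ->.
Qed.

Lemma gtens_pr_fin t : exists s, uniq s /\ t = \sum_(n <- s) gtens_pr n t.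
Proof.
have F0 : exists s, uniq s /\ (0 : tens V W) = \sum_(n <- s) gtens_pr n 0.
  by exists [::]; rewrite big_nil.
elim/tens_ind: t => [//|v w|x y hx hy]; last exact: gtens_pr_finD.
rewrite [v]gsum [w]gsum; elim: (supp v) => [|i s IH].
  by rewrite big_nil tpure0l.
rewrite big_cons tpureDl; apply: gtens_pr_finD => //.
elim: (supp w) => [|j r IHr]; first by rewrite big_nil tpure0r.
rewrite big_cons tpureDr; apply: gtens_pr_finD => //.
exists [:: i + j]; rewrite big_seq1 (gtens_prE _ (homog_gpr _ _) (homog_gpr _ _)).
by rewrite eqxx.
Qed.

Definition gtens : grMod k :=
  GrMod gtens_pr_lin gtens_pr_pr gtens_pr_fin.

Lemma homog_tpure i j v w : homog i v -> homog j w ->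
  @homog gtens (i + j) (tpure v w).
Proof. by move=> hv hw; rewrite /homog /= (gtens_prE _ hv hw) eqxx. Qed.

Lemma tens_isHom (X : grMod k) n (f : gtens -> X) : linear f ->
  (forall i j v w, homog i v -> homog j w -> homog (i + j + n) (f (tpure v w))) ->
  isHom n f.
Proof.
move=> fl h; apply/isHomP => // l.
apply: tens_hext => [a x y|a x y|i j v w hv hw]; rewrite ?fl ?gpr_lin ?fl //.
rewrite (gpr_homog _ (homog_tpure hv hw)) (gpr_homog _ (h _ _ _ _ hv hw)) (inj_eq (addIr n)).
by case: eqP => // _; rewrite lin0.
Qed.

End GTens.

Lemma tmap_isHom (V W V' W' : grMod k) m n (f : V -> V') (g : W -> W') :
  isHom m f -> isHom n g -> @isHom (gtens V W) (gtens V' W') (m + n) (tmap f g).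
Proof.
move=> [fl fh] [gl gh]; apply: tens_isHom => [|i j v w hv hw].
  exact: tmap_lin.
by rewrite tmapE // addrACA; apply: homog_tpure; [apply: fh | apply: gh].
Qed.

Lemma ktens_lin (V W V' W' : grMod k) n (f : V -> V') (g : W -> W') :
  linear f -> linear g -> linear (ktens n f g).
Proof.
by move=> fl gl; apply: tmap_lin => // a x y; rewrite ksign_lin fl.
Qed.

Lemma ktens_isHom (V W V' W' : grMod k) m n l (f : V -> V') (g : W -> W') :
  isHom m f -> isHom n g -> @isHom (gtens V W) (gtens V' W') (m + n) (ktens l f g).
Proof.
move=> hf hg; apply: tmap_isHom => //.
by rewrite -[m]add0r; apply: isHom_comp => //; apply: ksign_hom.
Qed.

Lemma ktensE (V W V' W' : grMod k) n (f : V -> V') (g : W -> W') v w :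
  linear f -> linear g -> ktens n f g (tpure v w) = tpure (f (ksign n v)) (g w).
Proof.
by move=> fl gl; rewrite /ktens tmapE // => a x y; rewrite ksign_lin fl.
Qed.

Lemma ksign_tpure (V W : grMod k) n (v : V) (w : W) :
  ksign (V := gtens V W) n (tpure v w) = tpure (ksign n v) (ksign n w).
Proof.
move: v; apply: hext => [a x y|a x y|i v hv].
- by rewrite tpureDl tpureZl ksign_lin.
- by rewrite ksign_lin tpureDl tpureZl.
move: w; apply: hext => [a x y|a x y|j w hw].
- by rewrite tpureDr tpureZr ksign_lin.
- by rewrite ksign_lin tpureDr tpureZr.
rewrite (ksignE _ hv) (ksignE _ hw) (ksignE _ (homog_tpure hv hw)).
by rewrite tpureZl tpureZr scalerA -sgnD -mulrDr.
Qed.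

Lemma tassoc_gpr (U V W : grMod k) n (t : gtens (gtens U V) W) :
  gpr (g := gtens U (gtens V W)) n (tassoc t) = tassoc (gpr n t).
Proof.
have L := @tassoc_lin k U V W; move: t.
apply: tens_ext => [a x y|a x y|t w]; rewrite ?L ?gpr_lin ?L //.
move: w; apply: hext => [a x y|a x y|l w hw];
  rewrite ?(tpureDr, tpureZr) ?L ?gpr_lin ?L //.
move: t; apply: tens_hext => [a x y|a x y|i j u v hu hv];
  rewrite ?(tpureDl, tpureZl) ?L ?gpr_lin ?L //.
rewrite tassocE (gpr_homog _ (homog_tpure hu (homog_tpure hv hw))).
rewrite (gpr_homog _ (homog_tpure (homog_tpure hu hv) hw)) addrA.
by case: eqP => _; rewrite ?tassocE // lin0.
Qed.

Lemma tassocV_gpr (U V W : grMod k) n (t : gtens U (gtens V W)) :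
  gpr (g := gtens (gtens U V) W) n (tassocV t) = tassocV (gpr n t).
Proof.
have -> : gpr n t = tassoc (gpr (g := gtens (gtens U V) W) n (tassocV t)).
  by rewrite -tassoc_gpr tassocVK.
by rewrite tassocK.
Qed.

Lemma tassoc_isHom (U V W : grMod k) :
  @isHom (gtens (gtens U V) W) (gtens U (gtens V W)) 0 tassoc.
Proof.
by split=> [|i v hv]; [exact: tassoc_lin | rewrite addr0 /homog tassoc_gpr hv].
Qed.

Lemma tassocV_isHom (U V W : grMod k) :
  @isHom (gtens U (gtens V W)) (gtens (gtens U V) W) 0 tassocV.
Proof.
by split=> [|i v hv]; [exact: tassocV_lin | rewrite addr0 /homog tassocV_gpr hv].
Qed.

End Graded.

Arguments homog {k V}.
Arguments isHom {k V W}.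
Arguments ksign {k V}.
Arguments ktens {k V W V' W'}.
Arguments sgn {k}.

(** * Curved dg algebras, dg coalgebras, their modules and comodules *)

(** Not based on [algType], which excludes the zero algebra. *)
Record cdgAlg (k : comPzRingType) := CdgAlg {
  acar :> grMod k;
  amul : acar -> acar -> acar;
  aone : acar;
  acurv : acar;
  adif : acar -> acar;
  amul_bil : bilinear2 amul;
  amul_deg : forall i j a b, homog i a -> homog j b -> homog (i + j) (amul a b);
  aone_deg : homog 0 aone;
  amulA : associative amul;
  amul1a : left_id aone amul;
  amula1 : right_id aone amul;
  acurv_deg : homog 2 acurv;
  adif_hom : isHom 1 adif;
  adif_curv : adif acurv = 0;
  adif_sq : forall a, adif (adif a) = amul acurv a - amul a acurv;
  adif_mul : forall i a b, homog i a ->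
    adif (amul a b) = amul (adif a) b + sgn i *: amul a (adif b) }.

(** [ccounitl] and [ccounitr] identify [k ⊗ C] and [C ⊗ k] with [C].
That [ccounit] kills boundaries follows from [cdif_delta]. *)
Record dgCoalg (k : comPzRingType) := DgCoalg {
  ccar :> grMod k;
  cdelta : ccar -> gtens ccar ccar;
  ccounit : ccar -> k;
  cdif : ccar -> ccar;
  cdelta_hom : isHom 0 cdelta;
  ccounit_lin : scalar ccounit;
  ccounit_deg : forall i x, i != 0 -> homog i x -> ccounit x = 0;
  cdeltaA : forall x,
    tassoc (tmap cdelta id (cdelta x)) = tmap id cdelta (cdelta x);
  ccounitl : forall x, tlift (fun y z => ccounit y *: z) (cdelta x) = x;
  ccounitr : forall x, tlift (fun y z => ccounit z *: y) (cdelta x) = x;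
  cdif_hom : isHom 1 cdif;
  cdif_sq : forall x, cdif (cdif x) = 0;
  cdif_delta : forall x, cdelta (cdif x) =
    ktens 0 cdif id (cdelta x) + ktens 1 id cdif (cdelta x) }.

Record cdgMod (k : comPzRingType) (A : cdgAlg k) := CdgMod {
  mcar :> grMod k;
  mact : mcar -> A -> mcar;
  mdif : mcar -> mcar;
  mact_bil : bilinear2 mact;
  mact_deg : forall i j m a, homog i m -> homog j a -> homog (i + j) (mact m a);
  mactA : forall m a b, mact (mact m a) b = mact m (amul a b);
  mact1 : forall m, mact m (aone A) = m;
  mdif_hom : isHom 1 mdif;
  mdif_sq : forall m, mdif (mdif m) = - mact m (acurv A);
  mdif_act : forall i m a, homog i m ->
    mdif (mact m a) = mact (mdif m) a + sgn i *: mact m (adif a) }.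

Record dgComod (k : comPzRingType) (C : dgCoalg k) := DgComod {
  ncar :> grMod k;
  ncoact : ncar -> gtens ncar C;
  ndif : ncar -> ncar;
  ncoact_hom : isHom 0 ncoact;
  ncoactA : forall x,
    tassoc (tmap ncoact id (ncoact x)) = tmap id (@cdelta k C) (ncoact x);
  ncounit : forall x, tlift (fun y z => ccounit z *: y) (ncoact x) = x;
  ndif_hom : isHom 1 ndif;
  ndif_sq : forall x, ndif (ndif x) = 0;
  ndif_coact : forall x, ncoact (ndif x) =
    ktens 0 ndif id (ncoact x) + ktens 1 id (@cdif k C) (ncoact x) }.

Arguments amul {k c}. Arguments aone {k c}. Arguments acurv {k c}.
Arguments adif {k c}. Arguments cdelta {k d}. Arguments ccounit {k d}.
Arguments cdif {k d}. Arguments mact {k A c}. Arguments mdif {k A c}.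
Arguments ncoact {k C d}. Arguments ndif {k C d}.

(** Solutions [tau] of the Maurer-Cartan equation in [Hom(C, A)]. *)
Definition maurer_cartan (k : comPzRingType) (A : cdgAlg k) (C : dgCoalg k)
    (tau : C -> A) : Prop :=
  isHom 1 tau /\
  forall x, ccounit x *: acurv + (adif (tau x) + tau (cdif x))
            + tlift amul (ktens 1 tau tau (cdelta x)) = 0.

(** * Categories enriched in [k]-modules *)

Record lincat (k : comPzRingType) := LinCat {
  lob :> Type;
  mor : lob -> lob -> lmodType k;
  idm : forall X, mor X X;
  cmp : forall X Y Z, mor Y Z -> mor X Y -> mor X Z;
  cmpA : forall X Y Z T (h : mor Z T) (g : mor Y Z) (f : mor X Y),
    cmp h (cmp g f) = cmp (cmp h g) f;
  cmp1f : forall X Y (f : mor X Y), cmp (idm Y) f = f;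
  cmpf1 : forall X Y (f : mor X Y), cmp f (idm X) = f;
  cmp_bil : forall X Y Z, bilinear2 (@cmp X Y Z) }.

Arguments mor {k l}.
Arguments idm {k l}.
Arguments cmp {k l X Y Z}.
Notation "g \c f" := (cmp g f) (at level 40, left associativity).

Record functor (k : comPzRingType) (K K' : lincat k) := Functor {
  fob :> K -> K';
  fmap : forall X Y, mor X Y -> mor (fob X) (fob Y);
  fmap_lin : forall X Y, linear (@fmap X Y);
  fmap_id : forall X, fmap (idm X) = idm (fob X);
  fmap_cmp : forall X Y Z (g : mor Y Z) (f : mor X Y),
    fmap (g \c f) = fmap g \c fmap f }.

Arguments fmap {k K K'} f0 {X Y}.

(** [L] is left adjoint to [R]. *)
Definition adjoint (k : comPzRingType) (K K' : lincat k)
    (L : functor K K') (R : functor K' K) : Prop :=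
  exists phi : forall X Y, mor (L X) Y -> mor X (R Y),
    [/\ forall X Y, linear (phi X Y),
        forall X Y, bijective (phi X Y) &
        forall X X' Y Y' (g : mor X' X) (f : mor Y Y') (u : mor (L X) Y),
          phi X' Y' (f \c u \c fmap L g) = fmap R f \c phi X Y u \c g].

(** ** Exact and Frobenius categories *)

Section Frobenius.
Variables (k : comPzRingType) (K : lincat k).
(** The conflations [X -> Y -> Z]. *)
Variable E : forall X Y Z : K, mor X Y -> mor Y Z -> Prop.

Definition additive_category : Prop :=
  (exists Z : K, idm Z = 0) /\
  forall X Y : K, exists (P : K) (i1 : mor X P) (i2 : mor Y P)
                         (p1 : mor P X) (p2 : mor P Y),
    [/\ p1 \c i1 = idm X, p2 \c i2 = idm Y, p1 \c i2 = 0, p2 \c i1 = 0 &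
        i1 \c p1 + i2 \c p2 = idm P].

Definition isom (X Y : K) (f : mor X Y) : Prop :=
  exists g : mor Y X, g \c f = idm X /\ f \c g = idm Y.

Definition is_kernel (X Y Z : K) (i : mor X Y) (p : mor Y Z) : Prop :=
  p \c i = 0 /\ forall T (f : mor T Y), p \c f = 0 ->
    exists! g : mor T X, i \c g = f.

Definition is_cokernel (X Y Z : K) (i : mor X Y) (p : mor Y Z) : Prop :=
  p \c i = 0 /\ forall T (f : mor Y T), f \c i = 0 ->
    exists! g : mor Z T, g \c p = f.

Definition inflation (X Y : K) (i : mor X Y) : Prop :=
  exists (Z : K) (p : mor Y Z), E i p.

Definition deflation (Y Z : K) (p : mor Y Z) : Prop :=
  exists (X : K) (i : mor X Y), E i p.

Definition is_pullback (X Y Z P : K) (p : mor Y Z) (f : mor X Z)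
    (p' : mor P X) (f' : mor P Y) : Prop :=
  p \c f' = f \c p' /\ forall T (u : mor T X) (v : mor T Y), p \c v = f \c u ->
    exists! w : mor T P, p' \c w = u /\ f' \c w = v.

Definition is_pushout (X Y Z P : K) (i : mor Z Y) (f : mor Z X)
    (i' : mor X P) (f' : mor Y P) : Prop :=
  f' \c i = i' \c f /\ forall T (u : mor X T) (v : mor Y T), v \c i = u \c f ->
    exists! w : mor P T, w \c i' = u /\ w \c f' = v.

(** Exact categories in the sense of Quillen. *)
Record exact_category : Prop := ExactCategory {
  ex_add : additive_category;
  ex_kc : forall X Y Z (i : mor X Y) (p : mor Y Z), E i p ->
    is_kernel i p /\ is_cokernel i p;
  ex_iso : forall X Y Z X' Y' Z' (i : mor X Y) (p : mor Y Z)
      (i' : mor X' Y') (p' : mor Y' Z') (a : mor X X') (b : mor Y Y')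
      (c : mor Z Z'),
    isom a -> isom b -> isom c -> b \c i = i' \c a -> c \c p = p' \c b ->
    E i p -> E i' p';
  ex_idi : forall X, inflation (idm X);
  ex_idd : forall X, deflation (idm X);
  ex_cmpi : forall X Y Z (j : mor Y Z) (i : mor X Y),
    inflation i -> inflation j -> inflation (j \c i);
  ex_cmpd : forall X Y Z (q : mor Y Z) (p : mor X Y),
    deflation p -> deflation q -> deflation (q \c p);
  ex_pull : forall X Y Z (p : mor Y Z) (f : mor X Z), deflation p ->
    exists (P : K) (p' : mor P X) (f' : mor P Y),
      is_pullback p f p' f' /\ deflation p';
  ex_push : forall X Y Z (i : mor Z Y) (f : mor Z X), inflation i ->
    exists (P : K) (i' : mor X P) (f' : mor Y P),
      is_pushout i f i' f' /\ inflation i' }.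

Definition projective (P : K) : Prop :=
  forall Y Z (p : mor Y Z) (f : mor P Z), deflation p ->
    exists g : mor P Y, p \c g = f.

Definition injective_ob (I : K) : Prop :=
  forall X Y (i : mor X Y) (f : mor X I), inflation i ->
    exists g : mor Y I, g \c i = f.

Record frobenius : Prop := Frobenius {
  fr_exact : exact_category;
  fr_proj : forall X, exists (P : K) (p : mor P X), deflation p /\ projective P;
  fr_inj : forall X, exists (I : K) (i : mor X I), inflation i /\ injective_ob I;
  fr_projinj : forall X, projective X <-> injective_ob X }.

End Frobenius.

(** A functor is exact when it preserves conflations. *)
Definition exact_functor (k : comPzRingType) (K K' : lincat k)
    (E : forall X Y Z : K, mor X Y -> mor Y Z -> Prop)
    (E' : forall X Y Z : K', mor X Y -> mor Y Z -> Prop)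
    (F : functor K K') : Prop :=
  forall X Y Z (i : mor X Y) (p : mor Y Z),
    E X Y Z i p -> E' _ _ _ (fmap F i) (fmap F p).

(** ** Quotient by an ideal *)

Section QuotientCategory.
Variables (k : comPzRingType) (K : lincat k).
Variable I : forall X Y : K, submod (mor X Y).
Hypothesis Il : forall X Y Z (g : mor Y Z) (f : mor X Y), I X Y f -> I X Z (g \c f).
Hypothesis Ir : forall X Y Z (g : mor Y Z) (f : mor X Y), I Y Z g -> I X Z (g \c f).

Definition qmor (X Y : K) : lmodType k := quotM (I X Y).
Definition qcmp (X Y Z : K) (g : qmor Y Z) (f : qmor X Y) : qmor X Z :=
  qproj _ (qrepr g \c qrepr f).

Lemma qcmpE (X Y Z : K) (g : mor Y Z) (f : mor X Y) :
  qcmp (qproj _ g) (qproj _ f) = qproj (I X Z) (g \c f).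
Proof.
apply/qprojE; set g' := qrepr _; set f' := qrepr _.
have hg : I Y Z (g' - g) by apply/qprojE; rewrite qreprK.
have hf : I X Y (f' - f) by apply/qprojE; rewrite qreprK.
have [bl br] := @cmp_bil k K X Y Z.
have -> : g' \c f' - g \c f = 1 *: (g' \c (f' - f)) + (g' - g) \c f.
  rewrite scale1r (linB (br g')) (linB (bl f)) /=.
  by rewrite addrA subrK.
by apply: sm_lin; [apply: Il | apply: Ir].
Qed.

Lemma qcmpA X Y Z T (h : qmor Z T) (g : qmor Y Z) (f : qmor X Y) :
  qcmp h (qcmp g f) = qcmp (qcmp h g) f.
Proof. by rewrite -[h]qreprK -[g]qreprK -[f]qreprK !qcmpE cmpA. Qed.

Lemma qcmp1f X Y (f : qmor X Y) : qcmp (qproj _ (idm Y)) f = f.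
Proof. by rewrite -[f]qreprK qcmpE cmp1f. Qed.

Lemma qcmpf1 X Y (f : qmor X Y) : qcmp f (qproj _ (idm X)) = f.
Proof. by rewrite -[f]qreprK qcmpE cmpf1. Qed.

Lemma qcmp_bil X Y Z : bilinear2 (@qcmp X Y Z).
Proof.
have [bl br] := @cmp_bil k K X Y Z.
split=> [f|g] a x y /=; rewrite -[x]qreprK -[y]qreprK -qproj_lin.
  by rewrite -[f]qreprK !qcmpE bl qproj_lin.
by rewrite -[g]qreprK !qcmpE br qproj_lin.
Qed.

Definition quot_cat : lincat k := LinCat qcmpA qcmp1f qcmpf1 qcmp_bil.

Definition quot_functor : functor K quot_cat :=
  @Functor k K quot_cat id (fun X Y f => qproj (I X Y) f)
    (fun X Y => @qproj_lin _ _ (I X Y)) (fun X => erefl)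
    (fun X Y Z g f => esym (qcmpE g f)).

End QuotientCategory.

(** ** The common pattern of [𝒞A] and [Com C]

Objects are graded [k]-modules with extra graded structure and an operator [d]
of degree 1; [dhom X Y n] consists of the degree [n] maps compatible with the
graded structure, but not necessarily with [d]. *)

Record dgData (k : comPzRingType) := DgData {
  dob : Type;
  dcar : dob -> grMod k;
  ddif : forall X, dcar X -> dcar X;
  dhom : forall X Y, int -> submod (dcar X -> dcar Y);
  ddif_hom : forall X, isHom 1 (@ddif X);
  dhom_hom : forall X Y n f, dhom X Y n f -> isHom n f;
  dhom_id : forall X, dhom X X 0 id;
  dhom_cmp : forall X Y Z m n g f, dhom Y Z m g -> dhom X Y n f ->
    dhom X Z (n + m) (fun x => g (f x)) }.

Arguments dcar {k d}.
Arguments ddif {k d X}.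
Arguments dhom {k d}.

Section DgCategories.
Variables (k : comPzRingType) (D : dgData k).
Local Notation ob := (dob D).

Lemma ddif_lin (X : ob) : linear (@ddif k D X).
Proof. by case: (ddif_hom X). Qed.

Lemma dhom_lin (X Y : ob) n (f : dcar X -> dcar Y) : dhom X Y n f -> linear f.
Proof. by case/dhom_hom. Qed.

(** Degree 0 morphisms commuting with the [d]'s; these are the morphisms of [zcat]. *)
Definition zhomS (X Y : ob) : submod (dcar X -> dcar Y : lmodType k).
Proof.
refine (@Submod k _ (fun f => dhom X Y 0 f /\ forall x, f (ddif x) = ddif (f x)) _ _).
- split; first exact: sm0.
  by move=> x; rewrite /= (lin0 (@ddif_lin Y)).
- move=> a f g [hf cf] [hg cg]; split; first exact: sm_lin.
  move=> x; change (a *: f (ddif x) + g (ddif x) = ddif (a *: f x + g x)).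
  by rewrite ddif_lin cf cg.
Defined.

Definition zhom (X Y : ob) : lmodType k := smT (zhomS X Y).

Definition zfun (X Y : ob) (f : zhom X Y) : dcar X -> dcar Y := val f.

Lemma zhomP (X Y : ob) (f : zhom X Y) :
  dhom X Y 0 (zfun f) /\ forall x, zfun f (ddif x) = ddif (zfun f x).
Proof. exact: (smP f). Qed.

Lemma zhom_ext (X Y : ob) (f g : zhom X Y) : (forall x, zfun f x = zfun g x) -> f = g.
Proof. by move=> h; apply/val_inj/funext. Qed.

Lemma zhom_linE (X Y : ob) a (f g : zhom X Y) x :
  zfun (a *: f + g) x = a *: zfun f x + zfun g x.
Proof.
have e : zfun (a *: f + g) = a *: zfun f + zfun g.
  exact: (val_lin a f g).
by rewrite e.
Qed.

Lemma zid_subproof (X : ob) : zhomS X X id.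
Proof. by split=> //; apply: dhom_id. Qed.
Definition zid (X : ob) : zhom X X := smI (zid_subproof X).

Lemma zcmp_subproof (X Y Z : ob) (g : zhom Y Z) (f : zhom X Y) :
  zhomS X Z (fun x => zfun g (zfun f x)).
Proof.
have [hg cg] := zhomP g; have [hf cf] := zhomP f; split=> [|x].
  by rewrite -[0]addr0; apply: dhom_cmp.
by rewrite cf cg.
Qed.
Definition zcmp (X Y Z : ob) (g : zhom Y Z) (f : zhom X Y) : zhom X Z :=
  smI (zcmp_subproof g f).

Lemma zcmpA X Y Z T (h : zhom Z T) (g : zhom Y Z) (f : zhom X Y) :
  zcmp h (zcmp g f) = zcmp (zcmp h g) f.
Proof. exact: zhom_ext. Qed.
Lemma zcmp1f X Y (f : zhom X Y) : zcmp (zid Y) f = f.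
Proof. exact: zhom_ext. Qed.
Lemma zcmpf1 X Y (f : zhom X Y) : zcmp f (zid X) = f.
Proof. exact: zhom_ext. Qed.
Lemma zcmp_bil X Y Z : bilinear2 (@zcmp X Y Z).
Proof.
split=> [f|g] a u v; apply: zhom_ext => x; rewrite zhom_linE /=.
  exact: zhom_linE.
change (zfun g (zfun (a *: u + v) x) = a *: zfun g (zfun u x) + zfun g (zfun v x)).
by rewrite zhom_linE (dhom_lin (zhomP g).1).
Qed.

Definition zcat : lincat k := LinCat zcmpA zcmp1f zcmpf1 zcmp_bil.

(** Short exact sequences which split in the graded sense. *)
Definition conflation (X Y Z : zcat) (i : mor X Y) (p : mor Y Z) : Prop :=
  [/\ injective (zfun i),
      forall z, exists y, zfun p y = z,
      forall y, zfun p y = 0 <-> exists x, zfun i x = y &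
      exists s : dcar Z -> dcar Y, dhom Z Y 0 s /\ forall z, zfun p (s z) = z].

(** Null-homotopic morphisms [dh + hd]. *)
Definition nullS (X Y : zcat) : submod (mor X Y).
Proof.
refine (@Submod k _ (fun f => exists h : dcar X -> dcar Y,
  dhom X Y (-1) h /\ forall x, zfun f x = ddif (h x) + h (ddif x)) _ _).
- exists 0; split; first exact: sm0.
  by move=> x; rewrite (lin0 (@ddif_lin Y)) addr0.
- move=> a f g [h [hh eh]] [l [hl el]]; exists (a *: h + l); split.
    exact: sm_lin.
  move=> x; rewrite zhom_linE eh el.
  change (a *: (ddif (h x) + h (ddif x)) + (ddif (l x) + l (ddif x)) =
    ddif (a *: h x + l x) + (a *: h (ddif x) + l (ddif x))).
  by rewrite ddif_lin scalerDr addrACA.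
Defined.

Lemma nullSl (X Y Z : zcat) (g : mor Y Z) (f : mor X Y) :
  nullS X Y f -> nullS X Z (g \c f).
Proof.
have [hg cg] := zhomP g.
move=> [h [hh eh]]; exists (fun x => zfun g (h x)); split.
  by rewrite -[-1]addr0; apply: dhom_cmp.
move=> x; rewrite -cg -(linD (dhom_lin hg)) -eh //.
Qed.

Lemma nullSr (X Y Z : zcat) (g : mor Y Z) (f : mor X Y) :
  nullS Y Z g -> nullS X Z (g \c f).
Proof.
have [hf cf] := zhomP f.
move=> [h [hh eh]]; exists (fun x => h (zfun f x)); split.
  by rewrite -[-1]add0r; apply: dhom_cmp.
by move=> x; rewrite cf -eh.
Qed.

Definition hcat : lincat k := quot_cat nullSl nullSr.
Definition hcat_proj : functor zcat hcat := quot_functor nullSl nullSr.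

End DgCategories.

(** ** The categories [𝒞A], [ℋA], [Com C] and [ℋC] *)

Section ModCat.
Variables (k : comPzRingType) (A : cdgAlg k).

Definition mod_dhom (M M' : cdgMod A) (n : int) : submod (M -> M' : lmodType k).
Proof.
refine (@Submod k _ (fun f => isHom n f /\
  forall m a, f (mact m a) = mact (f m) a) _ _).
- by split=> [|m a]; [exact: isHom0 | rewrite /= (lin0 ((mact_bil M').1 a))].
- move=> a f g [hf cf] [hg cg]; split; first exact: isHom_lin.
  move=> m b.
  change (a *: f (mact m b) + g (mact m b) = mact (a *: f m + g m) b).
  by rewrite cf cg ((mact_bil M').1 b).
Defined.

Lemma mod_dhom_id (M : cdgMod A) : mod_dhom M M 0 id.
Proof. by split=> //; apply: isHom_id. Qed.

Lemma mod_dhom_cmp (X Y Z : cdgMod A) m n (g : Y -> Z) (f : X -> Y) :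
  mod_dhom Y Z m g -> mod_dhom X Y n f ->
  mod_dhom X Z (n + m) (fun x => g (f x)).
Proof.
move=> [hg cg] [hf cf]; split; first exact: isHom_comp.
by move=> x a; rewrite cf cg.
Qed.

Definition mod_dg : dgData k :=
  @DgData k (cdgMod A) (@mcar k A) (fun M => mdif) mod_dhom
    (@mdif_hom k A) (fun _ _ _ _ h => proj1 h) mod_dhom_id mod_dhom_cmp.

Definition CA : lincat k := zcat mod_dg.
Definition HA : lincat k := hcat mod_dg.
End ModCat.

Section ComodCat.
Variables (k : comPzRingType) (C : dgCoalg k).

Lemma tmap_linl (V W V' W' : lmodType k) a (f g : V -> V') (h : W -> W') t :
  linear f -> linear g -> linear h ->
  tmap (fun x => a *: f x + g x) h t = a *: tmap f h t + tmap g h t.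
Proof.
move=> fl gl hl.
have Hl : linear (fun x => a *: f x + g x).
  move=> b u v; rewrite fl gl !scalerDr !scalerA [a * b]mulrC addrACA //.
elim/tens_ind: t => [|v w|x y hx hy].
- by rewrite !(lin0 (tmap_lin _ _)) // scaler0 addr0.
- by rewrite !tmapE // tpureDl tpureZl.
- by rewrite !(linD (tmap_lin _ _)) // hx hy scalerDr addrACA.
Qed.

Lemma lin_id (V : lmodType k) : linear (id : V -> V). Proof. by []. Qed.

Lemma lin_zero (V W : lmodType k) : linear (fun _ : V => 0 : W).
Proof. by move=> a u v; rewrite scaler0 addr0. Qed.

Lemma tmap_0l (V W V' W' : lmodType k) (h : W -> W') (t : tens V W) :
  linear h -> tmap (fun _ : V => 0 : V') h t = 0.
Proof.
move=> hl; have zl := @lin_zero V V'.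
elim/tens_ind: t => [|v w|x y hx hy].
- by rewrite (lin0 (tmap_lin _ _)).
- by rewrite tmapE // tpure0l.
- by rewrite (linD (tmap_lin _ _)) // hx hy addr0.
Qed.

Lemma tmap_cmp (V W V1 W1 V2 W2 : lmodType k) (f : V -> V1) (g : W -> W1)
    (f' : V1 -> V2) (g' : W1 -> W2) t :
  linear f -> linear g -> linear f' -> linear g' ->
  tmap f' g' (tmap f g t) = tmap (fun x => f' (f x)) (fun x => g' (g x)) t.
Proof.
move=> fl gl fl' gl'.
have h1 : linear (fun x => f' (f x)) by move=> a u v; rewrite fl fl'.
have h2 : linear (fun x => g' (g x)) by move=> a u v; rewrite gl gl'.
elim/tens_ind: t => [|v w|x y hx hy].
- by rewrite !(lin0 (tmap_lin _ _)).
- by rewrite !tmapE.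
- by rewrite !(linD (tmap_lin _ _)) // hx hy.
Qed.

Lemma tmap_id (V W : lmodType k) (t : tens V W) : tmap id id t = t.
Proof.
elim/tens_ind: t => [|v w|x y hx hy].
- by rewrite (lin0 (tmap_lin _ _)).
- by rewrite tmapE.
- by rewrite (linD (tmap_lin _ _)) // hx hy.
Qed.

Definition comod_dhom (N N' : dgComod C) (n : int) : submod (N -> N' : lmodType k).
Proof.
refine (@Submod k _ (fun f => isHom n f /\
  forall x, ncoact (f x) = tmap f id (ncoact x)) _ _).
- split=> [|x]; first exact: isHom0.
  by rewrite tmap_0l // /= (lin0 (ncoact_hom N').1).
- move=> a f g [hf cf] [hg cg]; split; first exact: isHom_lin.
  move=> x.
  change (ncoact (a *: f x + g x) =
    tmap (fun x => a *: f x + g x) id (ncoact x)).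
  rewrite tmap_linl ?hf.1 ?hg.1 //; try by case: hf; try by case: hg.
  by rewrite (ncoact_hom N').1 cf cg.
Defined.

Lemma comod_dhom_id (N : dgComod C) : comod_dhom N N 0 id.
Proof. by split=> [|x]; [exact: isHom_id | rewrite tmap_id]. Qed.

Lemma comod_dhom_cmp (X Y Z : dgComod C) m n (g : Y -> Z) (f : X -> Y) :
  comod_dhom Y Z m g -> comod_dhom X Y n f ->
  comod_dhom X Z (n + m) (fun x => g (f x)).
Proof.
move=> [hg cg] [hf cf]; split; first exact: isHom_comp.
by move=> x; rewrite cg cf tmap_cmp //; [case: hf | case: hg].
Qed.

Definition comod_dg : dgData k :=
  @DgData k (dgComod C) (@ncar k C) (fun N => ndif) comod_dhom
    (@ndif_hom k C) (fun _ _ _ _ h => proj1 h) comod_dhom_id comod_dhom_cmp.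

Definition ComC : lincat k := zcat comod_dg.
Definition HC : lincat k := hcat comod_dg.
End ComodCat.

(** * The bar and cobar constructions *)

Section LinClosure.
Variable k : pzRingType.

Lemma lin_comp (U V W : lmodType k) (f : V -> W) (g : U -> V) :
  linear f -> linear g -> linear (fun x => f (g x)).
Proof. by move=> fl gl a u v; rewrite gl fl. Qed.

Lemma lin_add (V W : lmodType k) (f g : V -> W) :
  linear f -> linear g -> linear (fun x => f x + g x).
Proof. by move=> fl gl a u v; rewrite fl gl scalerDr addrACA. Qed.

Lemma lin_opp (V W : lmodType k) (f : V -> W) :
  linear f -> linear (fun x => - f x).
Proof. by move=> fl a u v; rewrite fl opprD scalerN. Qed.
End LinClosure.

Lemma lin_scale (k : comPzRingType) (V W : lmodType k) b (f : V -> W) :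
  linear f -> linear (fun x => b *: f x).
Proof. by move=> fl a u v; rewrite fl scalerDr !scalerA mulrC. Qed.

Lemma tpure_linr (k : comPzRingType) (V W : lmodType k) (v : V) :
  linear (fun w : W => tpure v w).
Proof. exact: (tpure_bil V W).2. Qed.
Lemma tpure_linl (k : comPzRingType) (V W : lmodType k) (w : W) :
  linear (fun v : V => tpure v w).
Proof. exact: (tpure_bil V W).1. Qed.
Lemma amul_linl (k : comPzRingType) (A : cdgAlg k) (b : A) :
  linear (fun a : A => amul a b).
Proof. exact: (@amul_bil k A).1. Qed.
Lemma amul_linr (k : comPzRingType) (A : cdgAlg k) (b : A) :
  linear (fun a : A => amul b a).
Proof. exact: (@amul_bil k A).2. Qed.
Lemma mact_linl (k : comPzRingType) (A : cdgAlg k) (M : cdgMod A) (b : A) :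
  linear (fun m : M => mact m b).
Proof. exact: (mact_bil M).1. Qed.
Lemma mact_linr (k : comPzRingType) (A : cdgAlg k) (M : cdgMod A) (m : M) :
  linear (fun b : A => mact m b).
Proof. exact: (mact_bil M).2. Qed.
Lemma adif_lin (k : comPzRingType) (A : cdgAlg k) : linear (@adif k A).
Proof. by case: (@adif_hom k A). Qed.
Lemma cdif_lin (k : comPzRingType) (C : dgCoalg k) : linear (@cdif k C).
Proof. by case: (@cdif_hom k C). Qed.
Lemma cdelta_lin (k : comPzRingType) (C : dgCoalg k) : linear (@cdelta k C).
Proof. by case: (@cdelta_hom k C). Qed.
Lemma mdif_lin (k : comPzRingType) (A : cdgAlg k) (M : cdgMod A) : linear (@mdif k A M).
Proof. by case: (mdif_hom M). Qed.
Lemma ndif_lin (k : comPzRingType) (C : dgCoalg k) (N : dgComod C) : linear (@ndif k C N).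
Proof. by case: (ndif_hom N). Qed.
Lemma ncoact_lin (k : comPzRingType) (C : dgCoalg k) (N : dgComod C) :
  linear (@ncoact k C N).
Proof. by case: (ncoact_hom N). Qed.

Lemma lmact_bil (k : comPzRingType) (A : cdgAlg k) (M : cdgMod A) :
  bilinear2 (@mact k A M).
Proof. exact: mact_bil. Qed.

Lemma counitl_bil (k : comPzRingType) (C : dgCoalg k) (V : lmodType k) :
  bilinear2 (fun (y : C) (z : V) => ccounit y *: z).
Proof.
split=> [z|y] a u v /=; last by rewrite scalerDr !scalerA mulrC.
by rewrite ccounit_lin scalerDl scalerA.
Qed.

Lemma counitr_bil (k : comPzRingType) (C : dgCoalg k) (V : lmodType k) :
  bilinear2 (fun (y : V) (z : C) => ccounit z *: y).
Proof.
split=> [z|y] a u v /=; first by rewrite scalerDr !scalerA mulrC.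
by rewrite ccounit_lin scalerDl scalerA.
Qed.

Ltac lint :=
  lazymatch goal with
  | |- GRing.linear_for _ (fun x => (@?f x + @?g x)%R) => refine (lin_add (f := f) (g := g) _ _); lint
  | |- GRing.linear_for _ (fun x => (- (@?f x))%R) => refine (lin_opp (f := f) _); lint
  | |- GRing.linear_for _ (fun x => (?b *: (@?f x))%R) => refine (lin_scale b (f := f) _); lint
  | |- GRing.linear_for _ (fun x => tpure (@?f x) (@?g x)) =>
      lazymatch g with
      | (fun _ => ?w) => refine (lin_comp (f := fun y => tpure y w) (g := f) _ _);
          [exact: tpure_linl | lint]
      | _ => lazymatch f with
        | (fun _ => ?v) => refine (lin_comp (f := tpure v) (g := g) _ _);
            [exact: tpure_linr | lint]
        end
      end
  | |- GRing.linear_for _ (fun x => mact (@?f x) (@?g x)) =>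
      lazymatch g with
      | (fun _ => ?w) => refine (lin_comp (f := fun y => mact y w) (g := f) _ _);
          [exact: mact_linl | lint]
      | _ => lazymatch f with
        | (fun _ => ?v) => refine (lin_comp (f := mact v) (g := g) _ _);
            [exact: mact_linr | lint]
        end
      end
  | |- GRing.linear_for _ (fun x => amul (@?f x) (@?g x)) =>
      lazymatch g with
      | (fun _ => ?w) => refine (lin_comp (f := fun y => amul y w) (g := f) _ _);
          [exact: amul_linl | lint]
      | _ => lazymatch f with
        | (fun _ => ?v) => refine (lin_comp (f := amul v) (g := g) _ _);
            [exact: amul_linr | lint]
        end
      end
  | |- GRing.linear_for _ (fun x => x) => exact: lin_id
  | |- GRing.linear_for _ (fun x => ?F x) =>
      change (linear F); lint_atom
  | |- GRing.linear_for _ (fun x => ?F (@?g x)) =>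
      refine (lin_comp (f := F) (g := g) _ _); [lint_atom | lint]
  | |- _ => lint_atom
  end
with lint_atom :=
  first
  [ eassumption
  | exact: lin_id
  | match goal with H : isHom _ ?f |- GRing.linear_for _ ?f => exact: (proj1 H) end
  | exact: tassoc_lin | exact: tassocV_lin | exact: ksign_lin
  | exact: amul_linl | exact: amul_linr | exact: mact_linl | exact: mact_linr
  | exact: adif_lin | exact: cdif_lin | exact: cdelta_lin | exact: mdif_lin
  | exact: ndif_lin | exact: ncoact_lin | exact: tpure_linl | exact: tpure_linr
  | exact: gpr_lin
  | lazymatch goal with
    | |- GRing.linear_for _ (tmap _ _) => apply: tmap_lin; lint
    | |- GRing.linear_for _ (ktens _ _ _) => apply: ktens_lin; lint
    | |- GRing.linear_for _ (tlift _) => apply: tlift_lin; bilt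
    end ]
with bilt :=
  first [exact: counitl_bil | exact: counitr_bil | exact: amul_bil
  | exact: mact_bil | eassumption | by split=> [?|?] /=; lint ].

Ltac bext t := move: t; apply: tens_ext => [||? ?]; [lint | lint | ].

(** Identities in abelian groups. *)
Ltac zpush t := try rewrite [t + _]addrC ?addrA;
  repeat (progress rewrite [_ + t + _]addrAC).
Ltac zmod := apply/eqP; rewrite -subr_eq0; apply/eqP;
  rewrite !(opprD, opprK, oppr0) -[LHS]add0r ?addr0 !addrA;
  repeat match goal with |- context [- ?x] =>
    zpush x; zpush (- x); first [rewrite addrK | rewrite addrNK] end;
  try done.

(** Evaluation on pure tensors. *)
Ltac peval := repeat first
  [ rewrite tassocE | rewrite tassocVE
  | rewrite tmapE; [ | lint | lint ]
  | rewrite ktensE; [ | lint | lint ]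
  | rewrite tliftE; [ | bilt ] ].

Section Signs.
Variable k : comPzRingType.
Local Notation sg := (ksign 1).

Lemma ktens0 (V W V' W' : grMod k) (f : V -> V') (g : W -> W') :
  ktens 0 f g = tmap f g.
Proof. by rewrite /ktens; congr (tmap _ g); apply/funext => v; rewrite ksign0. Qed.

Lemma ksign_deg0 (V W : grMod k) (f : V -> W) n v : isHom 0 f ->
  ksign n (f v) = f (ksign n v).
Proof. by move=> hf; rewrite (ksign_isHom _ _ hf) mulr0 sgn0 scale1r. Qed.

Lemma ksign_deg1 (V W : grMod k) (f : V -> W) v : isHom 1 f ->
  ksign 1 (f v) = - f (ksign 1 v).
Proof. by move=> hf; rewrite (ksign_isHom _ _ hf) mulr1 sgn1 scaleN1r. Qed.

Lemma ksign_mact (A : cdgAlg k) (M : cdgMod A) (m : M) a n :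
  ksign n (mact m a) = mact (ksign n m) (ksign n a).
Proof.
move: m; apply: hext => [||i m hm]; [lint|lint|].
move: a; apply: hext => [||j a ha]; [lint|lint|].
rewrite (ksignE _ hm) (ksignE _ ha) (ksignE _ (mact_deg hm ha)).
by rewrite (linZ (@mact_linl _ _ _ _)) (linZ (@mact_linr _ _ _ _)) scalerA -sgnD mulrDr.
Qed.

Lemma ksign_amul (A : cdgAlg k) (a b : A) n :
  ksign n (amul a b) = amul (ksign n a) (ksign n b).
Proof.
move: a; apply: hext => [||i a ha]; [lint|lint|].
move: b; apply: hext => [||j b hb]; [lint|lint|].
rewrite (ksignE _ ha) (ksignE _ hb) (ksignE _ (amul_deg ha hb)).
by rewrite (linZ (@amul_linl _ _ _)) (linZ (@amul_linr _ _ _)) scalerA -sgnD mulrDr.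
Qed.

Lemma mdif_mact (A : cdgAlg k) (M : cdgMod A) (m : M) a :
  mdif (mact m a) = mact (mdif m) a + mact (sg m) (adif a).
Proof.
move: m; apply: hext => [||i m hm]; [lint|lint|].
by rewrite (mdif_act _ hm) (ksignE _ hm) mul1r (linZ (@mact_linl _ _ _ _)).
Qed.

Lemma adif_amul (A : cdgAlg k) (a b : A) :
  adif (amul a b) = amul (adif a) b + amul (sg a) (adif b).
Proof.
move: a; apply: hext => [||i a ha]; [lint|lint|].
by rewrite (adif_mul _ ha) (ksignE _ ha) mul1r (linZ (@amul_linl _ _ _)).
Qed.
End Signs.

Section BarCobar.
Variables (k : comPzRingType) (A : cdgAlg k) (C : dgCoalg k) (tau : C -> A).
Hypothesis mc : maurer_cartan tau.
Local Notation sg := (ksign 1).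

Lemma mc_hom : isHom 1 tau. Proof. exact: proj1 mc. Qed.

Lemma mc_lin : linear tau. Proof. by case: mc_hom. Qed.

Lemma mc_sign x : sg (tau x) = - tau (sg x).
Proof. exact/ksign_deg1/mc_hom. Qed.

Lemma mc_eq x : adif (tau x) + tau (cdif x) +
  tlift amul (ktens 1 tau tau (cdelta x)) = - (ccounit x *: acurv).
Proof.
apply/eqP; rewrite -subr_eq0 opprK addrC addrA; apply/eqP; exact: (proj2 mc).
Qed.

(** ** The bar construction [M ⊗_tau C] *)

Section BarOb.
Variable M : cdgMod A.
Implicit Types (m : M) (x : C) (t : gtens M C).

Definition bar_coact : gtens M C -> gtens (gtens M C) C :=
  fun t => tassocV (tmap id cdelta t).

(** [(m2 ⊗ 1) (1 ⊗ tau ⊗ 1) (1 ⊗ Delta)] *)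
Definition bar_twist : gtens M C -> gtens M C := fun t =>
  tmap (tlift mact) id
    (tassocV (@ktens k M (gtens C C) M (gtens A C) 1 id (ktens 0 tau id)
      (tmap id cdelta t))).

Definition bar_dif : gtens M C -> gtens M C := fun t =>
  ktens 0 mdif id t + ktens 1 id cdif t - bar_twist t.

Local Notation tl := mc_lin.

Let G (m : M) : tens C C -> tens M C := tmap (fun y => mact (sg m) (tau y)) id.

Lemma barGE m y z : G m (tpure y z) = tpure (mact (sg m) (tau y)) z.
Proof. by have tl := tl; rewrite /G; peval. Qed.

Lemma barG_lin m : linear (G m).
Proof. by have tl := tl; rewrite /G; lint. Qed.

Lemma bar_twistE m x : bar_twist (tpure m x) = G m (cdelta x).
Proof.
have tl := tl; rewrite /bar_twist ktens0; peval.
move: (cdelta x); apply: tens_ext => [||y z].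
- lint.
- exact: barG_lin.
- by rewrite barGE; peval.
Qed.

Lemma bar_difE m x : bar_dif (tpure m x) =
  tpure (mdif m) x + tpure (sg m) (cdif x) - G m (cdelta x).
Proof. by rewrite /bar_dif ktens0 bar_twistE; peval. Qed.

Lemma bar_twist_lin : linear bar_twist.
Proof. by have tl := tl; rewrite /bar_twist ktens0; lint. Qed.

Lemma bar_dif_lin : linear bar_dif.
Proof. by have tl := bar_twist_lin; rewrite /bar_dif; lint. Qed.

Lemma bar_dif_hom : isHom 1 bar_dif.
Proof.
have htau := mc_hom.
apply: isHomD; first apply: isHomD.
- exact: (ktens_isHom 0 (mdif_hom M) (isHom_id C)).
- exact: (ktens_isHom 1 (isHom_id M) (@cdif_hom k C)).
apply: isHomN; apply: tens_isHom; first exact: bar_twist_lin.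
move=> i j m x hm hx; rewrite /bar_twist.
have h1 := homog_tpure hm hx.
have h2 := (tmap_isHom (isHom_id M) (@cdelta_hom k C)).2 _ _ h1.
have h3 := (ktens_isHom 1 (isHom_id M) (ktens_isHom 0 htau (isHom_id C))).2 _ _ h2.
have h4 := (tassocV_isHom M A C).2 _ _ h3.
have hact : @isHom k (gtens M A) M 0 (tlift mact).
  apply: tens_isHom => [|i' j' m' a' hm' ha']; first lint.
  by rewrite addr0; peval; apply: mact_deg.
have := (tmap_isHom hact (isHom_id C)).2 _ _ h4.
by rewrite !addr0 !add0r.
Qed.

Let P (m : M) : tens C C -> M := fun p => mact m (tlift amul (ktens 1 tau tau p)).

Lemma barP_lin m : linear (P m).
Proof. by have tl := tl; rewrite /P; lint. Qed.

Lemma bar_difG m u : bar_dif (G m u) =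
  - G (mdif m) u + tmap (fun y => mact m (adif (tau y))) id u
  - tmap (fun y => mact m (tau (sg y))) cdif u
  + tmap (P m) id (tassocV (tmap id cdelta u)).
Proof.
have tl := tl; have Gl := barG_lin; have Pl := barP_lin m; have dl := bar_dif_lin.
move: u; apply: tens_ext => [||y z].
- exact: (lin_comp (f := bar_dif) dl (Gl m)).
- have Gl' := Gl (mdif m); lint.
rewrite !barGE bar_difE; peval.
rewrite mdif_mact ksignK ksign_mact ksignK !(ksign_deg1 _ (mdif_hom M)) mc_sign.
rewrite (linN (@mact_linr _ _ _ _)) (linN (@mact_linl _ _ _ _)).
rewrite !(linN (@tpure_linl _ _ _ _)) tpureDl opprK -!addrA; congr (_ + (_ + (_ + _))).
have Gn := Gl (mact (sg m) (tau y)).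
move: (cdelta z); apply: tens_ext => [||a b]; [lint|lint|].
rewrite barGE; peval; rewrite /P; peval.
rewrite ksign_mact ksignK mc_sign (linN (@mact_linr _ _ _ _)).
by rewrite (linN (@mact_linl _ _ _ _)) (linN (@tpure_linl _ _ _ _)) opprK mactA.
Qed.

Lemma bar_sq t : bar_dif (bar_dif t) = 0.
Proof.
have tl := tl; have Gl := barG_lin; have dl := bar_dif_lin.
move: t; apply: tens_ext => [||m x]; [lint | exact: lin_zero | ].
have Pl := barP_lin m.
rewrite bar_difE (linB dl) (linD dl) !bar_difE bar_difG.
rewrite mdif_sq cdif_sq ksignK !(ksign_deg1 _ (mdif_hom M)) tpure0r addr0.
have -> : mdif (sg m) = - sg (mdif m) by rewrite (ksign_deg1 _ (mdif_hom M)) opprK.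
rewrite cdif_delta ktens0 (linD (Gl _)).
have -> : tmap (P m) id (tassocV (tmap id cdelta (cdelta x))) =
    tmap (fun y => P m (cdelta y)) id (cdelta x).
  by rewrite -cdeltaA tassocK tmap_cmp //; lint.
have E1 (u : tens C C) : G (sg m) (tmap cdif id u) = tmap (fun y => mact m (tau (cdif y))) id u.
  have Gs := Gl (sg m).
  move: u; apply: tens_ext => [||y z]; [lint|lint|].
  by peval; rewrite barGE ksignK.
have E2 (u : tens C C) : G (sg m) (ktens 1 id cdif u) =
    tmap (fun y => mact m (tau (sg y))) cdif u.
  have Gs := Gl (sg m).
  move: u; apply: tens_ext => [||y z]; [lint|lint|].
  by peval; rewrite barGE ksignK.
have E3 (u : tens C C) : tmap (fun y => mact m (tau (cdif y))) id u +
    tmap (fun y => mact m (adif (tau y))) id u +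
    tmap (fun y => P m (cdelta y)) id u =
    - tpure (mact m acurv) (tlift (fun y z => ccounit y *: z) u).
  move: u; apply: tens_ext => [||y z]; [lint|lint|].
  peval; rewrite -!tpureDl /P -!(linD (@mact_linr _ _ _ _)).
  rewrite [tau _ + _]addrC mc_eq (linN (@mact_linr _ _ _ _)).
  rewrite (linZ (@mact_linr _ _ _ _)) (linN (@tpure_linl _ _ _ _)).
  by rewrite tpureZl tpureZr.
rewrite E1 E2; have := E3 (cdelta x); rewrite ccounitl => {}E3.
rewrite (linN (@tpure_linl _ _ _ _)) -E3 (linN (@tpure_linl _ _ _ _)).
by zmod.
Qed.

Lemma bar_coact_lin : linear bar_coact.
Proof. by rewrite /bar_coact; lint. Qed.

Lemma bar_coactE m x : bar_coact (tpure m x) = tassocV (tpure m (cdelta x)).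
Proof. by rewrite /bar_coact; peval. Qed.

Lemma bar_coact_hom : isHom 0 bar_coact.
Proof.
have h := tmap_isHom (isHom_id M) (@cdelta_hom k C).
by have := isHom_comp (tassocV_isHom M C C) h.
Qed.

Lemma bar_coactA t :
  tassoc (tmap bar_coact id (bar_coact t)) = tmap id cdelta (bar_coact t).
Proof.
have cl := bar_coact_lin.
move: t; apply: tens_ext => [||m x]; [lint | lint | ].
rewrite bar_coactE.
have E1 (u : tens C C) : tassoc (tmap bar_coact id (tassocV (tpure m u))) =
    tassocV (tpure m (tassoc (tmap cdelta id u))).
  move: u; apply: tens_ext => [||y z]; [lint|lint|].
  peval; rewrite bar_coactE; move: (cdelta y).
  by apply: tens_ext => [||a b]; [lint|lint|]; peval.
rewrite E1 cdeltaA; move: (cdelta x).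
by apply: tens_ext => [||y z]; [lint|lint|]; peval.
Qed.

Lemma bar_counit t : tlift (fun y z => ccounit z *: y) (bar_coact t) = t.
Proof.
have cl := bar_coact_lin.
move: t; apply: tens_ext => [||m x]; [lint | lint | ].
rewrite bar_coactE -{2}[x]ccounitr; move: (cdelta x).
by apply: tens_ext => [||y z]; [lint|lint|]; peval; rewrite tpureZr.
Qed.

Lemma bar_dif_coact t : bar_coact (bar_dif t) =
  @ktens k (gtens M C) C (gtens M C) C 0 bar_dif id (bar_coact t) +
  @ktens k (gtens M C) C (gtens M C) C 1 id cdif (bar_coact t).
Proof.
have cl := bar_coact_lin; have tl := tl; have Gl := barG_lin.
have dl := bar_dif_lin; rewrite ktens0.
move: t; apply: tens_ext => [||m x]; [lint | lint | ].
have Gm := Gl m.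
rewrite bar_difE (linB cl) (linD cl) !bar_coactE cdif_delta ktens0.
pose Q : tens C (tens C C) -> tens (tens M C) C :=
  fun p => tassocV (tmap (fun y => mact (sg m) (tau y)) id p).
have Ql : linear Q by rewrite /Q; lint.
have -> : bar_coact (G m (cdelta x)) = Q (tmap id cdelta (cdelta x)).
  move: (cdelta x); apply: tens_ext => [||y z]; [lint|lint|].
  by rewrite barGE bar_coactE; peval; rewrite /Q; peval.
rewrite -cdeltaA.
move: (cdelta x); apply: tens_ext => [||y z]; [lint|lint|].
peval; rewrite bar_difE ksign_tpure.
have -> : Q (tassoc (tpure (cdelta y) z)) = tpure (G m (cdelta y)) z.
  move: (cdelta y); apply: tens_ext => [||a b]; [lint|lint|].
  by rewrite barGE; peval; rewrite /Q; peval.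
rewrite tpureDr (linD (@tassocV_lin _ _ _ _)); peval.
rewrite (linB (@tpure_linl _ _ _ _)) tpureDl.
by zmod.
Qed.

Definition bar_ob : dgComod C :=
  @DgComod k C (gtens M C) bar_coact bar_dif bar_coact_hom bar_coactA bar_counit
    bar_dif_hom bar_sq bar_dif_coact.
End BarOb.

Lemma bar_map_subproof (M M' : CA A) (f : mor M M') :
  @zhomS _ (comod_dg C) (bar_ob M) (bar_ob M') (tmap (zfun f) id).
Proof.
have [[fh fa] fd] := zhomP f; have fl := fh.1.
move: (zfun f) fh fa fd fl => {}f fh fa fd fl /=.
have dl := @bar_dif_lin M; have dl' := @bar_dif_lin M'.
have cl := @bar_coact_lin M; have cl' := @bar_coact_lin M'.
split; first split.
- exact: (tmap_isHom fh (isHom_id C)).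
- rewrite /=; apply: tens_ext => [||m x]; [lint|lint|].
  peval; rewrite !bar_coactE; move: (cdelta x).
  by apply: tens_ext => [||y z]; [lint|lint|]; peval.
- rewrite /=; apply: tens_ext => [||m x]; [lint|lint|].
  rewrite bar_difE; peval; rewrite bar_difE.
  have fl' : linear (tmap f (@id C)) by lint.
  rewrite (linB fl') (linD fl'); peval; rewrite fd (ksign_deg0 _ _ fh).
  congr (_ + _ - _); have tl := mc_lin.
  move: (cdelta x); apply: tens_ext => [||y z]; [lint|lint|].
  by peval; rewrite fa.
Qed.

Definition bar_map (M M' : CA A) (f : mor M M') :
    @mor k (ComC C) (bar_ob M) (bar_ob M') := smI (bar_map_subproof f).

Lemma bar_map_lin (M M' : CA A) : linear (@bar_map M M').
Proof.
move=> a f g; apply: zhom_ext => t; rewrite zhom_linE /=.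
have fl := (zhomP f).1.1.1; have gl := (zhomP g).1.1.1.
rewrite -tmap_linl //; congr (tmap _ id t).
Qed.

Lemma bar_map_id (M : CA A) : bar_map (idm M) = idm (bar_ob M : ComC C).
Proof. by apply: zhom_ext => t; exact: tmap_id. Qed.

Lemma bar_map_cmp (X Y Z : CA A) (g : mor Y Z) (f : mor X Y) :
  bar_map (g \c f) = cmp (l := ComC C) (bar_map g) (bar_map f).
Proof.
apply: zhom_ext => t; have fl := (zhomP f).1.1.1; have gl := (zhomP g).1.1.1.
change (tmap (fun x => zfun g (zfun f x)) id t =
  tmap (zfun g) id (tmap (zfun f) id t)).
by rewrite tmap_cmp.
Qed.

Definition bar : functor (CA A) (ComC C) :=
  Functor bar_map_lin bar_map_id bar_map_cmp.

(** ** The cobar construction [N ⊗_tau A] *)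

Section CobarOb.
Variable N : dgComod C.
Implicit Types (n : N) (a b : A) (t : gtens N A).

Definition cobar_act : gtens N A -> A -> gtens N A :=
  fun t b => tmap id (fun a => amul a b) t.

(** [(1 ⊗ m2) (1 ⊗ tau ⊗ 1) (Delta_N ⊗ 1)] *)
Definition cobar_twist : gtens N A -> gtens N A := fun t =>
  tmap id (tlift amul) (tassoc
    (@ktens k (gtens N C) A (gtens N A) A 0 (ktens 1 id tau) id
      (tmap ncoact id t))).

Definition cobar_dif : gtens N A -> gtens N A := fun t =>
  ktens 0 ndif id t + ktens 1 id adif t + cobar_twist t.

Let S (a : A) : tens N C -> tens N A := tmap sg (fun c => amul (tau c) a).

Lemma cobarSE a n c : S a (tpure n c) = tpure (sg n) (amul (tau c) a).
Proof. by have tl := mc_lin; rewrite /S; peval. Qed.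

Lemma cobarS_lin a : linear (S a).
Proof. by have tl := mc_lin; rewrite /S; lint. Qed.

Lemma cobar_twistE n a : cobar_twist (tpure n a) = S a (ncoact n).
Proof.
have tl := mc_lin; have Sl := cobarS_lin a; rewrite /cobar_twist ktens0; peval.
move: (ncoact n); apply: tens_ext => [||p q]; [lint|lint|].
by rewrite cobarSE; peval.
Qed.

Lemma cobar_difE n a : cobar_dif (tpure n a) =
  tpure (ndif n) a + tpure (sg n) (adif a) + S a (ncoact n).
Proof. by rewrite /cobar_dif ktens0 cobar_twistE; peval. Qed.

Lemma cobar_twist_lin : linear cobar_twist.
Proof. by have tl := mc_lin; rewrite /cobar_twist ktens0; lint. Qed.

Lemma cobar_dif_lin : linear cobar_dif.
Proof. by have tl := cobar_twist_lin; rewrite /cobar_dif; lint. Qed.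

Lemma cobar_dif_hom : isHom 1 cobar_dif.
Proof.
have htau := mc_hom.
apply: isHomD; first apply: isHomD.
- exact: (ktens_isHom 0 (ndif_hom N) (isHom_id A)).
- exact: (ktens_isHom 1 (isHom_id N) (@adif_hom k A)).
apply: tens_isHom; first exact: cobar_twist_lin.
move=> i j n a hn ha; rewrite /cobar_twist.
have h1 := homog_tpure hn ha.
have h2 := (tmap_isHom (ncoact_hom N) (isHom_id A)).2 _ _ h1.
have h3 := (ktens_isHom 0 (ktens_isHom 1 (isHom_id N) htau) (isHom_id A)).2 _ _ h2.
have h4 := (tassoc_isHom N A A).2 _ _ h3.
have hmul : @isHom k (gtens A A) A 0 (tlift amul).
  apply: tens_isHom => [|i' j' m' a' hm' ha']; first lint.
  by rewrite addr0; peval; apply: amul_deg.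
have := (tmap_isHom (isHom_id N) hmul).2 _ _ h4.
by rewrite !addr0 !add0r.
Qed.

Lemma cobar_act_linl b : linear (cobar_act^~ b).
Proof. by rewrite /cobar_act; lint. Qed.

Lemma cobar_actE n a b : cobar_act (tpure n a) b = tpure n (amul a b).
Proof. by rewrite /cobar_act; peval. Qed.

Lemma cobar_act_bil : bilinear2 cobar_act.
Proof.
split=> [b|t] x u v; first exact: cobar_act_linl.
move: t; apply: tens_ext => [||n a].
- exact: cobar_act_linl.
- have h1 := cobar_act_linl u; have h2 := cobar_act_linl v.
  by apply: lin_add => //; apply: lin_scale.
- by rewrite !cobar_actE (@amul_linr _ _ a) tpureDr tpureZr.
Qed.

Lemma cobar_act_deg i j t b :
  homog i t -> homog j b -> homog (i + j) (cobar_act t b).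
Proof.
move=> ht hb.
have h : isHom j (fun a => amul a b).
  by split=> [|l a ha]; [exact: amul_linl | apply: amul_deg].
have [_ h'] := tmap_isHom (isHom_id N) h.
by rewrite -[j]add0r; apply: h'.
Qed.

Lemma cobar_actA t a b : cobar_act (cobar_act t a) b = cobar_act t (amul a b).
Proof.
rewrite /cobar_act tmap_cmp; [|lint..].
by congr (tmap _ _ t); apply/funext => x; rewrite amulA.
Qed.

Lemma cobar_act1 t : cobar_act t aone = t.
Proof.
rewrite -[RHS]tmap_id /cobar_act.
by congr (tmap _ _ t); apply/funext => x; rewrite amula1.
Qed.

Lemma cobar_dif_act i t a : homog i t ->
  cobar_dif (cobar_act t a) = cobar_act (cobar_dif t) a
                              + sgn i *: cobar_act t (adif a).
Proof.
move=> ht; have dl := cobar_dif_lin; have al := cobar_act_linl.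
have al1 := al a; have al2 := al (adif a).
rewrite -(linZ al2) -[i]mul1r -(ksignE _ ht); move: {ht} t.
apply: tens_ext => [||n b].
- exact: (lin_comp dl al1).
- apply: lin_add; first exact: (lin_comp al1 dl).
  exact: (lin_comp al2 (@ksign_lin _ _ _)).
rewrite ksign_tpure !cobar_actE !cobar_difE !(linD al1) !cobar_actE.
rewrite adif_amul tpureDr.
have -> : cobar_act (S b (ncoact n)) a = S (amul b a) (ncoact n).
  have s1 := cobarS_lin b; have s2 := cobarS_lin (amul b a).
  move: (ncoact n); apply: tens_ext => [||p q]; [exact: (lin_comp al1 s1)|lint|].
  by rewrite !cobarSE cobar_actE amulA.
by zmod.
Qed.

Lemma cobar_sq t : cobar_dif (cobar_dif t) = - cobar_act t acurv.
Proof.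
have tl := mc_lin; have dl := cobar_dif_lin; have al := cobar_act_linl acurv.
move: t; apply: tens_ext => [||n a]; [lint | exact: lin_opp | ].
have Sl := cobarS_lin; have Sa := Sl a; have Sd := Sl (adif a).
rewrite cobar_difE !(linD dl) !cobar_difE cobar_actE.
rewrite ndif_sq tpure0l add0r ksignK (ksign_deg1 _ (ndif_hom N)) adif_sq.
have -> : ndif (sg n) = - sg (ndif n) by rewrite (ksign_deg1 _ (ndif_hom N)) opprK.
rewrite ndif_coact ktens0 (linD Sa) -(ksign_deg0 _ n (ncoact_hom N)).
pose H : tens N (tens C C) -> tens N A :=
  tmap id (fun v => amul (tlift amul (ktens 1 tau tau v)) a).
have Hl : linear H by rewrite /H; lint.
have E1 (u : tens N C) : cobar_dif (S a u) = - S a (tmap ndif id u)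
    + tmap id (fun q => amul (adif (tau q)) a) u
    - S (adif a) (ksign (V := gtens N C) 1 u)
    + H (tassoc (tmap ncoact id u)).
  move: u; apply: tens_ext => [||p q]; [lint|lint|].
  rewrite cobarSE cobar_difE; peval; rewrite ksign_tpure !cobarSE !ksignK.
  rewrite (ksign_deg1 _ (ndif_hom N)) (linN (@tpure_linl _ _ _ _)) opprK.
  rewrite adif_amul mc_sign (linN (@amul_linl _ _ _)) tpureDr.
  rewrite (linN (@tpure_linr _ _ _ _)) -!addrA; congr (_ + (_ + (_ + _))).
  have Sq := Sl (amul (tau q) a); rewrite -(ksign_deg0 _ p (ncoact_hom N)).
  move: (ncoact p); apply: tens_ext => [||x y]; [lint|lint|].
  rewrite ksign_tpure cobarSE ksignK; peval; rewrite /H; peval.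
  by rewrite amulA.
have E2 (u : tens N C) : S a (ktens 1 id cdif u) =
    tmap id (fun q => amul (tau (cdif q)) a) u.
  move: u; apply: tens_ext => [||p q]; [lint|lint|].
  by peval; rewrite cobarSE ksignK.
have E3 (u : tens N C) : tmap id (fun q => amul (tau (cdif q)) a) u +
    tmap id (fun q => amul (adif (tau q)) a) u + H (tmap id cdelta u) =
    - tpure (tlift (fun y z => ccounit z *: y) u) (amul acurv a).
  move: u; apply: tens_ext => [||p q]; [lint|lint|].
  peval; rewrite /H; peval; rewrite -!tpureDr -!(linD (@amul_linl _ _ a)).
  rewrite [tau _ + _]addrC mc_eq (linN (@amul_linl _ _ _)).
  rewrite (linZ (@amul_linl _ _ _)) (linN (@tpure_linr _ _ _ _)).
  by rewrite tpureZl tpureZr.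
rewrite E1 E2 ncoactA; have := E3 (ncoact n); rewrite ncounit => {}E3.
rewrite (linB (@tpure_linr _ _ _ _)) -[tpure n (amul acurv a)]opprK -E3.
rewrite !(linN (@tpure_linl _ _ _ _)).
by zmod.
Qed.

Definition cobar_ob : cdgMod A :=
  @CdgMod k A (gtens N A) cobar_act cobar_dif cobar_act_bil cobar_act_deg
    cobar_actA cobar_act1 cobar_dif_hom cobar_sq cobar_dif_act.
End CobarOb.

Lemma cobar_map_subproof (N N' : ComC C) (f : mor N N') :
  @zhomS _ (mod_dg A) (cobar_ob N) (cobar_ob N') (tmap (zfun f) id).
Proof.
have [[fh fa] fd] := zhomP f; have fl := fh.1.
move: (zfun f) fh fa fd fl => {}f fh fa fd fl /=.
have dl := @cobar_dif_lin N; have dl' := @cobar_dif_lin N'.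
split; first split.
- exact: (tmap_isHom fh (isHom_id A)).
- move=> t b; move: t; rewrite /= /cobar_act.
  by apply: tens_ext => [||n a]; [lint|lint|]; peval.
- rewrite /=; apply: tens_ext => [||n a]; [lint|lint|].
  rewrite cobar_difE; peval; rewrite cobar_difE.
  have fl' : linear (tmap f (@id A)) by lint.
  rewrite !(linD fl'); peval; rewrite fd (ksign_deg0 _ _ fh) fa.
  congr (_ + _ + _); have tl := mc_lin.
  move: (ncoact n); apply: tens_ext => [||y z]; [lint|lint|].
  by peval; rewrite (ksign_deg0 _ _ fh).
Qed.

Definition cobar_map (N N' : ComC C) (f : mor N N') :
    @mor k (CA A) (cobar_ob N) (cobar_ob N') := smI (cobar_map_subproof f).

Lemma cobar_map_lin (N N' : ComC C) : linear (@cobar_map N N').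
Proof.
move=> a f g; apply: zhom_ext => t; rewrite zhom_linE /=.
have fl := (zhomP f).1.1.1; have gl := (zhomP g).1.1.1.
rewrite -tmap_linl //; congr (tmap _ id t).
Qed.

Lemma cobar_map_id (N : ComC C) : cobar_map (idm N) = idm (cobar_ob N : CA A).
Proof. by apply: zhom_ext => t; exact: tmap_id. Qed.

Lemma cobar_map_cmp (X Y Z : ComC C) (g : mor Y Z) (f : mor X Y) :
  cobar_map (g \c f) = cmp (l := CA A) (cobar_map g) (cobar_map f).
Proof.
apply: zhom_ext => t; have fl := (zhomP f).1.1.1; have gl := (zhomP g).1.1.1.
change (tmap (fun x => zfun g (zfun f x)) id t =
  tmap (zfun g) id (tmap (zfun f) id t)).
by rewrite tmap_cmp.
Qed.

Definition cobar : functor (ComC C) (CA A) :=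
  Functor cobar_map_lin cobar_map_id cobar_map_cmp.
End BarCobar.

(** * Complexes and their cohomology *)

Record complex (k : comPzRingType) := Complex {
  cx :> int -> lmodType k;
  cd : forall m n, m + 1 = n -> cx m -> cx n;
  cd_lin : forall m n (e : m + 1 = n), linear (cd e);
  cd_sq : forall m n p (e : m + 1 = n) (e' : n + 1 = p) x, cd e' (cd e x) = 0 }.

Arguments cd {k c m n}.

Record chmap (k : comPzRingType) (X Y : complex k) := ChMap {
  chf :> forall n, X n -> Y n;
  chf_lin : forall n, linear (@chf n);
  chf_cd : forall m n (e : m + 1 = n) x, chf (cd e x) = cd e (chf x) }.

Arguments chf {k X Y} c n.
Arguments chf_lin {k X Y} c n.
Arguments chf_cd {k X Y} c {m n} e.

Section Cohomology.
Variable k : comPzRingType.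

Definition cycles (X : complex k) (n : int) : submod (X n).
Proof.
refine (@Submod k _ (fun x => cd (erefl (n + 1)) x = 0) (lin0 (cd_lin _)) _).
by move=> a u v hu hv; rewrite cd_lin hu hv scaler0 addr0.
Defined.

Definition boundaries (X : complex k) (n : int) : submod (smT (cycles X n)).
Proof.
refine (@Submod k _ (fun z => exists y : X (n - 1), val z = cd (subrK 1 n) y) _ _).
- by exists 0; rewrite (lin0 (cd_lin _)).
- move=> a u v [x hx] [y hy]; exists (a *: x + y).
  by rewrite cd_lin -hx -hy; apply: val_lin.
Defined.

Definition cohomology (n : int) (X : complex k) : lmodType k :=
  quotM (boundaries X n).

Lemma cyc_map_subproof (X Y : complex k) (f : chmap X Y) n
  (z : smT (cycles X n)) : cycles Y n (f n (val z)).
Proof. by rewrite /= -chf_cd (smP z) (lin0 (chf_lin _ _)). Qed.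

Definition cyc_map (X Y : complex k) (f : chmap X Y) n
  (z : smT (cycles X n)) : smT (cycles Y n) := smI (cyc_map_subproof f z).

Definition coh_map (X Y : complex k) (f : chmap X Y) n :
  cohomology n X -> cohomology n Y := qmap (boundaries Y n) (@cyc_map X Y f n).

Lemma cyc_map_lin (X Y : complex k) (f : chmap X Y) n : linear (@cyc_map X Y f n).
Proof.
move=> a u v; apply: val_inj; rewrite val_lin /= -chf_lin.
by congr (f n _); apply: val_lin.
Qed.

Lemma cyc_map_bound (X Y : complex k) (f : chmap X Y) n z :
  boundaries X n z -> boundaries Y n (cyc_map f z).
Proof. by move=> [y hy]; exists (f _ y); rewrite -chf_cd -hy. Qed.

Lemma coh_mapE (X Y : complex k) (f : chmap X Y) n z :
  coh_map f (qproj (boundaries X n) z) = qproj (boundaries Y n) (cyc_map f z).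
Proof. exact: (qmapE (@cyc_map_lin X Y f n) (@cyc_map_bound X Y f n)). Qed.
End Cohomology.

(** * The twisted Hom complex [F_tau(Hom(N, M))] *)

(** The degree [n] component of [Hom(V, W)]. *)
Definition homS (k : comPzRingType) (V W : grMod k) (n : int) :
    submod (V -> W : lmodType k) :=
  @Submod k _ (isHom n) (isHom0 V W n) (fun a f g => @isHom_lin k V W n a f g).

Section Ftau.
Variables (k : comPzRingType) (A : cdgAlg k) (C : dgCoalg k) (tau : C -> A).
Hypothesis mc : maurer_cartan tau.
Local Notation sg := (ksign 1).

Section Objects.
Variables (N : dgComod C) (M : cdgMod A).

(** [d_tau f] for [f] of degree [n]. *)
Definition ftau_fun (n : int) (f : N -> M) : N -> M := fun x =>
  mdif (f x) - sgn n *: f (ndif x)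
  + sgn (n + 1) *: tlift mact (ktens 1 f tau (ncoact x)).

Lemma ftau_fun_hom n f : isHom n f -> isHom (n + 1) (ftau_fun n f).
Proof.
move=> hf; have htau := mc_hom mc.
apply: isHomD; first apply: isHomD.
- exact: isHom_comp (mdif_hom M) hf.
- by apply/isHomN/isHomZ; rewrite addrC; apply: isHom_comp hf (ndif_hom N).
apply: isHomZ.
have hact : @isHom k (gtens M A) M 0 (tlift mact).
  apply: tens_isHom => [|i j m a hm ha]; first lint.
  by rewrite addr0; peval; apply: mact_deg.
have h1 := isHom_comp (ktens_isHom 1 hf htau) (ncoact_hom N).
by have := isHom_comp hact h1; rewrite add0r addr0.
Qed.

Lemma ftau_fun_sq n f : isHom n f -> forall x, ftau_fun (n + 1) (ftau_fun n f) x = 0.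
Proof.
move=> hf x; have fl := hf.1; have tl := mc_lin mc.
have htau := mc_hom mc; have gl := (ftau_fun_hom hf).1.
pose B (h : N -> M) (u : tens N C) := tlift mact (ktens 1 h tau u).
have BE h p q : linear h -> B h (tpure p q) = mact (h (sg p)) (tau q).
  by move=> hl; rewrite /B; peval.
have Bl h : linear h -> linear (B h).
  by move=> hl; rewrite /B; lint.
pose fd := fun y => f (ndif y).
pose df := fun y => mdif (f y).
have fdl : linear fd by rewrite /fd; lint.
have dfl : linear df by rewrite /df; lint.
have Bf := Bl f fl; have Bfd := Bl fd fdl; have Bdf := Bl df dfl.
have Bg := Bl _ gl.
pose s : k := sgn n.
have ss v : s *: (s *: v) = v :> M by rewrite scalerA sgnK scale1r.
have s1 : sgn (n + 1) = - s by rewrite sgnD sgn1 mulrN1.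
have s2 : sgn (n + 1 + 1) = s by rewrite !sgnD sgn1 mulrN1 mulrN1 opprK.
have gE y : ftau_fun n f y = df y - s *: fd y - s *: B f (ncoact y).
  by rewrite /ftau_fun s1 scaleNr.
pose F1 (u : tens N C) := tlift mact (tmap f (fun q => adif (tau q)) u).
pose F2 (u : tens N C) := tlift mact (tmap f (fun q => tau (cdif q)) u).
pose F3 (p : tens N (tens C C)) :=
  tlift mact (tmap f (fun v => tlift amul (ktens 1 tau tau v)) p).
have F1l : linear F1 by rewrite /F1; lint.
have F2l : linear F2 by rewrite /F2; lint.
have F3l : linear F3 by rewrite /F3; lint.
have sf y : sg (f y) = s *: f (sg y).
  by rewrite (ksign_isHom _ _ hf) mul1r.
have dB (u : tens N C) : mdif (B f u) = B df u + s *: F1 u.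
  move: u; apply: tens_ext => [||p q]; [lint|lint|].
  by rewrite !BE // mdif_mact sf ksignK (linZ (@mact_linl _ _ _ _)) /F1; peval.
have Bd (u : tens N C) : B f (ktens 0 ndif id u) + B f (ktens 1 id cdif u) =
    F2 u - B fd u.
  rewrite ktens0; move: u; apply: tens_ext => [||p q]; [lint|lint|].
  peval; rewrite !BE // /F2; peval; rewrite ksignK /fd.
  rewrite (ksign_deg1 _ (ndif_hom N)) (linN fl) (linN (@mact_linl _ _ _ _)).
  by rewrite addrC.
have BB (u : tens N C) : B (ftau_fun n f) u =
    B df u - s *: B fd u - s *: F3 (tassoc (tmap ncoact id u)).
  move: u; apply: tens_ext => [||p q]; [lint|lint|].
  rewrite !BE // gE; peval.
  rewrite !(linB (@mact_linl _ _ _ _)) !(linZ (@mact_linl _ _ _ _)).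
  congr (_ - _ - _ *: _); rewrite -(ksign_deg0 _ p (ncoact_hom N)).
  move: (ncoact p); apply: tens_ext => [||y z]; [lint|lint|].
  rewrite ksign_tpure BE // ksignK /F3; peval.
  by rewrite mactA.
have tot (u : tens N C) : F2 u + F1 u + F3 (tmap id cdelta u) =
    - mact (f (tlift (fun y z => ccounit z *: y) u)) acurv.
  move: u; apply: tens_ext => [||p q]; [lint|lint|].
  rewrite /F1 /F2 /F3; peval; rewrite -!(linD (@mact_linr _ _ _ _)).
  rewrite [tau _ + _]addrC (mc_eq mc) (linN (@mact_linr _ _ _ _)).
  by rewrite (linZ (@mact_linr _ _ _ _)) (linZ fl) (linZ (@mact_linl _ _ _ _)).
have := tot (ncoact x); rewrite ncounit => {}tot.
rewrite {1}/ftau_fun s1 s2 -/(B _ _) BB !gE ncoactA.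
rewrite !(linB (@mdif_lin _ _ M)) !(linZ (@mdif_lin _ _ M)) dB.
rewrite ndif_coact (linD Bf) Bd.
rewrite {1}/df mdif_sq {2}/fd ndif_sq (lin0 fl) scaler0 subr0.
rewrite scaleNr !scalerBr !ss !scalerDr ss.
change (df (ndif x)) with (mdif (fd x)); rewrite -tot.
by zmod.
Qed.

Definition ftau_ob (n : int) : lmodType k := smT (homS N M n).

Lemma ftau_cd_subproof m n (e : m + 1 = n) (f : ftau_ob m) :
  homS N M n (ftau_fun m (val f)).
Proof. by rewrite /= -e; apply: ftau_fun_hom; apply: (smP f). Qed.

Definition ftau_cd m n (e : m + 1 = n) (f : ftau_ob m) : ftau_ob n :=
  smI (ftau_cd_subproof e f).

Lemma ftau_cd_lin m n (e : m + 1 = n) : linear (ftau_cd e).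
Proof.
move=> a f g; apply: val_inj; rewrite val_lin /=; apply/funext => x.
have fl := (smP f).1; have gl := (smP g).1; have tl := mc_lin mc.
change (ftau_fun m (fun y => a *: val f y + val g y) x =
  a *: ftau_fun m (val f) x + ftau_fun m (val g) x).
rewrite /ftau_fun mdif_lin.
have -> : ktens 1 (fun y => a *: val f y + val g y) tau (ncoact x) =
    a *: ktens 1 (val f) tau (ncoact x) + ktens 1 (val g) tau (ncoact x).
  by rewrite /ktens; apply: tmap_linl; lint.
rewrite (tlift_lin (mact_bil M)) !scalerDr !scalerN !scalerA.
rewrite [sgn m * a]mulrC [sgn (m + 1) * a]mulrC.
by zmod.
Qed.

Lemma ftau_cd_sq m n p (e : m + 1 = n) (e' : n + 1 = p) f :
  ftau_cd e' (ftau_cd e f) = 0.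
Proof.
apply: val_inj; apply/funext => x /=; rewrite -e.
by rewrite (ftau_fun_sq (smP f)).
Qed.

(** [F_tau (Hom (N, M))] *)
Definition ftau : complex k := Complex ftau_cd_lin ftau_cd_sq.

End Objects.

(** [F_tau (Hom (g, f))], sending [u] to [f u g]. *)
Section Functoriality.
Variables (N N' : ComC C) (M M' : CA A) (g : mor N' N) (f : mor M M').

Lemma ftau_map_subproof n (u : ftau N M n) :
  homS N' M' n (fun x => zfun f (val u (zfun g x))).
Proof.
have [[gh _] _] := zhomP g; have [[fh _] _] := zhomP f.
have := isHom_comp (isHom_comp fh (smP u)) gh.
by rewrite add0r addr0.
Qed.

Definition ftau_map_fun n (u : ftau N M n) : ftau N' M' n :=
  smI (ftau_map_subproof u).

Lemma ftau_map_lin n : linear (@ftau_map_fun n).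
Proof.
have [[[fl _] _] _] := zhomP f.
move=> a u v; apply: val_inj; rewrite val_lin /=; apply/funext => x.
change (zfun f (a *: val u (zfun g x) + val v (zfun g x)) =
  a *: zfun f (val u (zfun g x)) + zfun f (val v (zfun g x))).
exact: fl.
Qed.

Lemma ftau_map_cd m n (e : m + 1 = n) u :
  ftau_map_fun (cd e u) = cd e (ftau_map_fun u).
Proof.
have [[gh gc] gd] := zhomP g; have [[fh fa] fd] := zhomP f.
have fl := fh.1; have gl := gh.1; have ul := (smP u).1; have tl := mc_lin mc.
apply: val_inj; apply/funext => x /=; rewrite /ftau_fun.
rewrite (linD fl) (linB fl) !(linZ fl).
move: gd => /= ->; move: gc => /= ->; move: fd => /= ->; congr (_ + _ *: _).
move: (ncoact x); apply: tens_ext => [||y z].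
- lint.
- lint.
peval; rewrite (ksign_deg0 _ _ gh); exact: fa.
Qed.

Definition ftau_map : chmap (ftau N M) (ftau N' M') :=
  ChMap ftau_map_lin ftau_map_cd.
End Functoriality.
End Ftau.

(* Main.v *)
Require Import Defs.
From HB Require Import structures.
From mathcomp Require Import all_boot all_order all_algebra.
From mathcomp Require Import boolp functions.

(** The proof has two independent halves.

Frobenius structure. Both categories consist of graded objects with an operator
of degree 1, and a conflation is the same thing as a twisted direct sum: the
graded sum of the ends [X] and [Z], with [d (x, z) = (d x + e z, d z)] for a
degree 1 morphism [e : Z -> X] such that [d e + e d = 0] ([conflationP]). Hence,
the zero object aside, every object required by the axioms of an exact category
is again a twisted sum whose class [e] can be written down: pulling back along
[f] gives [e f], pushing out gives [f e], and the kernel or cokernel of a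
composite has the class obtained by composing with the evident inclusion or
projection. Curvature causes no difficulty, because [d ^ 2] commutes with all
graded morphisms even when it is not zero. The extension of a shift of [X] by
[X] whose class is the shift map is the cone of an identity; it is contractible,
contractible objects are both projective and injective, and conversely an object
which is projective or injective is a retract of such a cone ([conf_frobenius]).
It remains to construct zero objects, shifts and twisted sums in the two
categories ([mod_frobenius_data], [comod_frobenius_data]).

Adjunction. The module [N ⊗ A] is free on [N] as a graded module, and [M ⊗ C] is
cofree on [M] as a graded comodule, so in every degree graded morphisms
[N ⊗ A -> M], graded maps [N -> M] and graded morphisms [N -> M ⊗ C] correspond
to each other. The twisted differentials of [N ⊗_tau A] and [M ⊗_tau C] are
exactly what makes both correspondences carry the commutator with [d] to [d_tau]
([cobar_hom_iso], [bar_hom_iso]). Thus morphisms on either side are the 0-cycles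
of [F_tau (Hom (N, M))] and null-homotopic ones are its 0-boundaries; comparing
the cycles gives the adjunction, and passing to quotients gives the isomorphisms
with [H^0]. *)

Set Implicit Arguments.
Unset Strict Implicit.
Unset Printing Implicit Defensive.

Import GRing.Theory.
Local Open Scope ring_scope.

(** * Conflations as twisted direct sums *)

Section TwistedExtensions.
Variables (k : comPzRingType) (D : dgData k).
Local Notation ob := (dob D).

(** A conflation [X -> E -> Z] with a chosen graded splitting [r], [s]; the class
[e] measures the failure of [s] to commute with [d]. *)
Record twisted_ext (X E Z : ob) (i : dcar X -> dcar E) (p : dcar E -> dcar Z)
    (r : dcar E -> dcar X) (s : dcar Z -> dcar E) (e : dcar Z -> dcar X) : Prop :=
  TwistedExt {
    te_i : dhom X E 0 i;
    te_p : dhom E Z 0 p;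
    te_r : dhom E X 0 r;
    te_s : dhom Z E 0 s;
    te_e : dhom Z X 1 e;
    te_ri : forall x, r (i x) = x;
    te_ps : forall z, p (s z) = z;
    te_pi : forall x, p (i x) = 0;
    te_rs : forall z, r (s z) = 0;
    te_sum : forall y, i (r y) + s (p y) = y;
    te_di : forall x, i (ddif x) = ddif (i x);
    te_dp : forall y, p (ddif y) = ddif (p y);
    te_ds : forall z, ddif (s z) = s (ddif z) + i (e z) }.

(** What the Frobenius axioms need from the ambient graded category. The first two
fields make [f |-> [d, f]] an endomorphism of the graded morphisms, with [d ^ 2]
central rather than zero so that curvature is covered. The third one says that
retractions of graded monomorphisms are automatically morphisms. *)
Record frobenius_data : Prop := FrobeniusData {
  fd_comm : forall (X Y : ob) n f, dhom X Y n f ->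
    dhom X Y (n + 1) (fun x => ddif (f x) - sgn n *: f (ddif x));
  fd_sq : forall (X Y : ob) n f, dhom X Y n f ->
    forall x, ddif (ddif (f x)) = f (ddif (ddif x));
  fd_retract : forall (X Y : ob) i r, dhom X Y 0 i ->
    dhom Y Y 0 (fun y => i (r y)) -> (forall x, r (i x) = x) -> dhom Y X 0 r;
  fd_zero : exists Z : ob, forall z : dcar Z, z = 0;
  fd_shift : forall (X : ob) n,
    exists (Y : ob) (u : dcar X -> dcar Y) (v : dcar Y -> dcar X),
    [/\ dhom X Y (- n) u, dhom Y X n v, cancel u v, cancel v u &
        forall x, ddif (u x) = sgn n *: u (ddif x)];
  fd_ext : forall (X Z : ob) e, dhom Z X 1 e ->
    (forall z, ddif (e z) + e (ddif z) = 0) ->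
    exists (E : ob) i p r s, @twisted_ext X E Z i p r s e }.

Definition contractible (X : ob) : Prop := exists h : dcar X -> dcar X,
  dhom X X (-1) h /\ forall x, ddif (h x) + h (ddif x) = x.

Lemma dhom_ext (X Y : ob) n f g : dhom X Y n f -> (forall x, f x = g x) ->
  dhom X Y n g.
Proof. by move=> hf /funext <-. Qed.

Lemma dhomD (X Y : ob) n f g : dhom X Y n f -> dhom X Y n g ->
  dhom X Y n (fun x => f x + g x).
Proof.
move=> hf hg; apply: dhom_ext (sm_lin 1 hf hg) _ => x.
by rewrite -[f x]scale1r.
Qed.

Lemma dhomN (X Y : ob) n f : dhom X Y n f -> dhom X Y n (fun x => - f x).
Proof.
move=> hf; apply: dhom_ext (sm_lin (-1) hf (sm0 _)) _ => x.
by rewrite -scaleN1r -[RHS]addr0.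
Qed.

Lemma dhomB (X Y : ob) n f g : dhom X Y n f -> dhom X Y n g ->
  dhom X Y n (fun x => f x - g x).
Proof. by move=> hf hg; apply/dhomD/dhomN. Qed.

Lemma dhom_zero (X Y : ob) n : dhom X Y n (fun=> 0).
Proof. exact: sm0. Qed.

Lemma dhom_comp0 (X Y Z : ob) n g f : dhom Y Z 0 g -> dhom X Y n f ->
  dhom X Z n (fun x => g (f x)).
Proof. by move=> hg hf; rewrite -[n]addr0; apply: dhom_cmp. Qed.

Lemma dhom_comp0r (X Y Z : ob) n g f : dhom Y Z n g -> dhom X Y 0 f ->
  dhom X Z n (fun x => g (f x)).
Proof. by move=> hg hf; rewrite -[n]add0r; apply: dhom_cmp. Qed.

Definition closed_mor (X Y : ob) f (hf : dhom X Y 0 f)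
    (cf : forall x, f (ddif x) = ddif (f x)) : @mor k (zcat D) X Y :=
  smI (conj hf cf : zhomS X Y f).

Lemma closed_morE (X Y : ob) f (hf : dhom X Y 0 f)
    (cf : forall x, f (ddif x) = ddif (f x)) x : zfun (closed_mor hf cf) x = f x.
Proof. by []. Qed.

Lemma zfunE (X Y : zcat D) (f g : mor X Y) x : f = g -> zfun f x = zfun g x.
Proof. by move->. Qed.

Lemma zfunD (X Y : zcat D) (f g : mor X Y) x : zfun (f + g) x = zfun f x + zfun g x.
Proof. by have := zhom_linE 1 f g x; rewrite !scale1r. Qed.

Lemma zfun0 (X Y : zcat D) x : zfun (0 : mor X Y) x = 0.
Proof.
have := zhom_linE (-1) (0 : zhom X Y) 0 x.
by rewrite scaler0 addr0 scaleN1r addNr.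
Qed.

Lemma zfunl (X Y : zcat D) (f : mor X Y) : linear (zfun f).
Proof. exact: (dhom_lin (zhomP f).1). Qed.

Section Ext.
Variables (X E Z : ob) (i : dcar X -> dcar E) (p : dcar E -> dcar Z).
Variables (r : dcar E -> dcar X) (s : dcar Z -> dcar E) (e : dcar Z -> dcar X).
Hypothesis T : twisted_ext i p r s e.

Lemma te_inj x y : i x = i y -> x = y.
Proof. by move=> h; rewrite -[x](te_ri T) h (te_ri T). Qed.

Lemma te_dr y : r (ddif y) = ddif (r y) + e (p y).
Proof.
rewrite -{1}[y](te_sum T) (linD (@ddif_lin _ _ _)) -(te_di T) (te_ds T).
have rl := dhom_lin (te_r T).
by rewrite !(linD rl) !(te_ri T) (te_rs T) add0r.
Qed.

(** Centrality of [d ^ 2] applied to [s] is the cocycle condition on [e]. *)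
Lemma te_cocycle : (forall x, ddif (ddif (s x)) = s (ddif (ddif x))) ->
  forall z, ddif (e z) + e (ddif z) = 0.
Proof.
move=> sq z; apply: te_inj; have il := dhom_lin (te_i T).
rewrite (linD il) (te_di T) (lin0 il).
have -> : i (e z) = ddif (s z) - s (ddif z) by rewrite (te_ds T) addrAC subrr add0r.
rewrite (linB (@ddif_lin _ _ _)) sq (te_ds T) opprD addrA subrr add0r.
by rewrite addNr.
Qed.

Definition te_infl : @mor k (zcat D) X E := closed_mor (te_i T) (te_di T).
Definition te_defl : @mor k (zcat D) E Z := closed_mor (te_p T) (te_dp T).

(** When the class [e] identifies [Z] with the shift [X[1]], as for the cone of
an identity, [s u r] is a contraction. *)
Lemma te_contractible (u : dcar X -> dcar Z) : dhom X Z (-1) u ->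
  cancel u e -> cancel e u -> (forall x, ddif (u x) + u (ddif x) = 0) ->
  contractible E.
Proof.
move=> hu ue eu du; exists (fun y => s (u (r y))); split.
  by apply: dhom_comp0 (te_s T) _; apply: dhom_comp0r hu (te_r T).
have sl := dhom_lin (te_s T); have ul := dhom_lin hu.
move=> y; rewrite te_dr (te_ds T) ue (linD ul) eu (linD sl).
rewrite addrACA addrA -(linD sl) du (lin0 sl) add0r.
exact: te_sum T y.
Qed.
End Ext.

Hypothesis FD : frobenius_data.

(** A graded section [s] of [p] determines the retraction [r] by
[i r = 1 - s p], and then [e = r [d, s]]. *)
Lemma conflationP (X Y Z : zcat D) (i : mor X Y) (p : mor Y Z) :
  conflation i p <-> exists r s e, twisted_ext (zfun i) (zfun p) r s e.
Proof.
split=> [[inj sur ex [s [hs ps]]]|[r [s [e T]]]]; last first.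
  split.
  - exact: te_inj T.
  - by move=> z; exists (s z); apply: te_ps T z.
  - move=> y; split=> [py|[x <-]]; last exact: te_pi T x.
    by exists (r y); rewrite -[RHS](te_sum T) py (lin0 (dhom_lin (te_s T))) addr0.
  - by exists s; split; [apply: te_s T | apply: te_ps T].
have [hi ci] := zhomP i; have [hp cp] := zhomP p.
have il := dhom_lin hi; have pl := dhom_lin hp; have sl := dhom_lin hs.
have rP y : exists x, zfun i x = y - s (zfun p y).
  by apply/ex; rewrite (linB pl) ps subrr.
pose r y := sval (cid (rP y)).
have ir y : zfun i (r y) = y - s (zfun p y) by rewrite /r; case: cid.
have ri x : r (zfun i x) = x.
  apply: inj; rewrite ir; have -> : zfun p (zfun i x) = 0 by apply/ex; exists x.
  by rewrite (lin0 sl) subr0.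
have hr : dhom Y X 0 r.
  apply: (fd_retract FD hi) => //.
  have -> : (fun y => zfun i (r y)) = (fun y => y - s (zfun p y)).
    by apply/funext.
  apply: dhomB; first exact: dhom_id.
  exact: dhom_comp0.
pose e z := r (ddif (s z) - s (ddif z)).
have he : dhom Z X 1 e.
  apply: dhom_comp0 hr _; apply: dhom_ext (fd_comm FD hs) _ => z.
  by rewrite sgn0 scale1r.
have rs z : r (s z) = 0.
  by apply: inj; rewrite ir ps subrr (lin0 il).
exists r, s, e; split=> //.
- by move=> x; apply/ex; exists x.
- by move=> y; rewrite ir subrK.
- move=> z; rewrite /e ir (linB pl) cp !ps subrr (lin0 sl) subr0.
  by rewrite addrC subrK.
Qed.

Lemma te_conflation (X E Z : ob) i p r s e (T : @twisted_ext X E Z i p r s e) :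
  conflation (te_infl T) (te_defl T).
Proof. by apply/conflationP; exists r, s, e. Qed.

Lemma te_class_cocycle (X E Z : ob) i p r s e :
  @twisted_ext X E Z i p r s e -> forall z, ddif (e z) + e (ddif z) = 0.
Proof. by move=> T; apply: (te_cocycle T); apply: (fd_sq FD (te_s T)). Qed.

Local Notation conf := (@conflation k D).

Lemma zero_ob : exists Z : zcat D, forall z : dcar Z, z = 0.
Proof. exact: fd_zero FD. Qed.

Lemma conf_additive : additive_category (zcat D).
Proof.
split.
  by have [Z hZ] := zero_ob; exists Z; apply: zhom_ext => z; rewrite zfun0 [LHS]hZ.
move=> X Y; have e0 : forall z : dcar Y, ddif (0 : dcar X) + 0 = 0.
  by move=> z; rewrite (lin0 (@ddif_lin _ _ _)) addr0.
have [E [i [p [r [s T]]]]] := fd_ext FD (dhom_zero Y X 1) e0.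
have cr y : r (ddif y) = ddif (r y) by rewrite (te_dr T) addr0.
have cs y : s (ddif y) = ddif (s y).
  by rewrite (te_ds T) (lin0 (dhom_lin (te_i T))) addr0.
exists E, (te_infl T), (closed_mor (te_s T) cs), (closed_mor (te_r T) cr), (te_defl T).
split; apply: zhom_ext => x; rewrite ?zfun0.
- exact: te_ri T x.
- exact: te_ps T x.
- exact: te_rs T x.
- exact: te_pi T x.
- by rewrite zfunD; apply: te_sum T x.
Qed.

Lemma conf_kernel (X Y Z : zcat D) (i : mor X Y) (p : mor Y Z) :
  conf i p -> is_kernel i p /\ is_cokernel i p.
Proof.
move=> /conflationP[r [s [e T]]].
have pi0 : p \c i = 0 by apply: zhom_ext => x; rewrite zfun0; apply: te_pi T x.
have [hi ci] := zhomP i; have [hp cp] := zhomP p.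
split; split=> //.
- move=> U f pf; have [hf cf] := zhomP f.
  have irf x : zfun i (r (zfun f x)) = zfun f x.
    have pf0 : zfun p (zfun f x) = 0 by have := zfunE x pf; rewrite zfun0.
    by rewrite -[RHS](te_sum T) pf0 (lin0 (dhom_lin (te_s T))) addr0.
  have crf x : r (zfun f (ddif x)) = ddif (r (zfun f x)).
    by apply: (te_inj T); rewrite irf ci irf cf.
  exists (closed_mor (dhom_comp0 (te_r T) hf) crf); split.
    exact/zhom_ext/irf.
  by move=> g eg; apply: zhom_ext => x; apply: (te_inj T); rewrite /= irf -eg.
- move=> U f fi; have [hf cf] := zhomP f; have fl := zfunl f.
  have fi0 x : zfun f (zfun i x) = 0 by have := zfunE x fi; rewrite zfun0.
  have fsp y : zfun f (s (zfun p y)) = zfun f y.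
    by rewrite -[y in RHS](te_sum T) (linD fl) fi0 add0r.
  have cfs z : zfun f (s (ddif z)) = ddif (zfun f (s z)).
    by rewrite -cf (te_ds T) (linD fl) fi0 addr0.
  exists (closed_mor (dhom_comp0 hf (te_s T)) cfs); split.
    exact/zhom_ext/fsp.
  move=> g eg; apply: zhom_ext => z.
  rewrite closed_morE; have <- : zfun g (zfun p (s z)) = zfun f (s z) := zfunE (s z) eg.
  by rewrite (te_ps T).
Qed.

Lemma conf_isom (X Y Z X' Y' Z' : zcat D) (i : mor X Y) (p : mor Y Z)
    (i' : mor X' Y') (p' : mor Y' Z') (a : mor X X') (b : mor Y Y') (c : mor Z Z') :
  isom a -> isom b -> isom c -> b \c i = i' \c a -> c \c p = p' \c b ->
  conf i p -> conf i' p'.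
Proof.
move=> [a' [a'a aa']] [b' [b'b bb']] [c' [c'c cc']] bi cp [inj sur ex [s [hs ps]]].
have aK x : zfun a' (zfun a x) = x := zfunE x a'a.
have aK' x : zfun a (zfun a' x) = x := zfunE x aa'.
have bK x : zfun b' (zfun b x) = x := zfunE x b'b.
have bK' x : zfun b (zfun b' x) = x := zfunE x bb'.
have cK x : zfun c' (zfun c x) = x := zfunE x c'c.
have cK' x : zfun c (zfun c' x) = x := zfunE x cc'.
have biE x : zfun b (zfun i x) = zfun i' (zfun a x) := zfunE x bi.
have cpE x : zfun c (zfun p x) = zfun p' (zfun b x) := zfunE x cp.
split.
- move=> x y; rewrite -[x]aK' -[y]aK' -!biE => /(can_inj bK) /inj h.
  by rewrite h.
- move=> z; exists (zfun b (s (zfun c' z))).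
  by rewrite -cpE ps cK'.
- move=> y; rewrite -[y]bK' -cpE; split=> [h|[x hx]].
    have /ex[x hx] : zfun p (zfun b' y) = 0.
      by rewrite -[LHS]cK h (lin0 (zfunl c')).
    by exists (zfun a x); rewrite -biE hx.
  have -> : zfun b' y = zfun i (zfun a' x).
    by rewrite -[zfun b' y]bK -hx -[x]aK' -biE bK aK'.
  have -> : zfun p (zfun i (zfun a' x)) = 0 by apply/ex; exists (zfun a' x).
  exact: lin0 (zfunl c).
- exists (fun z => zfun b (s (zfun c' z))); split=> [|z]; last by rewrite -cpE ps cK'.
  apply: dhom_comp0 (zhomP b).1 _; apply: dhom_comp0 hs _.
  exact: (zhomP c').1.
Qed.

Lemma inflation_id (X : zcat D) : inflation (@conflation k D) (idm X).
Proof.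
have [Z hZ] := zero_ob; exists Z, 0; split=> //.
- by move=> z; exists 0; rewrite zfun0 [RHS]hZ.
- by move=> y; rewrite zfun0; split=> // _; exists y.
- exists (fun=> 0); split; first exact: dhom_zero.
  by move=> z; rewrite zfun0 [RHS]hZ.
Qed.

Lemma deflation_id (X : zcat D) : deflation (@conflation k D) (idm X).
Proof.
have [Z hZ] := zero_ob; exists Z, 0; split=> //.
- by move=> x y _; rewrite [x]hZ [y]hZ.
- by move=> z; exists z.
- move=> y; change (y = 0 <-> exists x, zfun (0 : mor Z X) x = y).
  split=> [->|[x <-]]; last by rewrite zfun0.
  by exists 0; rewrite zfun0.
- by exists id; split=> //; apply: dhom_id.
Qed.


(** Injectivity of [i] and exactness at [Y] follow pointwise from [r]. *)
Lemma conflation_split (X Y Z : zcat D) (i : mor X Y) (p : mor Y Z) r s :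
  dhom Z Y 0 s -> (forall x, r (zfun i x) = x) -> (forall z, zfun p (s z) = z) ->
  (forall x, zfun p (zfun i x) = 0) ->
  (forall y, zfun i (r y) + s (zfun p y) = y) -> conf i p.
Proof.
move=> hs ri ps pi0 sum; split.
- by move=> x y h; rewrite -[x]ri h ri.
- by move=> z; exists (s z).
- move=> y; split=> [py|[x <-//]]; exists (r y).
  by rewrite -[RHS]sum py (lin0 (dhom_lin hs)) addr0.
- by exists s.
Qed.

(** If [U] and [V] are the cokernels of [i] and [j], the cokernel of [j i] is the
graded sum of [U] and [V] twisted by [p e'], with [e'] the class of [j]. *)
Lemma inflation_cmp (X Y Z : zcat D) (j : mor Y Z) (i : mor X Y) :
  inflation conf i -> inflation conf j -> inflation conf (j \c i).
Proof.
move=> [U [p /conflationP[r [s [e T]]]]] [V [q /conflationP[r' [s' [e' T']]]]].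
have [hp cp] := zhomP p; have pl := zfunl p.
have he : dhom V U 1 (fun v => zfun p (e' v)) by apply: dhom_comp0 hp (te_e T').
have ce v : ddif (zfun p (e' v)) + zfun p (e' (ddif v)) = 0.
  by rewrite -cp -(linD pl) (te_class_cocycle T') (lin0 pl).
have [W [i1 [p1 [r1 [s1 T1]]]]] := fd_ext FD he ce.
have i1l := dhom_lin (te_i T1); have s1l := dhom_lin (te_s T1).
have p1l := dhom_lin (te_p T1); have r1l := dhom_lin (te_r T1).
pose f (z : dcar Z) := i1 (zfun p (r' z)) + s1 (zfun q z).
have hf : dhom Z W 0 f.
  apply: dhomD; first by apply: dhom_comp0 (te_i T1) _; apply: dhom_comp0 hp (te_r T').
  by apply: dhom_comp0 (te_s T1) (te_p T').
have cf z : f (ddif z) = ddif (f z).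
  rewrite /f (linD (@ddif_lin _ _ _)) (te_ds T1) -(te_di T1) (te_dr T').
  rewrite (linD pl) cp (te_dp T') (linD i1l) -!addrA; congr (_ + _).
  exact: addrC.
have jl := zfunl j; have ql := zfunl q; have r'l := dhom_lin (te_r T').
have [hj _] := zhomP j.
exists W, (closed_mor hf cf).
apply: (conflation_split (r := fun z => r (r' z))
  (s := fun w => zfun j (s (r1 w)) + s' (p1 w))) => /=.
- apply: dhomD; last exact: dhom_comp0 (te_s T') (te_p T1).
  by apply: dhom_comp0 hj _; apply: dhom_comp0 (te_s T) (te_r T1).
- by move=> x; rewrite (te_ri T') (te_ri T).
- move=> w; rewrite /zfun /= /f (linD r'l) (linD ql) (te_ri T') (te_rs T') (te_pi T').
  by rewrite (te_ps T') addr0 add0r (te_ps T) (te_sum T1).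
- move=> x; rewrite /zfun /= /f (te_ri T') (te_pi T') (te_pi T).
  by rewrite (lin0 i1l) (lin0 s1l) addr0.
- move=> z; rewrite /= /f (linD r1l) (linD p1l) (te_ri T1) (te_rs T1) (te_pi T1).
  by rewrite (te_ps T1) addr0 add0r addrA -(linD jl) (te_sum T) (te_sum T').
Qed.

(** Dually, the kernel of [q p] is the sum of the kernels twisted by [e j]. *)
Lemma deflation_cmp (X Y Z : zcat D) (q : mor Y Z) (p : mor X Y) :
  deflation conf p -> deflation conf q -> deflation conf (q \c p).
Proof.
move=> [U [i /conflationP[r [s [e T]]]]] [V [j /conflationP[r' [s' [e' T']]]]].
have [hj cj] := zhomP j; have jl := zfunl j.
have he : dhom V U 1 (fun v => e (zfun j v)) by apply: dhom_comp0r (te_e T) hj.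
have ce v : ddif (e (zfun j v)) + e (zfun j (ddif v)) = 0.
  by rewrite cj (te_class_cocycle T).
have [W [i1 [p1 [r1 [s1 T1]]]]] := fd_ext FD he ce.
have [hi ci] := zhomP i; have il := zfunl i.
have i1l := dhom_lin (te_i T1); have s1l := dhom_lin (te_s T1).
have p1l := dhom_lin (te_p T1); have r1l := dhom_lin (te_r T1).
have sl := dhom_lin (te_s T).
pose f (w : dcar W) := zfun i (r1 w) + s (zfun j (p1 w)).
have hf : dhom W X 0 f.
  apply: dhomD; first exact: dhom_comp0 hi (te_r T1).
  by apply: dhom_comp0 (te_s T) _; apply: dhom_comp0 hj (te_p T1).
have cf w : f (ddif w) = ddif (f w).
  rewrite /f (linD (@ddif_lin _ _ _)) (te_ds T) -(te_di T) (te_dr T1) (te_dp T1).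
  by rewrite (linD il) cj -!addrA; congr (_ + _); exact: addrC.
have pl := zfunl p; have rl := dhom_lin (te_r T).
exists W, (closed_mor hf cf).
apply: (conflation_split (r := fun x => i1 (r x) + s1 (r' (zfun p x)))
  (s := fun z => s (s' z))) => /=.
- exact: dhom_comp0 (te_s T) (te_s T').
- move=> w; rewrite /= /f (linD rl) (linD pl) (te_ri T) (te_rs T) (te_pi T) (te_ps T).
  by rewrite addr0 add0r (te_ri T') (te_sum T1).
- by move=> z; rewrite /zfun /= (te_ps T) (te_ps T').
- move=> w; rewrite /zfun /= /f (linD pl) (te_pi T) (te_ps T) add0r.
  exact: te_pi T' _.
- move=> x; rewrite closed_morE /f (linD r1l) (linD p1l) (te_ri T1) (te_rs T1) (te_pi T1).
  by rewrite (te_ps T1) addr0 add0r -addrA -(linD sl) (te_sum T') (te_sum T).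
Qed.

(** As a graded object the pullback is the kernel of [p] plus [X]; writing a pair
[(y, x)] with [p y = f x] as [y = i w + s (f x)] shows that its class is [e f]. *)
Lemma deflation_pull (X Y Z : zcat D) (p : mor Y Z) (f : mor X Z) :
  deflation conf p -> exists (P : zcat D) (p' : mor P X) (f' : mor P Y),
    is_pullback p f p' f' /\ deflation conf p'.
Proof.
move=> [W [i /conflationP[r [s [e T]]]]].
have [hf cf] := zhomP f; have fl := zfunl f.
have ce x : ddif (e (zfun f x)) + e (zfun f (ddif x)) = 0.
  by rewrite cf (te_class_cocycle T).
have [P [i1 [p1 [r1 [s1 T1]]]]] := fd_ext FD (dhom_comp0r (te_e T) hf) ce.
have [hi ci] := zhomP i; have il := zfunl i.
have i1l := dhom_lin (te_i T1); have s1l := dhom_lin (te_s T1).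
have p1l := dhom_lin (te_p T1); have r1l := dhom_lin (te_r T1).
have sl := dhom_lin (te_s T); have pl := zfunl p; have rl := dhom_lin (te_r T).
pose g (w : dcar P) := zfun i (r1 w) + s (zfun f (p1 w)).
have hg : dhom P Y 0 g.
  apply: dhomD; first exact: dhom_comp0 hi (te_r T1).
  by apply: dhom_comp0 (te_s T) _; apply: dhom_comp0 hf (te_p T1).
have cg w : g (ddif w) = ddif (g w).
  rewrite /g (linD (@ddif_lin _ _ _)) (te_ds T) -(te_di T) (te_dr T1) (te_dp T1).
  by rewrite (linD il) cf -!addrA; congr (_ + _); exact: addrC.
have pg w : zfun p (g w) = zfun f (p1 w).
  by rewrite /g (linD pl) (te_pi T) (te_ps T) add0r.
exists P, (te_defl T1), (closed_mor hg cg); split; last first.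
  by exists W, (te_infl T1); apply: te_conflation.
split; first exact/zhom_ext/pg.
move=> U u v pv; have [hu cu] := zhomP u; have [hv cv] := zhomP v.
have pvE x : zfun p (zfun v x) = zfun f (zfun u x) := zfunE x pv.
pose w x := i1 (r (zfun v x)) + s1 (zfun u x).
have p1w x : p1 (w x) = zfun u x.
  by rewrite /w (linD p1l) (te_pi T1) (te_ps T1) add0r.
have gw x : g (w x) = zfun v x.
  rewrite /g p1w /w (linD r1l) (te_ri T1) (te_rs T1) addr0 -pvE.
  exact: te_sum T _.
(* The two legs of the pullback are jointly injective. *)
have jm a b : p1 a = p1 b -> g a = g b -> a = b.
  move=> h1; rewrite /g h1 => /addIr /(te_inj T) h2.
  by rewrite -[a](te_sum T1) h1 h2 (te_sum T1).
have hw : dhom U P 0 w.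
  apply: dhomD; last exact: dhom_comp0 (te_s T1) hu.
  by apply: dhom_comp0 (te_i T1) _; apply: dhom_comp0 (te_r T) hv.
have cw x : w (ddif x) = ddif (w x).
  by apply: jm; rewrite ?(te_dp T1) ?cg ?p1w ?gw ?cu ?cv.
exists (closed_mor hw cw); split; first by split; [exact/zhom_ext/p1w | exact/zhom_ext/gw].
move=> w' [e1 e2]; apply: zhom_ext => x; apply: jm.
  by have /= h := zfunE x e1; rewrite [RHS]h; exact: p1w.
by have /= h := zfunE x e2; rewrite [RHS]h; exact: gw.
Qed.

(** As a graded object the pushout is [X] plus the cokernel of [i], with class [f e]. *)
Lemma inflation_push (X Y Z : zcat D) (i : mor Z Y) (f : mor Z X) :
  inflation conf i -> exists (P : zcat D) (i' : mor X P) (f' : mor Y P),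
    is_pushout i f i' f' /\ inflation conf i'.
Proof.
move=> [V [p /conflationP[r [s [e T]]]]].
have [hf cf] := zhomP f; have fl := zfunl f.
have ce x : ddif (zfun f (e x)) + zfun f (e (ddif x)) = 0.
  by rewrite -cf -(linD fl) (te_class_cocycle T) (lin0 fl).
have [P [i1 [p1 [r1 [s1 T1]]]]] := fd_ext FD (dhom_comp0 hf (te_e T)) ce.
have [hi ci] := zhomP i; have [hp cp] := zhomP p.
have il := zfunl i; have pl := zfunl p.
have i1l := dhom_lin (te_i T1); have s1l := dhom_lin (te_s T1).
have sl := dhom_lin (te_s T); have rl := dhom_lin (te_r T).
pose g (y : dcar Y) := i1 (zfun f (r y)) + s1 (zfun p y).
have hg : dhom Y P 0 g.
  apply: dhomD; last exact: dhom_comp0 (te_s T1) hp.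
  by apply: dhom_comp0 (te_i T1) _; apply: dhom_comp0 hf (te_r T).
have cg w : g (ddif w) = ddif (g w).
  rewrite /g (linD (@ddif_lin _ _ _)) (te_ds T1) -(te_di T1) (te_dr T) cp.
  by rewrite (linD fl) (linD i1l) cf -!addrA; congr (_ + _); exact: addrC.
have gi z : g (zfun i z) = i1 (zfun f z).
  by rewrite /g (te_ri T) (te_pi T) (lin0 s1l) addr0.
have gs z : g (s z) = s1 z.
  by rewrite /g (te_rs T) (te_ps T) (lin0 fl) (lin0 i1l) add0r.
exists P, (te_infl T1), (closed_mor hg cg); split; last first.
  by exists V, (te_defl T1); apply: te_conflation.
split; first exact/zhom_ext/gi.
move=> U u v vi; have [hu cu] := zhomP u; have [hv cv] := zhomP v.
have ul := zfunl u; have vl := zfunl v.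
have viE x : zfun v (zfun i x) = zfun u (zfun f x) := zfunE x vi.
pose w x := zfun u (r1 x) + zfun v (s (p1 x)).
have wi x : w (i1 x) = zfun u x.
  by rewrite /w (te_ri T1) (te_pi T1) (lin0 sl) (lin0 vl) addr0.
have ws z : w (s1 z) = zfun v (s z).
  by rewrite /w (te_rs T1) (te_ps T1) (lin0 ul) add0r.
have hw : dhom P U 0 w.
  apply: dhomD; first exact: dhom_comp0 hu (te_r T1).
  by apply: dhom_comp0 hv _; apply: dhom_comp0 (te_s T) (te_p T1).
have wl := dhom_lin hw.
have wg y : w (g y) = zfun v y.
  by rewrite /g (linD wl) wi ws -viE -(linD vl) (te_sum T).
have cw x : w (ddif x) = ddif (w x).
  rewrite /w (te_dr T1) (te_dp T1) (linD ul) (linD (@ddif_lin _ _ _)) -cu -cv.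
  by rewrite (te_ds T) (linD vl) viE -!addrA; congr (_ + _); exact: addrC.
exists (closed_mor hw cw); split; first by split; [exact/zhom_ext/wi | exact/zhom_ext/wg].
move=> w' [e1 e2]; apply: zhom_ext => x; have w'l := zfunl w'.
have /= h1 := zfunE (r1 x) e1; have /= h2 := zfunE (s (p1 x)) e2.
rewrite -[x in RHS](te_sum T1) (linD w'l) -gs.
by rewrite /zfun /= /w -[X in _ + X]h2 -[X in X + _]h1.
Qed.

Lemma conf_exact : exact_category conf.
Proof.
exact: (ExactCategory conf_additive conf_kernel conf_isom inflation_id
  deflation_id inflation_cmp deflation_cmp deflation_pull inflation_push).
Qed.

(** [dg + gd] commutes with [d] only because [d ^ 2] commutes with [g]. *)
Lemma comm_contraction (X Y : zcat D) g (hg : dhom X Y (-1) g) :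
  exists f : mor X Y, forall x, zfun f x = ddif (g x) + g (ddif x).
Proof.
have gl := dhom_lin hg.
have hf : dhom X Y 0 (fun x => ddif (g x) + g (ddif x)).
  apply: dhom_ext (fd_comm FD hg) _ => x.
  by rewrite sgnN sgn1 scaleN1r opprK.
have cf x : ddif (g (ddif x)) + g (ddif (ddif x)) =
    ddif (ddif (g x) + g (ddif x)).
  by rewrite (linD (@ddif_lin _ _ _)) (fd_sq FD hg) addrC.
by exists (closed_mor hf cf).
Qed.

(** With a contraction [h] of [X] and a graded section [s] of [p], the lift is
[[d, s f h]]. *)
Lemma contractible_proj (X : zcat D) : contractible X -> projective conf X.
Proof.
move=> [h [hh eh]] Y Z p f [W [i /conflationP[r [s [e T]]]]].
have [hf cf] := zhomP f; have [hp cp] := zhomP p; have fl := zfunl f.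
have hs : dhom X Y (-1) (fun x => s (zfun f (h x))).
  by apply: dhom_comp0 (te_s T) _; apply: dhom_comp0 hf hh.
have [g eg] := comm_contraction hs.
exists g; apply: zhom_ext => x /=; rewrite /zfun /=.
change (zfun p (zfun g x) = zfun f x).
by rewrite eg (linD (zfunl p)) cp !(te_ps T) -cf -(linD fl) eh.
Qed.

(** With a graded retraction [r] of [i], the extension is [[d, h f r]]. *)
Lemma contractible_inj (X : zcat D) : contractible X -> injective_ob conf X.
Proof.
move=> [h [hh eh]] Y Z i f [W [p /conflationP[r [s [e T]]]]].
have [hf cf] := zhomP f; have fl := zfunl f.
have hr : dhom Z X (-1) (fun x => h (zfun f (r x))).
  by apply: dhom_comp0r hh _; apply: dhom_comp0 hf (te_r T).
have [g eg] := comm_contraction hr.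
exists g; apply: zhom_ext => x.
change (zfun g (zfun i x) = zfun f x).
by rewrite eg -(te_di T) !(te_ri T) cf eh.
Qed.

Lemma contractible_retract (X Y : zcat D) (a : mor X Y) (b : mor Y X) :
  b \c a = idm X -> contractible Y -> contractible X.
Proof.
move=> ba [h [hh eh]].
have [ha ca] := zhomP a; have [hb cb] := zhomP b; have bl := zfunl b.
exists (fun x => zfun b (h (zfun a x))); split.
  by apply: dhom_comp0 hb _; apply: dhom_comp0r hh ha.
by move=> x; rewrite ca -cb -(linD bl) eh; exact: zfunE x ba.
Qed.

(** The cone of the identity of [X[-1]]. *)
Lemma enough_proj (X : zcat D) : exists (P : zcat D) (p : mor P X),
  deflation conf p /\ contractible P.
Proof.
have [W [u [v [hu hv uK vK du]]]] := fd_shift FD X (-1).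
rewrite opprK in hu.
have cu x : ddif (u x) + u (ddif x) = 0.
  by rewrite du sgnN sgn1 scaleN1r addNr.
have [E [i [p [r [s T]]]]] := fd_ext FD hu cu.
exists E, (te_defl T); split.
  by exists W, (te_infl T); apply: te_conflation.
apply: (te_contractible T hv) => // w.
rewrite -{2}[w]vK -[ddif (u _)]opprK -[- ddif _]scaleN1r du sgnN sgn1.
by rewrite !scaleN1r opprK (linN (dhom_lin hv)) uK subrr.
Qed.

(** The cone of the identity of [X]. *)
Lemma enough_inj (X : zcat D) : exists (I : zcat D) (i : mor X I),
  inflation conf i /\ contractible I.
Proof.
have [W [u [v [hu hv uK vK du]]]] := fd_shift FD X 1.
have vl := dhom_lin hv; have ul := dhom_lin hu.
have cv w : ddif (v w) + v (ddif w) = 0.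
  by rewrite -{2}[w]vK du sgn1 (linZ vl) uK scaleN1r subrr.
have [E [i [p [r [s T]]]]] := fd_ext FD hv cv.
exists E, (te_infl T); split.
  by exists W, (te_defl T); apply: te_conflation.
apply: (te_contractible T hu) => // w.
by rewrite du sgn1 scaleN1r addNr.
Qed.

Lemma proj_contractible (X : zcat D) : projective conf X <-> contractible X.
Proof.
split=> [pX|]; last exact: contractible_proj.
have [P [p [dp cP]]] := enough_proj X; have [g pg] := pX _ _ p (idm X) dp.
exact: contractible_retract pg cP.
Qed.

Lemma inj_contractible (X : zcat D) : injective_ob conf X <-> contractible X.
Proof.
split=> [iX|]; last exact: contractible_inj.
have [I [i [ii cI]]] := enough_inj X; have [g gi] := iX _ _ i (idm X) ii.
exact: contractible_retract gi cI.
Qed.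

Theorem conf_frobenius : frobenius conf.
Proof.
split; first exact: conf_exact.
- by move=> X; have [P [p [dp /contractible_proj]]] := enough_proj X; exists P, p.
- by move=> X; have [I [i [ii /contractible_inj]]] := enough_inj X; exists I, i.
- by move=> X; rewrite proj_contractible inj_contractible.
Qed.

End TwistedExtensions.

(** * Zero, shift and sum of graded modules *)

Section GradedConstructions.
Variable k : comPzRingType.
Implicit Types V W : grMod k.

Lemma pair_eq (T U : Type) (x y : T * U) : x.1 = y.1 -> x.2 = y.2 -> x = y.
Proof. by case: x y => x1 x2 [y1 y2] /= -> ->. Qed.

Section Zero.
Lemma zmx0 (v : 'rV[k]_0) : v = 0. Proof. exact: thinmx0. Qed.

Lemma gzero_pr (m n : int) (v : 'rV[k]_0) : v = if m == n then v else 0.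
Proof. by rewrite [RHS]zmx0 [LHS]zmx0. Qed.

Lemma gzero_fin (v : 'rV[k]_0) :
  exists s : seq int, uniq s /\ v = \sum_(n <- s) v.
Proof. by exists [::]; rewrite big_nil [LHS]zmx0. Qed.

Definition gzero : grMod k :=
  @GrMod k 'rV[k]_0 (fun _ v => v) (fun _ => @lin_id k _) gzero_pr gzero_fin.

Lemma gzero_eq (u v : gzero) : u = v.
Proof. by rewrite [LHS]zmx0 [RHS]zmx0. Qed.
End Zero.

Section Shift.
Variables (n : int) (V : grMod k).

Lemma gshift_pr (i j : int) (v : V) :
  gpr (i + n) (gpr (j + n) v) = if i == j then gpr (j + n) v else 0.
Proof. by rewrite gpr_pr (inj_eq (addIr n)). Qed.

Lemma gshift_fin (v : V) :
  exists s : seq int, uniq s /\ v = \sum_(i <- s) gpr (i + n) v.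
Proof.
exists [seq i - n | i <- supp v]; split.
  by rewrite map_inj_uniq ?supp_uniq //; apply: addIr.
by rewrite big_map {1}[v]gsum; apply: eq_bigr => i _; rewrite subrK.
Qed.

(** [V[n]], with [V[n]^i = V^(i + n)] on the same total module. *)
Definition gshift : grMod k :=
  @GrMod k V (fun i => gpr (i + n)) (fun i => @gpr_lin k V (i + n))
    gshift_pr gshift_fin.

Lemma to_gshift_hom : @isHom k V gshift (- n) id.
Proof. by split=> // i v hv; rewrite /homog /= subrK. Qed.

Lemma of_gshift_hom : @isHom k gshift V n id.
Proof. by split=> // i v hv; rewrite /homog. Qed.

Lemma gshift_sign (v : V) : ksign (V := gshift) 1 v = sgn n *: ksign 1 v.
Proof.
have /= h := @ksign_isHom k gshift V n 1 id v of_gshift_hom.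
by rewrite h mul1r scalerA sgnK scale1r.
Qed.
End Shift.

Lemma gshift_isHom n i V W (f : V -> W) : isHom i f ->
  @isHom k (gshift n V) (gshift n W) i f.
Proof.
by move=> [fl hf]; split=> // j v hv; rewrite /homog /= addrAC; apply: hf.
Qed.

Section Product.
Variables V W : grMod k.

Definition gprod_gpr (n : int) (x : V * W) : V * W := (gpr n x.1, gpr n x.2).

Lemma fst_lin (X Y : lmodType k) : linear (fst : X * Y -> X). Proof. by []. Qed.
Lemma snd_lin (X Y : lmodType k) : linear (snd : X * Y -> Y). Proof. by []. Qed.

Lemma gprod_lin n : linear (gprod_gpr n).
Proof. by move=> a x y; apply: pair_eq; rewrite /= gpr_lin. Qed.

Lemma gprod_pr m n (x : V * W) :
  gprod_gpr m (gprod_gpr n x) = if m == n then gprod_gpr n x else 0.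
Proof. by rewrite /gprod_gpr /= !gpr_pr; case: ifP. Qed.

Lemma gprod_fin (x : V * W) :
  exists s : seq int, uniq s /\ x = \sum_(n <- s) gprod_gpr n x.
Proof.
exists (undup (supp x.1 ++ supp x.2)); split; first exact: undup_uniq.
apply: pair_eq; rewrite ?(lin_sum (@fst_lin V W)) ?(lin_sum (@snd_lin V W)) /=.
- rewrite (supp_sum (F := fun _ v => v)) ?undup_uniq //; first exact: gsum.
  by move=> i hi; rewrite mem_undup mem_cat hi.
- rewrite (supp_sum (F := fun _ v => v)) ?undup_uniq //; first exact: gsum.
  by move=> i hi; rewrite mem_undup mem_cat hi orbT.
Qed.

Definition gprod : grMod k := GrMod gprod_lin gprod_pr gprod_fin.

Lemma gprod_eq (x y : gprod) : x.1 = y.1 -> x.2 = y.2 -> x = y.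
Proof. exact: pair_eq. Qed.

Lemma gprod_fst : @isHom k gprod V 0 fst.
Proof. by split=> // i [v w]; rewrite /homog addr0 => -[]. Qed.

Lemma gprod_snd : @isHom k gprod W 0 snd.
Proof. by split=> // i [v w]; rewrite /homog addr0 => -[]. Qed.

Lemma gprod_pair (U : grMod k) n (f : U -> V) (g : U -> W) :
  isHom n f -> isHom n g -> @isHom k U gprod n (fun u => (f u, g u)).
Proof.
move=> [fl hf] [gl hg]; split=> [a u v|i u hu].
  by apply: pair_eq; rewrite /= ?fl ?gl.
by rewrite /homog /= /gprod_gpr /= (hf _ _ hu) (hg _ _ hu).
Qed.

Lemma gprod_inl : @isHom k V gprod 0 (fun v => (v, 0)).
Proof. exact: gprod_pair (isHom_id V) (isHom0 V W 0). Qed.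

Lemma gprod_inr : @isHom k W gprod 0 (fun w => (0, w)).
Proof. exact: gprod_pair (isHom0 W V 0) (isHom_id W). Qed.

Lemma gprod_sign n (x : gprod) : ksign n x = (ksign n x.1, ksign n x.2).
Proof.
apply: pair_eq; first exact: esym (ksign_deg0 n x gprod_fst).
exact: esym (ksign_deg0 n x gprod_snd).
Qed.
End Product.

Lemma isHom_retract V W (i : V -> W) (r : W -> V) : isHom 0 i ->
  isHom 0 (fun y => i (r y)) -> (forall x, r (i x) = x) -> isHom 0 r.
Proof.
move=> [il hi] [irl hir] ri; split=> [a u v|n v hv].
  by rewrite -[RHS]ri il -irl ri.
have := hir _ _ hv; rewrite addr0 => h; have e := (isHomP 0 il).1 (conj il hi).
by rewrite /homog -[LHS]ri -e !addr0 h ri.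
Qed.

Lemma isHom_comm V W n (f : V -> W) (d : V -> V) (d' : W -> W) :
  isHom n f -> isHom 1 d -> isHom 1 d' ->
  isHom (n + 1) (fun x => d' (f x) - sgn n *: f (d x)).
Proof.
move=> hf hd hd'; apply: isHomD; first exact: isHom_comp.
by apply/isHomN/isHomZ; rewrite addrC; apply: isHom_comp.
Qed.
End GradedConstructions.

Section ModuleConstructions.
Variables (k : comPzRingType) (A : cdgAlg k).
Local Notation D := (mod_dg A).
Local Notation sg := (ksign 1).

Lemma mod_comm (X Y : cdgMod A) n f : mod_dhom X Y n f ->
  mod_dhom X Y (n + 1) (fun x => mdif (f x) - sgn n *: f (mdif x)).
Proof.
move=> [hf fa]; have fl := hf.1; split.
  exact: isHom_comm hf (mdif_hom X) (mdif_hom Y).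
move=> m a; rewrite fa !mdif_mact (linD fl) !fa (ksign_isHom _ _ hf) mul1r.
rewrite (linB (@mact_linl _ _ _ _)) !(linZ (@mact_linl _ _ _ _)) scalerDr.
by zmod.
Qed.

Lemma mod_sq (X Y : cdgMod A) n f : mod_dhom X Y n f ->
  forall x, mdif (mdif (f x)) = f (mdif (mdif x)).
Proof.
by move=> [hf fa] x; rewrite !mdif_sq (linN hf.1) fa.
Qed.

Lemma mod_retract (X Y : cdgMod A) i r : mod_dhom X Y 0 i ->
  mod_dhom Y Y 0 (fun y => i (r y)) -> (forall x, r (i x) = x) ->
  mod_dhom Y X 0 r.
Proof.
move=> [hi ia] [hir ira] ri; split; first exact: isHom_retract hi hir ri.
by move=> m a; rewrite -[RHS]ri ia -ira ri.
Qed.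

Definition zero_mod : cdgMod A.
Proof.
refine (@CdgMod k A (gzero k) (fun m _ => m) (fun=> 0) _ _ _ _ (isHom0 _ _ 1) _ _).
- by split=> [a|m] b u v; apply: gzero_eq.
- by move=> i j m a _ _; apply: gzero_eq.
- by move=> m a b; apply: gzero_eq.
- by move=> m; apply: gzero_eq.
- by move=> m; apply: gzero_eq.
- by move=> i m a _; apply: gzero_eq.
Defined.

Section Shift.
Variables (X : cdgMod A) (n : int).

(** The action needs no sign, since it is on the right. *)
Definition shift_mod : cdgMod A.
Proof.
refine (@CdgMod k A (gshift n X) mact (fun m => sgn n *: mdif m)
  (mact_bil X) _ (@mactA k A X) (@mact1 k A X) _ _ _).
- by move=> i j m a hm ha; rewrite /homog /= addrAC; apply: mact_deg.
- exact/gshift_isHom/isHomZ/mdif_hom.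
- by move=> m; rewrite (linZ (@mdif_lin _ _ _)) scalerA sgnK scale1r mdif_sq.
- move=> i m a hm; have hm' : @homog k X (i + n) m by [].
  rewrite (mdif_act _ hm') (linZ (@mact_linl _ _ _ _)) scalerDr scalerA.
  by rewrite -sgnD [n + _]addrC -addrA sgnD sgnD sgnK mulr1.
Defined.
End Shift.

Section Extension.
Variables (X Z : cdgMod A) (e : Z -> X).
Hypotheses (he : mod_dhom Z X 1 e) (de : forall z, mdif (e z) + e (mdif z) = 0).

Definition ext_mod : cdgMod A.
Proof.
refine (@CdgMod k A (gprod X Z) (fun m a => (mact m.1 a, mact m.2 a))
  (fun m => (mdif m.1 + e m.2, mdif m.2)) _ _ _ _ _ _ _).
- split=> [a|m] b u v; apply: pair_eq; rewrite /=.
  + exact: mact_linl.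
  + exact: mact_linl.
  + exact: mact_linr.
  + exact: mact_linr.
- move=> i j [x z] a [hx hz] ha; rewrite /homog /= /gprod_gpr /=.
  by congr pair; apply: mact_deg.
- by move=> m a b; rewrite /= !mactA.
- by move=> [x z]; rewrite /= !mact1.
- apply: gprod_pair; last exact: isHom_comp (mdif_hom Z) (gprod_snd X Z).
  apply: isHomD; first exact: isHom_comp (mdif_hom X) (gprod_fst X Z).
  exact: isHom_comp he.1 (gprod_snd X Z).
- move=> [x z]; apply: pair_eq; rewrite /= ?mdif_sq //.
  by rewrite (linD (@mdif_lin _ _ _)) mdif_sq -addrA de addr0.
- move=> i [x z] a [hx hz]; apply: pair_eq; rewrite /= ?(mdif_act _ hx) ?(mdif_act _ hz) //.
  by rewrite he.2 (linD (@mact_linl _ _ _ _)) addrAC.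
Defined.
End Extension.

Lemma mod_frobenius_data : frobenius_data D.
Proof.
split.
- exact: mod_comm.
- exact: mod_sq.
- exact: mod_retract.
- by exists zero_mod; move=> z; apply: gzero_eq.
- move=> X n; exists (shift_mod X n), id, id; split=> //.
  exact: (conj (to_gshift_hom n X) (fun _ _ => erefl)).
- move=> X Z e he de; exists (ext_mod he de).
  exists (fun x => (x, 0)), snd, fst, (fun z => (0, z)).
  split=> //.
  + split; first exact: gprod_inl.
    by move=> m a; rewrite /= (lin0 (@mact_linl _ _ _ _)).
  + by split=> //; apply: gprod_snd.
  + by split=> //; apply: gprod_fst.
  + split; first exact: gprod_inr.
    by move=> m a; rewrite /= (lin0 (@mact_linl _ _ _ _)).
  + by move=> [x z]; apply: pair_eq; rewrite /= ?addr0 ?add0r.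
  + move=> x; apply: pair_eq; rewrite /= ?(lin0 he.1.1) ?addr0 //.
    by rewrite (lin0 (@mdif_lin _ _ _)).
  + move=> z; apply: pair_eq; rewrite /= ?addr0 // add0r.
    by rewrite (lin0 (@mdif_lin _ _ _)) add0r.
Qed.
End ModuleConstructions.

(** * Extensions of dg comodules *)

Section ComoduleConstructions.
Variables (k : comPzRingType) (C : dgCoalg k).
Local Notation D := (comod_dg C).
Local Notation sg := (ksign 1).

Lemma comod_comm (X Y : dgComod C) n f : comod_dhom X Y n f ->
  comod_dhom X Y (n + 1) (fun x => ndif (f x) - sgn n *: f (ndif x)).
Proof.
move=> [hf fc]; have fl := hf.1; split.
  exact: isHom_comm hf (ndif_hom X) (ndif_hom Y).
move=> x; rewrite (linB (@ncoact_lin _ _ _)) (linZ (@ncoact_lin _ _ _)).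
rewrite ndif_coact !fc ndif_coact !ktens0.
move: (ncoact x); apply: tens_ext => [||y z].
- have h1 : linear (fun x => @ktens k X C X C 1 id cdif x) by lint.
  have h2 : linear (tmap f (@id C)) by lint.
  have h3 : linear (fun x => tmap f (@id C) (ktens 1 id cdif x)) by exact: lin_comp h2 h1.
  have h4 : linear (fun x => tmap f (@id C) (tmap ndif id x)) by lint.
  have h5 : linear (fun x => @ktens k Y C Y C 1 id cdif (tmap f (@id C) x)) by lint.
  lint.
- lint.
peval; rewrite (linD (tmap_lin fl (@lin_id k C))); peval.
rewrite (ksign_isHom _ _ hf) mul1r tpureZl scalerDr.
rewrite (linB (@tpure_linl _ _ _ _)) tpureZl.
by zmod.
Qed.

Lemma comod_sq (X Y : dgComod C) n f : comod_dhom X Y n f ->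
  forall x, ndif (ndif (f x)) = f (ndif (ndif x)).
Proof. by move=> [hf _] x; rewrite !ndif_sq (lin0 hf.1). Qed.

(** [i ⊗ 1] stays injective because [r] splits it over [k], so the comodule
identity for [r] can be checked after applying [i ⊗ 1]. *)
Lemma comod_retract (X Y : dgComod C) i r : comod_dhom X Y 0 i ->
  comod_dhom Y Y 0 (fun y => i (r y)) -> (forall x, r (i x) = x) ->
  comod_dhom Y X 0 r.
Proof.
move=> [hi ic] [hir irc] ri; have hr := isHom_retract hi hir ri; split=> // y.
have il := hi.1; have rl := hr.1.
have K (t : tens X C) : tmap r id (tmap i id t) = t.
  rewrite tmap_cmp // -[RHS]tmap_id; congr (tmap _ _ t).
  exact/funext.
have e : tmap (fun y => i (r y)) id (ncoact y) = tmap i id (tmap r id (ncoact y)).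
  by rewrite tmap_cmp.
by rewrite -[LHS]K -ic irc e K.
Qed.

Definition zero_comod : dgComod C.
Proof.
refine (@DgComod k C (gzero k) (fun=> 0) (fun=> 0) (isHom0 _ _ 0) _ _
  (isHom0 _ _ 1) _ _).
- move=> x; rewrite (lin0 (tmap_lin (@lin_zero _ _ _) (@lin_id _ _))).
  by rewrite (lin0 (@tassoc_lin _ _ _ _)) (lin0 (tmap_lin (@lin_id _ _) (@cdelta_lin _ _))).
- by move=> x; apply: gzero_eq.
- by move=> x; apply: gzero_eq.
- move=> x; rewrite ktens0 (lin0 (tmap_lin (@lin_zero _ _ _) (@lin_id _ _))) add0r.
  by rewrite (lin0 (ktens_lin 1 (@lin_id _ _) (@cdif_lin _ _))).
Defined.

Section Shift.
Variables (X : dgComod C) (n : int).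

(** The coaction is conjugated by the regrading, which has degrees [n] and [-n]. *)
Lemma shift_coact_hom : @isHom k (gshift n X) (gtens (gshift n X) C) 0 ncoact.
Proof.
have h1 := isHom_comp (ncoact_hom X) (of_gshift_hom n X).
have h2 := tmap_isHom (to_gshift_hom n X) (isHom_id C).
have := isHom_comp h2 h1; rewrite !addr0 subrr.
by congr isHom; apply/funext => x; rewrite tmap_id.
Qed.

Lemma shift_dif_coact (x : X) : ncoact (sgn n *: ndif x) =
  @ktens k (gshift n X) C (gshift n X) C 0 (fun y => sgn n *: ndif y) id (ncoact x) +
  @ktens k (gshift n X) C (gshift n X) C 1 id cdif (ncoact x).
Proof.
rewrite (linZ (@ncoact_lin _ _ _)) ndif_coact !ktens0.
have dl := @ndif_lin k C X.
have sl : linear (fun y => sgn n *: (@ndif k C X y)) by lint.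
have h1 : linear (@ktens k (gshift n X) C (gshift n X) C 1 id cdif).
  by apply: ktens_lin => //; apply: cdif_lin.
have h2 : linear (tmap (fun y => sgn n *: @ndif k C X y) (@id C)) by lint.
move: (ncoact x); apply: tens_ext => [||y z]; first by lint.
- exact: lin_add h2 h1.
rewrite !tmapE // ktensE ?ktensE //; try by exact: cdif_lin.
by rewrite gshift_sign scalerDr !tpureZl.
Qed.

(** As for modules, the structure map keeps its formula; only [d] acquires a sign. *)
Definition shift_comod : dgComod C.
Proof.
refine (@DgComod k C (gshift n X) ncoact (fun x => sgn n *: ndif x)
  shift_coact_hom (@ncoactA k C X) (@ncounit k C X) _ _ shift_dif_coact).
- exact/gshift_isHom/isHomZ/ndif_hom.
- by move=> x; rewrite (linZ (@ndif_lin _ _ _)) ndif_sq !scaler0.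
Defined.
End Shift.

Section Extension.
Variables (X Z : dgComod C) (e : Z -> X).
Hypotheses (he : comod_dhom Z X 1 e) (de : forall z, ndif (e z) + e (ndif z) = 0).

Let inX (x : X) : gprod X Z := (x, 0).
Let inZ (z : Z) : gprod X Z := (0, z).
Local Notation pX := (fst : gprod X Z -> X).
Local Notation pZ := (snd : gprod X Z -> Z).

Let inXl : linear inX. Proof. exact: (gprod_inl X Z).1. Qed.
Let inZl : linear inZ. Proof. exact: (gprod_inr X Z).1. Qed.
Let pXl : linear pX. Proof. by []. Qed.
Let pZl : linear pZ. Proof. by []. Qed.

Let splitE (x : gprod X Z) : x = inX x.1 + inZ x.2.
Proof. by apply: gprod_eq; rewrite /= ?addr0 ?add0r. Qed.

Definition ext_coact (x : gprod X Z) : gtens (gprod X Z) C :=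
  tmap inX id (ncoact x.1) + tmap inZ id (ncoact x.2).

Definition ext_dif (x : gprod X Z) : gprod X Z := (ndif x.1 + e x.2, ndif x.2).

Lemma ext_coact_hom : isHom 0 ext_coact.
Proof.
have h1 := isHom_comp (tmap_isHom (gprod_inl X Z) (isHom_id C))
  (isHom_comp (ncoact_hom X) (gprod_fst X Z)).
have h2 := isHom_comp (tmap_isHom (gprod_inr X Z) (isHom_id C))
  (isHom_comp (ncoact_hom Z) (gprod_snd X Z)).
by have := isHomD h1 h2; rewrite !addr0.
Qed.

Lemma ext_dif_hom : isHom 1 ext_dif.
Proof.
apply: gprod_pair; last exact: isHom_comp (ndif_hom Z) (gprod_snd X Z).
apply: isHomD; first exact: isHom_comp (ndif_hom X) (gprod_fst X Z).
exact: isHom_comp he.1 (gprod_snd X Z).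
Qed.

Lemma ext_coactX x : ext_coact (inX x) = tmap inX id (ncoact x).
Proof.
rewrite /ext_coact /= (lin0 (@ncoact_lin _ _ _)).
by rewrite (lin0 (tmap_lin inZl (@lin_id _ _))) addr0.
Qed.

Lemma ext_coactZ z : ext_coact (inZ z) = tmap inZ id (ncoact z).
Proof.
rewrite /ext_coact /= (lin0 (@ncoact_lin _ _ _)).
by rewrite (lin0 (tmap_lin inXl (@lin_id _ _))) add0r.
Qed.

Let cl : linear ext_coact. Proof. exact: ext_coact_hom.1. Qed.
Let dl : linear ext_dif. Proof. exact: ext_dif_hom.1. Qed.

(** Coassociativity and the counit law on the sum follow from those of the two
summands along the inclusions, which are compatible with the coactions. *)
Lemma coactA_push (N : dgComod C) (j : N -> gprod X Z) : linear j ->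
  (forall x, ext_coact (j x) = tmap j id (ncoact x)) -> forall x,
  tassoc (tmap ext_coact id (ext_coact (j x))) = tmap id cdelta (ext_coact (j x)).
Proof.
move=> jl jc x; rewrite jc tmap_cmp //.
rewrite tmap_cmp //; last exact: cdelta_lin.
have E (u : tens N C) : tassoc (tmap (fun y => ext_coact (j y)) id u) =
    tmap j id (tassoc (tmap ncoact id u)).
  have ejl : linear (fun y => ext_coact (j y)) by exact: lin_comp cl jl.
  move: u; apply: tens_ext => [||y z]; [lint|lint|].
  peval; rewrite jc; move: (ncoact y).
  by apply: tens_ext => [||a b]; [lint|lint|]; peval.
by rewrite E ncoactA tmap_cmp //; exact: cdelta_lin.
Qed.

Lemma counit_push (N : dgComod C) (j : N -> gprod X Z) : linear j ->
  (forall x, ext_coact (j x) = tmap j id (ncoact x)) -> forall x,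
  tlift (fun y z => ccounit z *: y) (ext_coact (j x)) = j x.
Proof.
move=> jl jc x; rewrite jc -[in RHS](ncounit x).
move: (ncoact x); apply: tens_ext => [||y z]; [lint|lint|].
by peval; rewrite (linZ jl).
Qed.

Lemma ext_coactA x : tassoc (tmap ext_coact id (ext_coact x)) =
  tmap id cdelta (ext_coact x).
Proof.
rewrite [x]splitE (linD cl).
rewrite (linD (tmap_lin cl (@lin_id _ _))) (linD (@tassoc_lin _ _ _ _)).
rewrite (linD (tmap_lin (@lin_id _ _) (@cdelta_lin _ _))).
by rewrite (coactA_push inXl ext_coactX) (coactA_push inZl ext_coactZ).
Qed.

Lemma ext_counit x : tlift (fun y z => ccounit z *: y) (ext_coact x) = x.
Proof.
rewrite [x in LHS]splitE (linD cl) (linD (tlift_lin (@counitr_bil _ _ _))).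
by rewrite (counit_push inXl ext_coactX) (counit_push inZl ext_coactZ) -splitE.
Qed.

Lemma ext_sq x : ext_dif (ext_dif x) = 0.
Proof.
apply: gprod_eq; rewrite /= ?ndif_sq //.
by rewrite (linD (@ndif_lin _ _ _)) ndif_sq add0r de.
Qed.

Lemma ext_difX x : ext_dif (inX x) = inX (ndif x).
Proof.
by apply: gprod_eq; rewrite /= ?(lin0 (@ndif_lin _ _ _)) // (lin0 he.1.1) addr0.
Qed.

Lemma ext_difZ z : ext_dif (inZ z) = inZ (ndif z) + inX (e z).
Proof.
apply: gprod_eq; rewrite /= ?addr0 // add0r.
by rewrite (lin0 (@ndif_lin _ _ _)) add0r.
Qed.

Lemma ext_dif_coact x : ext_coact (ext_dif x) =
  ktens 0 ext_dif id (ext_coact x) + ktens 1 id cdif (ext_coact x).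
Proof.
have el := he.1.1; have kl : linear (@ktens k (gprod X Z) C (gprod X Z) C 1 id cdif) by lint.
have tl := tmap_lin dl (@lin_id k C).
have tX := tmap_lin inXl (@lin_id k C); have tZ := tmap_lin inZl (@lin_id k C).
have EX (u : tens X C) : tmap inX id (tmap ndif id u + ktens 1 id cdif u) =
    tmap ext_dif id (tmap inX id u) + ktens 1 id cdif (tmap inX id u).
  move: u; apply: tens_ext => [||y z].
  - have h : linear (@ktens k X C X C 1 id cdif) by lint.
    by apply: (lin_comp tX); lint.
  - by apply: lin_add; apply: lin_comp => //; lint.
  rewrite (linD tX); peval; rewrite ext_difX gprod_sign; congr (_ + tpure _ _).
  by rewrite /inX /= (lin0 (@ksign_lin _ _ _)).
have EZ (u : tens Z C) : tmap inZ id (tmap ndif id u + ktens 1 id cdif u) +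
    tmap inX id (tmap e id u) =
    tmap ext_dif id (tmap inZ id u) + ktens 1 id cdif (tmap inZ id u).
  move: u; apply: tens_ext => [||y z].
  - have h : linear (@ktens k Z C Z C 1 id cdif) by lint.
    apply: lin_add; last by lint.
    by apply: (lin_comp tZ); lint.
  - by apply: lin_add; apply: lin_comp => //; lint.
  rewrite (linD tZ); peval; rewrite ext_difZ tpureDl gprod_sign addrAC.
  congr (_ + tpure _ _).
  by rewrite /inZ /= (lin0 (@ksign_lin _ _ _)).
rewrite ktens0 [x]splitE (linD dl) !(linD cl) (linD tl) (linD kl).
rewrite ext_difX ext_difZ (linD cl) !ext_coactX !ext_coactZ !ndif_coact !ktens0.
by rewrite he.2 EX EZ addrACA.
Qed.

Definition ext_comod : dgComod C :=
  @DgComod k C (gprod X Z) ext_coact ext_dif ext_coact_hom ext_coactA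
    ext_counit ext_dif_hom ext_sq ext_dif_coact.

Lemma ext_comodP : exists (E : dob D) i p r s,
  @twisted_ext k D X E Z i p r s e.
Proof.
exists ext_comod, inX, snd, fst, inZ.
split.
- split; first exact: gprod_inl.
  exact: ext_coactX.
- split; first exact: gprod_snd.
  move=> x; rewrite /= [x in RHS]splitE (linD cl) ext_coactX ext_coactZ.
  rewrite (linD (tmap_lin pZl (@lin_id _ _))) !tmap_cmp //.
  have e1 := @tmap_0l k X C Z C id (ncoact x.1) (@lin_id _ _).
  have e2 := tmap_id (ncoact x.2).
  exact: esym (etrans (congr2 +%R e1 e2) (add0r _)).
- split; first exact: gprod_fst.
  move=> x; rewrite /= [x in RHS]splitE (linD cl) ext_coactX ext_coactZ.
  rewrite (linD (tmap_lin pXl (@lin_id _ _))) !tmap_cmp //.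
  have e1 := tmap_id (ncoact x.1).
  have e2 := @tmap_0l k Z C X C id (ncoact x.2) (@lin_id _ _).
  exact: esym (etrans (congr2 +%R e1 e2) (addr0 _)).
- split; first exact: gprod_inr.
  exact: ext_coactZ.
- exact: he.
- by [].
- by [].
- by [].
- by [].
- by move=> x; rewrite -splitE.
- by move=> x; apply: esym (ext_difX x).
- by [].
- exact: ext_difZ.
Qed.
End Extension.

Lemma comod_frobenius_data : frobenius_data D.
Proof.
split.
- exact: comod_comm.
- exact: comod_sq.
- exact: comod_retract.
- by exists zero_comod; move=> z; apply: gzero_eq.
- move=> X n; exists (shift_comod X n), id, id; split=> //.
  + split; first exact: to_gshift_hom.
    by move=> x; rewrite tmap_id.
  + split; first exact: of_gshift_hom.
    by move=> x; rewrite tmap_id.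
- exact: ext_comodP.
Qed.
End ComoduleConstructions.

(** * Exactness of the bar and cobar constructions *)

Section Exactness.
Variables (k : comPzRingType) (A : cdgAlg k) (C : dgCoalg k) (tau : C -> A).
Hypothesis mc : maurer_cartan tau.

Lemma bar_dhom (M M' : cdgMod A) n f : mod_dhom M M' n f ->
  comod_dhom (bar_ob mc M) (bar_ob mc M') n (tmap f id).
Proof.
move=> [hf fa]; have fl := hf.1; split.
  by have := tmap_isHom hf (isHom_id C); rewrite addr0.
have cl := @bar_coact_lin _ _ C M; have cl' := @bar_coact_lin _ _ C M'.
rewrite /=; apply: tens_ext => [||m x]; [lint|lint|].
peval; rewrite !bar_coactE; move: (cdelta x).
by apply: tens_ext => [||y z]; [lint|lint|]; peval.
Qed.

Lemma cobar_dhom (N N' : dgComod C) n f : comod_dhom N N' n f ->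
  mod_dhom (cobar_ob mc N) (cobar_ob mc N') n (tmap f id).
Proof.
move=> [hf fc]; have fl := hf.1; split.
  by have := tmap_isHom hf (isHom_id A); rewrite addr0.
move=> t b; move: t; rewrite /= /cobar_act.
by apply: tens_ext => [||x a]; [lint|lint|]; peval.
Qed.

Section Tensor.
Variables (V X Y Z : lmodType k).
Variables (i : X -> Y) (p : Y -> Z) (r : Y -> X) (s : Z -> Y).
Hypotheses (il : linear i) (pl : linear p) (rl : linear r) (sl : linear s).

Lemma tmap_cancel : cancel i r ->
  cancel (tmap i (@id V)) (tmap r (@id V)).
Proof.
move=> ri t; rewrite tmap_cmp // -[RHS]tmap_id; congr (tmap _ _ t).
exact/funext.
Qed.

Lemma tmap_zero : (forall x, p (i x) = 0) ->
  forall t, tmap p (@id V) (tmap i (@id V) t) = 0.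
Proof.
move=> pi0 t; rewrite tmap_cmp // -[RHS](@tmap_0l k X V Z V id t) //.
by congr (tmap _ _ t); apply/funext.
Qed.

Lemma tmap_sum : (forall y, i (r y) + s (p y) = y) ->
  forall t, tmap i (@id V) (tmap r (@id V) t) + tmap s (@id V) (tmap p (@id V) t) = t.
Proof.
move=> sum; apply: tens_ext => [||y v]; [lint|lint|].
by peval; rewrite -tpureDl sum.
Qed.
End Tensor.

Lemma bar_exact : exact_functor (@conflation k (mod_dg A))
  (@conflation k (comod_dg C)) (bar mc).
Proof.
move=> X Y Z i p /(conflationP (mod_frobenius_data A))[r [s [e T]]].
have il := zfunl i; have pl := zfunl p.
have rl := dhom_lin (te_r T); have sl := dhom_lin (te_s T).
apply: (@conflation_split k (comod_dg C) (bar_ob mc X) (bar_ob mc Y)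
  (bar_ob mc Z) (fmap (bar mc) i) (fmap (bar mc) p) (tmap r id) (tmap s id)).
- exact: bar_dhom (te_s T).
- exact: tmap_cancel (te_ri T).
- exact: tmap_cancel (te_ps T).
- exact: tmap_zero (te_pi T).
- exact: tmap_sum (te_sum T).
Qed.

Lemma cobar_exact : exact_functor (@conflation k (comod_dg C))
  (@conflation k (mod_dg A)) (cobar mc).
Proof.
move=> X Y Z i p /(conflationP (comod_frobenius_data C))[r [s [e T]]].
have il := zfunl i; have pl := zfunl p.
have rl := dhom_lin (te_r T); have sl := dhom_lin (te_s T).
apply: (@conflation_split k (mod_dg A) (cobar_ob mc X) (cobar_ob mc Y)
  (cobar_ob mc Z) (fmap (cobar mc) i) (fmap (cobar mc) p) (tmap r id) (tmap s id)).
- exact: cobar_dhom (te_s T).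
- exact: tmap_cancel (te_ri T).
- exact: tmap_cancel (te_ps T).
- exact: tmap_zero (te_pi T).
- exact: tmap_sum (te_sum T).
Qed.
End Exactness.

(** Mutually inverse maps which respect the submodules have mutually inverse
quotient maps. *)
Lemma qmap_cancel (k : pzRingType) (V W : lmodType k) (S : submod V) (T : submod W)
    (f : V -> W) (g : W -> V) :
  linear f -> linear g -> (forall v, S v -> T (f v)) ->
  (forall w, T w -> S (g w)) -> cancel f g ->
  cancel (@qmap k V W S T f) (@qmap k W V T S g).
Proof.
by move=> fl gl fS gT fK x; rewrite -[x]qreprK (qmapE fl fS) (qmapE gl gT) fK.
Qed.

(** * From an isomorphism of Hom complexes to one in cohomology *)

Section HomComplex.
Variables (k : comPzRingType) (A : cdgAlg k) (C : dgCoalg k) (tau : C -> A).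
Hypothesis mc : maurer_cartan tau.
Variables (N : dgComod C) (M : cdgMod A).
Variables (D : dgData k) (X Y : dob D).
Variables (u : (dcar X -> dcar Y) -> N -> M) (v : (N -> M) -> dcar X -> dcar Y).

(** [u] and [v] are inverse isomorphisms between the complex of graded morphisms
[X -> Y], with differential the commutator with [d], and [F_tau (Hom (N, M))]. *)
Record hom_iso : Prop := HomIso {
  hi_u : forall n f, dhom X Y n f -> isHom n (u f);
  hi_v : forall n g, isHom n g -> dhom X Y n (v g);
  hi_lin : forall a f g x, u (fun y => a *: f y + g y) x = a *: u f x + u g x;
  hi_uv : forall n g, isHom n g -> u (v g) = g;
  hi_vu : forall n f, dhom X Y n f -> v (u f) = f;
  hi_d : forall n f, dhom X Y n f ->
    u (fun x => ddif (f x) - sgn n *: f (ddif x)) = ftau_fun tau n (u f) }.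

Hypotheses (FD : frobenius_data D) (H : hom_iso).
Local Notation F := (ftau mc N M).
Local Notation Z0 := (smT (cycles F 0)).

Lemma hi_u0 : u (fun=> 0) = fun=> 0.
Proof.
apply/funext => x; have := hi_lin H (-1) (fun=> 0) (fun=> 0) x.
have -> : (fun _ : dcar X => -1 *: (0 : dcar Y) + 0) = (fun=> 0).
  by apply/funext => y; rewrite scaler0 addr0.
by move=> e; rewrite [LHS]e scaleN1r addNr.
Qed.

Lemma hi_inj n f g : dhom X Y n f -> dhom X Y n g -> u f = u g -> f = g.
Proof. by move=> hf hg e; rewrite -(hi_vu H hf) e (hi_vu H hg). Qed.

Lemma hi_deg (f : zhom X Y) : homS N M 0 (u (zfun f)).
Proof. exact: (hi_u H (zhomP f).1). Qed.

(** Being closed is being a 0-cycle. *)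
Lemma hi_cycle (f : zhom X Y) : cycles F 0 (smI (hi_deg f)).
Proof.
have [hf cf] := zhomP f.
apply: val_inj; change (ftau_fun tau 0 (u (zfun f)) = fun=> 0).
rewrite -(hi_d H hf) -hi_u0; congr u; apply/funext => x.
by rewrite cf sgn0 scale1r subrr.
Qed.

Definition hi_cyc (f : zhom X Y) : Z0 := smI (hi_cycle f).

Lemma hi_zhom (z : Z0) : zhomS X Y (v (val (val z))).
Proof.
have hg : isHom 0 (val (val z)) := smP (val z).
(* [u] maps the degree 1 morphism [[d, v g]] to [d_tau g = 0], and is injective. *)
have hf := hi_v H hg; split=> // x; apply/esym/eqP; rewrite -subr_eq0; apply/eqP.
have e := hi_d H hf; rewrite (hi_uv H hg) in e.
have zc : ftau_fun tau 0 (val (val z)) = fun=> 0 := congr1 val (smP z).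
rewrite zc -hi_u0 in e.
have := congr1 (fun f => f x) (hi_inj (fd_comm FD hf) (dhom_zero _ _ _) e).
by rewrite sgn0 scale1r.
Qed.

Definition hi_cycV (z : Z0) : zhom X Y := smI (hi_zhom z).

Lemma hi_cycK : cancel hi_cyc hi_cycV.
Proof.
move=> f; apply: zhom_ext => x.
by change (v (u (zfun f)) x = zfun f x); rewrite (hi_vu H (zhomP f).1).
Qed.

Lemma hi_cycVK : cancel hi_cycV hi_cyc.
Proof.
move=> z; apply: val_inj; apply: val_inj.
by change (u (v (val (val z))) = val (val z)); rewrite (hi_uv H (smP (val z))).
Qed.

Lemma hi_cyc_lin : linear hi_cyc.
Proof.
move=> a f g; apply: val_inj; apply: val_inj; rewrite !val_lin; apply/funext => x.
change (u (zfun (a *: f + g)) x = a *: u (zfun f) x + u (zfun g) x).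
by rewrite -hi_lin //; congr (u _ x); apply/funext => y; rewrite zhom_linE.
Qed.

Lemma hi_cycV_lin : linear hi_cycV.
Proof.
by move=> a y z; rewrite -[y]hi_cycVK -[z]hi_cycVK -hi_cyc_lin !hi_cycK.
Qed.

(** A homotopy [h] is a cochain of degree -1 and [dh + hd] is its coboundary. *)
Lemma hi_bound (f : zhom X Y) : nullS X Y f -> boundaries F 0 (hi_cyc f).
Proof.
(* The degree of the preimage is [0 - 1], convertible to [-1]. *)
move=> [h [hh eh]]; have hu : homS N M (0 - 1) (u h) := hi_u H hh.
exists (smI hu); apply: val_inj.
change (u (zfun f) = ftau_fun tau (-1) (u h)).
rewrite -(hi_d H hh); congr u; apply/funext => x.
by rewrite eh sgnN sgn1 scaleN1r opprK.
Qed.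

Lemma hi_boundV (z : Z0) : boundaries F 0 z -> nullS X Y (hi_cycV z).
Proof.
move=> [y ey]; have hy : isHom (-1) (val y) := smP y.
have hh := hi_v H hy; exists (v (val y)); split=> // x.
have ez : val (val z) = ftau_fun tau (-1) (val y) := congr1 val ey.
have e : u (v (val (val z))) = u (fun x => ddif (v (val y) x) - sgn (-1) *: v (val y) (ddif x)).
  by rewrite (hi_d H hh) (hi_uv H hy) (hi_uv H (smP (val z))) ez.
have := congr1 (fun f => f x) (hi_inj (hi_v H (smP (val z))) (fd_comm FD hh) e).
by rewrite sgnN sgn1 scaleN1r opprK.
Qed.

Definition hi_coh : quotM (nullS X Y) -> cohomology 0 F :=
  qmap (boundaries F 0) hi_cyc.
Definition hi_cohV : cohomology 0 F -> quotM (nullS X Y) :=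
  qmap (nullS X Y) hi_cycV.

Lemma hi_coh_lin : linear hi_coh.
Proof. exact: qmap_lin hi_cyc_lin hi_bound. Qed.
Lemma hi_cohV_lin : linear hi_cohV.
Proof. exact: qmap_lin hi_cycV_lin hi_boundV. Qed.
Lemma hi_cohK : cancel hi_coh hi_cohV.
Proof. exact: qmap_cancel hi_cyc_lin hi_cycV_lin hi_bound hi_boundV hi_cycK. Qed.
Lemma hi_cohVK : cancel hi_cohV hi_coh.
Proof. exact: qmap_cancel hi_cycV_lin hi_cyc_lin hi_boundV hi_bound hi_cycVK. Qed.
Lemma hi_cohE f : hi_coh (qproj _ f) = qproj _ (hi_cyc f).
Proof. exact: qmapE hi_cyc_lin hi_bound f. Qed.
Lemma hi_cohVE z : hi_cohV (qproj _ z) = qproj _ (hi_cycV z).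
Proof. exact: qmapE hi_cycV_lin hi_boundV z. Qed.
End HomComplex.

(** * The bar and cobar constructions represent the twisted cochains *)

Section Units.
Variables (k : comPzRingType) (A : cdgAlg k) (C : dgCoalg k).
Local Notation sg := (ksign 1).

Lemma ksign_aone : sg (@aone k A) = aone.
Proof. by rewrite (ksignE _ (@aone_deg k A)) mulr0 sgn0 scale1r. Qed.

(** From [1 = 1 1], the Leibniz rule gives [d 1 = d 1 + d 1]. *)
Lemma adif_aone : adif (@aone k A) = 0.
Proof.
have := adif_amul (@aone k A) aone.
by rewrite ksign_aone !amul1a amula1 => /(congr1 (+%R^~ (- adif aone))) /=;
   rewrite subrr addrK.
Qed.

Lemma ccounit_sign n (x : C) : ccounit (ksign n x) = ccounit x.
Proof.
move: x; apply: (@hext k C k^o) => [a x y|a x y|i x hx].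
- by rewrite ksign_lin ccounit_lin.
- by rewrite ccounit_lin.
rewrite (ksignE _ hx); case: (i =P 0) => [->|/eqP i0].
  by rewrite mulr0 sgn0 scale1r.
by rewrite !(ccounit_deg i0) //; apply: homogZ.
Qed.

(** Expanding [Delta d] and applying the counit on both sides gives
[eta d = eta d + eta d]. *)
Lemma ccounit_cdif (x : C) : ccounit (cdif x) = 0.
Proof.
pose eta : C -> (k^o : lmodType k) := ccounit.
have el : linear eta by exact: ccounit_lin.
have E1 (t : tens C C) :
    eta (tlift (fun y z => ccounit y *: z) (tmap cdif id t)) =
    eta (cdif (tlift (fun y z => ccounit z *: y) t)).
  move: t; apply: tens_ext => [||y z]; [lint|lint|].
  by peval; rewrite (linZ (@cdif_lin _ _)) !(linZ el); apply: mulrC.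
have E2 (t : tens C C) :
    eta (tlift (fun y z => ccounit y *: z) (@ktens k C C C C 1 id cdif t)) =
    eta (cdif (tlift (fun y z => ccounit y *: z) t)).
  have h : linear (@ktens k C C C C 1 id cdif) by lint.
  move: t; apply: tens_ext => [||y z]; [lint|lint|].
  by peval; rewrite ccounit_sign (linZ (@cdif_lin _ _)).
have := congr1 (fun t => eta (tlift (fun y z => ccounit y *: z) t)) (cdif_delta x).
rewrite ccounitl ktens0 (linD (tlift_lin (@counitl_bil _ _ _))) (linD el) E1 E2.
rewrite ccounitl ccounitr => /(congr1 (+%R^~ (- eta (cdif x)))) /=.
by rewrite subrr addrK => h; apply: esym h.
Qed.
End Units.

Section LeftIso.
Variables (k : comPzRingType) (A : cdgAlg k) (C : dgCoalg k) (tau : C -> A).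
Hypothesis mc : maurer_cartan tau.
Variables (N : dgComod C) (M : cdgMod A).
Local Notation sg := (ksign 1).

Definition cobar_res (f : gtens N A -> M) (x : N) : M := f (tpure x aone).
Definition cobar_ext (g : N -> M) : gtens N A -> M :=
  tlift (fun x a => mact (g x) a).

Lemma cobar_ext_dhom n g : isHom n g ->
  mod_dhom (cobar_ob mc N) M n (cobar_ext g).
Proof.
move=> hg; have gl := hg.1.
have el : linear (cobar_ext g) by rewrite /cobar_ext; lint.
split.
  apply: tens_isHom => // i j x a hx ha; rewrite /cobar_ext; peval.
  by rewrite addrAC; apply: mact_deg => //; apply: hg.2.
move=> t b; move: t; rewrite /= /cobar_act.
apply: tens_ext => [||x a]; [lint|lint|].
by rewrite /cobar_ext; peval; rewrite mactA.
Qed.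

(** [N ⊗ A] is free on [N ⊗ 1]. In [d_tau] the twisting term is the value of [f] on
the part of [d (x ⊗ 1)] coming from [tau]. *)
Lemma cobar_hom_iso : @hom_iso k A C tau N M (mod_dg A) (cobar_ob mc N) M
  cobar_res cobar_ext.
Proof.
split.
- move=> n f [hf _]; split=> [a x y|i x hx].
    by rewrite /cobar_res tpureDl tpureZl hf.1.
  by apply: hf.2; rewrite -[i]addr0; apply: homog_tpure; [|exact: aone_deg].
- exact: cobar_ext_dhom.
- by [].
- move=> n g hg; apply/funext => x; have gl := hg.1.
  by rewrite /cobar_res /cobar_ext; peval; rewrite mact1.
- move=> n f [hf fa]; have fl := hf.1; apply/funext.
  have rl : linear (cobar_res f).
    by move=> a x y; rewrite /cobar_res tpureDl tpureZl fl.
  rewrite /cobar_ext; apply: tens_ext => [||x a]; [lint|lint|].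
  by peval; rewrite /cobar_res -fa /= cobar_actE amul1a.
- move=> n f [hf fa]; have fl := hf.1; apply/funext => x.
  have rl : linear (cobar_res f).
    by move=> a y z; rewrite /cobar_res tpureDl tpureZl fl.
  have tl := mc_lin mc.
  rewrite /cobar_res /= /ftau_fun cobar_difE // adif_aone tpure0r addr0 (linD fl).
  rewrite sgnD sgn1 mulrN1 scaleNr scalerDr opprD addrA; congr (_ - _ *: _).
  move: (ncoact x); apply: tens_ext => [||y z]; [lint|lint|].
  by peval; rewrite -fa /= cobar_actE amul1a amula1.
Qed.
End LeftIso.

Section RightIso.
Variables (k : comPzRingType) (A : cdgAlg k) (C : dgCoalg k) (tau : C -> A).
Hypothesis mc : maurer_cartan tau.
Variables (N : dgComod C) (M : cdgMod A).
Local Notation sg := (ksign 1).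

(** The cofree projection [1 ⊗ eta]. *)
Definition counit_proj : gtens M C -> M := tlift (fun m c => ccounit c *: m).

Definition bar_res (f : N -> gtens M C) (x : N) : M := counit_proj (f x).
Definition bar_ext (g : N -> M) (x : N) : gtens M C := tmap g id (ncoact x).

Lemma counit_proj_lin : linear counit_proj.
Proof. by rewrite /counit_proj; lint. Qed.

Lemma counit_proj_hom : isHom 0 counit_proj.
Proof.
apply: tens_isHom => [|i j m c hm hc]; first exact: counit_proj_lin.
rewrite /counit_proj addr0; peval; case: (j =P 0) => [->|/eqP j0].
  by rewrite addr0; apply: homogZ.
by rewrite (ccounit_deg j0 hc) scale0r; apply: homog0.
Qed.

(** This makes a comodule map into [M ⊗ C] recoverable from its composite with
[1 ⊗ eta]. *)
Lemma counit_proj_coact t : tmap counit_proj id (@bar_coact k A C M t) = t.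
Proof.
have pl := counit_proj_lin; have cl := @bar_coact_lin k A C M.
move: t; apply: tens_ext => [||m c]; [lint|lint|].
rewrite bar_coactE -[c in RHS]ccounitl; move: (cdelta c).
apply: tens_ext => [||y z]; [lint|lint|].
by rewrite /counit_proj; peval; rewrite tpureZl tpureZr.
Qed.

(** The failure of [1 ⊗ eta] to commute with the differentials is the twisting
term, because [eta d = 0]. *)
Lemma counit_proj_dif t : counit_proj (bar_dif tau t) =
  mdif (counit_proj t) - tlift mact (ktens 1 counit_proj tau (bar_coact t)).
Proof.
have pl := counit_proj_lin; have cl := @bar_coact_lin k A C M.
have dl := @bar_dif_lin k A C tau mc M; have tl := mc_lin mc.
move: t; apply: tens_ext => [||m c]; [lint|lint|].
rewrite (bar_difE mc) bar_coactE (linB pl) (linD pl).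
rewrite {1 2 4}/counit_proj; peval; rewrite ccounit_cdif scale0r addr0.
rewrite (linZ (@mdif_lin _ _ _)); congr (_ - _).
have -> : counit_proj (tmap (fun y => mact (sg m) (tau y)) id (cdelta c)) =
    mact (sg m) (tau (tlift (fun y z => ccounit z *: y) (cdelta c))).
  move: (cdelta c); apply: tens_ext => [||y z]; [lint|lint|].
  rewrite /counit_proj; peval.
  by rewrite (linZ tl) (linZ (@mact_linr _ _ _ _)).
rewrite ccounitr -[c in LHS]ccounitl.
move: (cdelta c); apply: tens_ext => [||y z]; [lint|lint|].
peval; rewrite ksign_tpure /counit_proj; peval; rewrite ccounit_sign.
by rewrite (linZ tl) (linZ (@mact_linr _ _ _ _)) (linZ (@mact_linl _ _ _ _)).
Qed.

Lemma bar_ext_dhom n g : isHom n g -> comod_dhom N (bar_ob mc M) n (bar_ext g).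
Proof.
move=> hg; have gl := hg.1; split.
  have := isHom_comp (tmap_isHom hg (isHom_id C)) (ncoact_hom N).
  by rewrite addr0 add0r.
move=> x; rewrite /= /bar_coact {1}/bar_ext.
have bl : linear (bar_ext g) by rewrite /bar_ext; lint.
have -> : tmap id cdelta (tmap g id (ncoact x)) =
    tmap g id (tassoc (tmap ncoact id (ncoact x))).
  by rewrite ncoactA !tmap_cmp //; exact: cdelta_lin.
move: (ncoact x); apply: tens_ext => [||y z]; [lint|lint|].
peval; rewrite /bar_ext; move: (ncoact y).
by apply: tens_ext => [||a b]; [lint|lint|]; peval.
Qed.

(** [M ⊗ C] is cofree on [M], so an identity between graded comodule maps into it
may be checked after [1 ⊗ eta]; there [counit_proj_dif] produces [d_tau]. *)
Lemma bar_hom_iso : @hom_iso k A C tau N M (comod_dg C) N (bar_ob mc M)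
  bar_res bar_ext.
Proof.
have pl := counit_proj_lin; have tl := mc_lin mc.
split.
- move=> n f [hf _]; rewrite /bar_res.
  by have := isHom_comp counit_proj_hom hf; rewrite addr0.
- exact: bar_ext_dhom.
- by move=> a f g x; rewrite /bar_res pl.
- move=> n g hg; apply/funext => x; have gl := hg.1.
  rewrite /bar_res /bar_ext -[x in RHS]ncounit.
  move: (ncoact x); apply: tens_ext => [||y z]; [lint|lint|].
  by rewrite /counit_proj; peval; rewrite (linZ gl).
- move=> n f [hf fc]; have fl := hf.1; apply/funext => x.
  rewrite -[RHS]counit_proj_coact; have /= -> := fc x.
  by rewrite tmap_cmp.
- move=> n f [hf fc]; have fl := hf.1; apply/funext => x.
  have rl : linear (bar_res f) by exact: lin_comp pl fl.
  rewrite /bar_res (linB pl) (linZ pl) /= counit_proj_dif; have /= -> := fc x.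
  rewrite /ftau_fun sgnD sgn1 mulrN1 scaleNr addrAC; congr (_ - _ - _).
  move: (ncoact x); apply: tens_ext => [||y z]; [lint|lint|].
  peval; rewrite (ksign_isHom _ _ hf) mul1r (linZ pl).
  by rewrite (linZ (@mact_linl _ _ _ _)).
Qed.
End RightIso.

(** * Naturality and the adjunction *)

Section Naturality.
Variables (k : comPzRingType) (A : cdgAlg k) (C : dgCoalg k).
Variables (N N' : ComC C) (M M' : CA A) (g : mor N' N) (f : mor M M').

Lemma cobar_res_natural (u : gtens N A -> M) x :
  cobar_res (fun t => zfun f (u (tmap (zfun g) id t))) x =
  zfun f (cobar_res u (zfun g x)).
Proof. by have gl := zfunl g; rewrite /cobar_res tmapE. Qed.

Lemma bar_ext_natural (v : N -> M) x : linear v ->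
  bar_ext (fun y => zfun f (v (zfun g y))) x =
  tmap (zfun f) id (bar_ext v (zfun g x)).
Proof.
move=> vl; have [[_ gc] _] := zhomP g; have gl := zfunl g; have fl := zfunl f.
rewrite /bar_ext; have /= -> := gc x.
have vgl : linear (fun y => v (zfun g y)) by exact: lin_comp vl gl.
by rewrite !tmap_cmp //; apply: lin_comp.
Qed.
End Naturality.

Unset Implicit Arguments.

Theorem mainTheorem10 (k : comPzRingType) (A : cdgAlg k) (C : dgCoalg k)
    (tau : C -> A) (mc : maurer_cartan tau) :
  let L : functor (ComC C) (CA A) := cobar mc in
  let R : functor (CA A) (ComC C) := bar mc in
  let QA : functor (CA A) (HA A) := hcat_proj (mod_dg A) in
  let QC : functor (ComC C) (HC C) := hcat_proj (comod_dg C) in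
  let F (N : ComC C) (M : CA A) : complex k := ftau mc N M in
  [/\ frobenius (@conflation k (mod_dg A)) /\
        frobenius (@conflation k (comod_dg C)),
      exact_functor (@conflation k (comod_dg C)) (@conflation k (mod_dg A)) L,
      exact_functor (@conflation k (mod_dg A)) (@conflation k (comod_dg C)) R,
      adjoint L R &
      exists (alpha : forall (N : ComC C) (M : CA A),
                @mor k (HA A) (L N) M -> cohomology 0 (F N M))
             (beta : forall (N : ComC C) (M : CA A),
                cohomology 0 (F N M) -> @mor k (HC C) N (R M)),
        [/\ forall N M, linear (alpha N M) /\ bijective (alpha N M),
            forall N M, linear (beta N M) /\ bijective (beta N M),
            forall (N N' : ComC C) (M M' : CA A)
                (g : mor N' N) (f : mor M M') (u : @mor k (HA A) (L N) M),
              alpha N' M' (fmap QA f \c u \c fmap QA (fmap L g)) =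
              coh_map (ftau_map mc g f) (alpha N M u) &
            forall (N N' : ComC C) (M M' : CA A)
                (g : mor N' N) (f : mor M M') (v : cohomology 0 (F N M)),
              beta N' M' (coh_map (ftau_map mc g f) v) =
              fmap QC (fmap R f) \c beta N M v \c fmap QC g]].
Proof.
move=> L R QA QC F.
have FA := mod_frobenius_data A; have FC := comod_frobenius_data C.
pose HL (N : ComC C) (M : CA A) := cobar_hom_iso mc N M.
pose HR (N : ComC C) (M : CA A) := bar_hom_iso mc N M.
split.
- split; exact: conf_frobenius.
- exact: cobar_exact.
- exact: bar_exact.
- exists (fun N M u => hi_cycV FC (HR N M) (hi_cyc mc (HL N M) u)); split.
  + move=> N M a u v.
    by rewrite (hi_cyc_lin mc (HL N M)) (hi_cycV_lin FC (HR N M)).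
  + move=> N M.
    exists (fun w => hi_cycV FA (HL N M) (hi_cyc mc (HR N M) w)) => w.
      by rewrite hi_cycVK hi_cycK.
    by rewrite hi_cycVK hi_cycK.
  + move=> N N' M M' g f u; apply: zhom_ext => x.
    have [/= hu _] := zhomP u.
    change (bar_ext (cobar_res (fun t => zfun f (zfun u (tmap (zfun g) id t)))) x =
      tmap (zfun f) id (bar_ext (cobar_res (zfun u)) (zfun g x))).
    rewrite -bar_ext_natural; last exact: (hi_u (HL N M) (zhomP u).1).1.
    by congr (bar_ext _ x); apply/funext => y; rewrite cobar_res_natural.
exists (fun N M => hi_coh mc (HL N M)), (fun N M => hi_cohV FC (HR N M)); split.
- move=> N M; split; first exact: (hi_coh_lin mc (HL N M)).
  exists (hi_cohV FA (HL N M)); first exact: hi_cohK.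
  exact: hi_cohVK.
- move=> N M; split; first exact: (hi_cohV_lin FC (HR N M)).
  exists (hi_coh mc (HR N M)); first exact: hi_cohVK.
  exact: hi_cohK.
- move=> N N' M M' g f u; rewrite -[u]qreprK; move: (qrepr u) => {}u.
  have e := congr1 (hi_coh mc (HL N' M'))
    (etrans (fmap_cmp QA (f \c u) (fmap L g)) (congr2 cmp (fmap_cmp QA f u) erefl)).
  rewrite (hi_cohE mc (HL N M)) coh_mapE; apply: etrans (esym e) _.
  apply: etrans (hi_cohE mc (HL N' M') _) _; congr qproj.
  apply: val_inj; apply: val_inj; apply/funext => x.
  exact: (cobar_res_natural g f (zfun u) x).
- move=> N N' M M' g f v; rewrite -[v]qreprK; move: (qrepr v) => {}v.
  have e := etrans (fmap_cmp QC (fmap R f \c hi_cycV FC (HR N M) v) g)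
    (congr2 cmp (fmap_cmp QC (fmap R f) (hi_cycV FC (HR N M) v)) erefl).
  rewrite coh_mapE (hi_cohVE FC (HR N M)) (hi_cohVE FC (HR N' M')).
  refine (etrans _ e); congr qproj; apply: zhom_ext => x.
  exact: (bar_ext_natural g f x (smP (val v)).1).
Qed.
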